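(* Assume $d\ge5$. The following limit exists (in $[0,\infty]$) for all $x>0$: $$\psi_d(x):=-\lim_{n\to\infty}\frac1n\log\mathbb P\big(\mathrm{Cap}(\mathcal R_n)\ge n\cdot x\big).$$ Furthermore, there exists a constant $\gamma_d^*>\gamma_d$ such that the function $\psi_d$ is continuous and convex on $[0,\gamma_d^*]$, increasing on $[\gamma_d,\gamma_d^*]$, and satisfies $$\psi_d(x)\ \begin{cases}=0 & \text{if }x\le\gamma_d,\\ \in(0,\infty) & \text{if }x\in(\gamma_d,\gamma_d^*],\\ =\infty & \text{if }x>\gamma_d^*.\end{cases}$$
   Context: $(S_n)_{n\ge 0}$ is the simple random walk on $\mathbb Z^d$ started from the origin, and $\mathcal R_n:=\{S_0,\dots,S_n\}$. $\mathbb P_x$ is the law of a simple random walk started from $x$, $\mathbb P=\mathbb P_0$. For $A\subset\mathbb Z^d$, $H_A^+:=\inf\{n\ge 1: S_n\in A\}$. The capacity of a finite set $A\subset \mathbb Z^d$ is $\mathrm{Cap}(A):=\sum_{x\in A}\mathbb P_x(H_A^+=\infty)$. The constant $\gamma_d$ is the almost sure limit $\gamma_d:=\lim_{n\to\infty}\frac1n\mathrm{Cap}(\mathcal R_n)$, which is known to exist and to be a positive deterministic constant when $d\ge5$. Convention: $\log 0=-\infty$, and $\psi_d(0)=0$ (which is what the defining formula gives at $x=0$). *)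

(* Defs.v *)
From HB Require Import structures.
From mathcomp Require Import all_boot all_order all_algebra finmap.
From mathcomp Require Import all_classical all_reals all_analysis.

Set Implicit Arguments.
Unset Strict Implicit.
Unset Printing Implicit Defensive.

Import Order.TTheory GRing.Theory Num.Theory.
Import numFieldNormedType.Exports.

Local Open Scope classical_set_scope.
Local Open Scope ring_scope.

Section SimpleRandomWalk.
Context (R : realType) (disp : measure_display) (Omega : measurableType disp).
Variables (P : probability Omega R) (d : nat).

(* [E] is meant to be countable, and it carries its discrete sigma-algebra. *)
Definition discrete_rv (E : Type) (X : Omega -> E) : Prop :=
  forall B : set E, measurable (X @^-1` B).

Definition mutually_independent (E : Type) (X : nat -> Omega -> E) : Prop :=
  forall (J : seq nat) (B : nat -> set E), uniq J ->
    P (\bigcap_(j in [set` J]) (X j @^-1` B j)) =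
    (\prod_(j <- J) P (X j @^-1` B j))%E.

Definition increment (S : nat -> Omega -> 'rV[int]_d) (n : nat) (w : Omega) :
  'rV[int]_d := S n.+1 w - S n w.

Definition simple_random_walk (S : nat -> Omega -> 'rV[int]_d) : Prop :=
  [/\ forall w, S 0%N w = 0,
      forall n, discrete_rv (increment S n),
      mutually_independent (increment S) &
      forall (n : nat) (i : 'I_d),
        P (increment S n @^-1` [set delta_mx 0 i]) = ((2 * d)%:R^-1)%:E /\
        P (increment S n @^-1` [set - delta_mx 0 i]) = ((2 * d)%:R^-1)%:E].

Variable S : nat -> Omega -> 'rV[int]_d.

Definition walk_range (n : nat) (w : Omega) : {fset 'rV[int]_d} :=
  [fset S k w | k in iota 0 n.+1]%fset.

(* The walk started from [x] is realized as [x + S]. *)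
Definition return_time (A : {fset 'rV[int]_d}) (x : 'rV[int]_d) (w : Omega) :
  \bar R :=
  ereal_inf [set (n%:R)%:E | n in [set n : nat | (1 <= n)%N /\ x + S n w \in A]].

Definition capacity (A : {fset 'rV[int]_d}) : R :=
  \sum_(x <- A) fine (P [set w | return_time A x w = +oo%E]).

Definition is_capacity_speed (g : R) : Prop :=
  {ae P, forall w, (fun n => n%:R^-1 * capacity (walk_range n w)) @ \oo --> g}.

Definition log_prob_rate (x : R) (n : nat) : \bar R :=
  ((n%:R^-1)%:E * lne (P [set w | (n%:R * x <= capacity (walk_range n w))%R]))%E.

Definition psi (x : R) : \bar R := (- limn (log_prob_rate x))%E.

End SimpleRandomWalk.

(* Main.v *)
Require Import Defs.
From HB Require Import structures.
From mathcomp Require Import all_boot all_order all_algebra finmap.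
From mathcomp Require Import all_classical all_reals all_analysis.
From mathcomp Require Import lra ring zify.
Set Implicit Arguments.
Unset Strict Implicit.
Unset Printing Implicit Defensive.
Import Order.TTheory GRing.Theory Num.Theory.
Import numFieldNormedType.Exports.
Local Open Scope classical_set_scope.
Local Open Scope ring_scope.

(** A path is a word in the [2d] unit steps.  By the variational formula for the
    capacity and the reflection principle, straight lines maximize the capacity
    among the paths of a given length, and every corner costs a fixed amount;
    gamma* is the capacity per unit length of a line, so that psi = +oo above it
    and psi(gamma* ) = log(2d), since paths close to optimal have few corners
    and are therefore few.  Independent walks of length n glued by connecting
    walks of length o(n) almost add up their capacities when d >= 5, because the
    Green function averaged over a connecting walk of length r is O(r^(-3/2)).
    Gluing blocks of two levels x and y gives, up to a small loss in the level,
    an asymptotic convexity of the rates; mixing with the level gamma* absorbs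
    the loss, which yields existence of the limit, convexity and continuity.
    Subadditivity of the capacity and the exponential Markov inequality make psi
    positive above gamma. *)

(** The capacity is subadditive, so [prob] is not evidently supermultiplicative and Fekete's lemma
    does not apply: gluing only gives a bound at level x - e, and removing e presupposes the
    continuity to be proved. The level gamma* breaks the circle because its rate is at most log(2d),
    the cost of a single word; the price is that the rate must be controlled up to gamma* itself.
    The cost of a corner has two sources. Two different steps can be taken in either order, two
    equal ones cannot, so the two-step kernel gains (2d)^-2 at a corner. This gain is weighted by
    the equilibrium weights of the path, which may be tiny; in that case (I - P)^-1 >= I/2, with P
    the transition operator, makes the variational formula gain from their distance to the weights
    of the line, which are bounded below. The exponent 3/2 serves twice: its series over the
    successive gaps converges, so q blocks lose O(q), and n^2 r^(-3/2) is o(n) for r = e n. *)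

(** * Finite averages over words of steps *)

Section Average.
Variables (R : realType) (d : nat).
Let step := ('I_d * bool)%type.

(** Expectation under n independent uniform steps; recursion on the first step makes first-step
    decompositions hold by computation. *)
Fixpoint avg (n : nat) (F : seq step -> R) : R :=
  if n is m.+1 then (2 * d)%:R^-1 * \sum_(s : step) avg m (fun w => F (s :: w))
  else F [::].

Lemma eq_avg n F1 F2 : (forall w, size w = n -> F1 w = F2 w) ->
  avg n F1 = avg n F2.
Proof.
elim: n F1 F2 => [|n IHn] F1 F2 eqF /=; first exact: eqF.
congr (_ * _); apply: eq_bigr => s _; apply: IHn => w sw.
by apply: eqF; rewrite /= sw.
Qed.

Lemma le_avg n F1 F2 : (forall w, size w = n -> F1 w <= F2 w) ->
  avg n F1 <= avg n F2.
Proof.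
elim: n F1 F2 => [|n IHn] F1 F2 leF /=; first exact: leF.
rewrite ler_wpM2l ?invr_ge0//; apply: ler_sum => s _; apply: IHn => w sw.
by apply: leF; rewrite /= sw.
Qed.

Lemma avg_cat n m F :
  avg (n + m) F = avg n (fun u => avg m (fun v => F (u ++ v))).
Proof.
elim: n F => [|n IHn] F //=.
by congr (_ * _); apply: eq_bigr => s _; rewrite IHn.
Qed.

Lemma avgZ n a F : avg n (fun w => a * F w) = a * avg n F.
Proof.
elim: n F => [|n IHn] F //=.
by under eq_bigr do rewrite IHn; rewrite -mulr_sumr mulrCA.
Qed.

Lemma avgD n F1 F2 : avg n (fun w => F1 w + F2 w) = avg n F1 + avg n F2.
Proof.
elim: n F1 F2 => [|n IHn] F1 F2 //=.
by under eq_bigr do rewrite IHn; rewrite big_split mulrDr.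
Qed.

Lemma avg0 n : avg n (fun=> 0) = 0.
Proof. by elim: n => [|n IHn] //=; rewrite IHn sumr_const mul0rn mulr0. Qed.

Lemma avg_sum (I : Type) (r : seq I) n (F : I -> seq step -> R) :
  avg n (fun w => \sum_(i <- r) F i w) = \sum_(i <- r) avg n (F i).
Proof.
elim: r => [|i r IHr]; first by under eq_avg do rewrite big_nil; rewrite big_nil avg0.
under eq_avg do rewrite big_cons.
by rewrite avgD IHr big_cons.
Qed.

Lemma avg_exchange n m (F : seq step -> seq step -> R) :
  avg n (fun u => avg m (F u)) = avg m (fun v => avg n (F^~ v)).
Proof.
elim: n F => [|n IHn] F //=.
under eq_bigr do rewrite IHn.
by rewrite -avg_sum -avgZ.
Qed.

Lemma avg_ge0 n F : (forall w, size w = n -> 0 <= F w) -> 0 <= avg n F.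
Proof. by move=> F0; rewrite -(avg0 n) le_avg. Qed.

Lemma avgM n m F1 F2 :
  avg n (fun u => avg m (fun v => F1 u * F2 v)) = avg n F1 * avg m F2.
Proof.
under eq_avg do rewrite avgZ mulrC.
by rewrite avgZ mulrC.
Qed.

Hypothesis d_gt0 : (0 < d)%N.

Lemma card_step : #|{: step}| = (2 * d)%N.
Proof. by rewrite card_prod card_ord card_bool mulnC. Qed.

Lemma step_neq0 : (2 * d)%:R != 0 :> R.
Proof. by rewrite pnatr_eq0 -lt0n muln_gt0. Qed.

Lemma mean_const a : (2 * d)%:R^-1 * (\sum_(s : step) a) = a :> R.
Proof.
by rewrite sumr_const card_step -[a *+ _]mulr_natl mulrA mulVf ?mul1r// step_neq0.
Qed.

Lemma avg_const n a : avg n (fun=> a) = a.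
Proof. by elim: n => [|n IHn] //=; rewrite IHn mean_const. Qed.

Lemma avg_ge_word n F u : (forall w, size w = n -> 0 <= F w) -> size u = n ->
  (2 * d)%:R^-1 ^+ n * F u <= avg n F.
Proof.
elim: n F u => [|n IHn] F u F0 /=; first by move=> /size0nil ->; rewrite expr0 mul1r.
case: u => [//|s u] /= [su]; rewrite exprS -mulrA ler_wpM2l ?invr_ge0//.
rewrite (bigD1 s)//= ler_wpDr//.
  by apply: sumr_ge0 => t _; apply: avg_ge0 => w sw; apply: F0; rewrite /= sw.
by apply: (IHn (fun w => F (s :: w))) => // w sw; apply: F0; rewrite /= sw.
Qed.

(** Markov's inequality, through 1 - 1[F <= 2a] <= F/(2a); it will select connecting pieces of small
    interaction with probability at least 1/2. *)
Lemma avg_markov n (F : seq step -> R) (a : R) : (forall w, size w = n -> 0 <= F w) ->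
  0 < a -> avg n F <= a ->
  2^-1 <= avg n (fun w => (F w <= 2 * a)%R%:R).
Proof.
move=> F0 a0 Fa.
have : avg n (fun w => 1 - (F w <= 2 * a)%R%:R) <= avg n (fun w => (2 * a)^-1 * F w).
  apply: le_avg => w sw; rewrite [_ * F w]mulrC; case: (leP (F w)) => h /=.
    by rewrite subrr divr_ge0 ?F0// mulr_ge0// ltW.
  by rewrite subr0 ler_pdivlMr ?mulr_gt0// mul1r ltW.
rewrite avgZ (_ : (fun w => 1 - _) = (fun w => 1 + (-1) * (F w <= 2 * a)%R%:R)); last first.
  by apply/funext => w; rewrite mulN1r.
rewrite avgD avg_const avgZ mulN1r.
have : (2 * a)^-1 * avg n F <= 2^-1.
  by rewrite mulrC ler_pdivrMr ?mulr_gt0// mulKf.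
lra.
Qed.

End Average.

(** * Transition kernel and reflection principle *)

Section Kernel.
Variables (R : realType) (d : nat).
Let step := ('I_d * bool)%type.
Let V := 'rV[int]_d.

Definition vec (s : step) : V :=
  if s.2 then delta_mx 0 s.1 else - delta_mx 0 s.1.

Definition pos (w : seq step) : V := \sum_(s <- w) vec s.

Definition unitv (i : 'I_d) : V := delta_mx 0 i.

Lemma vecE s j : vec s 0 j = if j == s.1 then (if s.2 then 1 else -1) else 0.
Proof. by rewrite /vec; case: s.2; rewrite !mxE /=; case: eqP. Qed.

Lemma pos_nil : pos [::] = 0. Proof. exact: big_nil. Qed.

Lemma pos_cons s w : pos (s :: w) = vec s + pos w. Proof. exact: big_cons. Qed.

Lemma pos_cat u v : pos (u ++ v) = pos u + pos v. Proof. exact: big_cat. Qed.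

Definition flip (s : step) : step := (s.1, ~~ s.2).

Lemma flipK : involutive flip. Proof. by case=> i b; rewrite /flip /= negbK. Qed.

Lemma vec_flip s : vec (flip s) = - vec s.
Proof. by rewrite /vec /flip /=; case: s.2 => //=; rewrite opprK. Qed.

Lemma vec_inj : injective vec.
Proof.
move=> [i b] [j c] /rowP vE.
have := vE i; rewrite !vecE /= eqxx; case: eqP => [->|_]; last by case: b {vE}.
by case: b {vE}; case: c.
Qed.

Definition mean (f : V -> R) (x : V) : R :=
  (2 * d)%:R^-1 * \sum_(s : step) f (x + vec s).

Lemma eq_mean f g x : (forall s, f (x + vec s) = g (x + vec s)) ->
  mean f x = mean g x.
Proof. by move=> fg; congr (_ * _); apply: eq_bigr => s _. Qed.

Lemma le_mean f g x : (forall s, f (x + vec s) <= g (x + vec s)) ->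
  mean f x <= mean g x.
Proof. by move=> fg; rewrite ler_wpM2l ?invr_ge0//; apply: ler_sum. Qed.

Lemma meanD f g x : mean (fun y => f y + g y) x = mean f x + mean g x.
Proof. by rewrite /mean big_split mulrDr. Qed.

Lemma meanZ a f x : mean (fun y => a * f y) x = a * mean f x.
Proof. by rewrite /mean -mulr_sumr mulrCA. Qed.

Lemma mean0 x : mean (fun=> 0) x = 0.
Proof. by rewrite /mean big1 ?mulr0. Qed.

Lemma mean_sum (I : Type) (r : seq I) (f : I -> V -> R) x :
  mean (fun y => \sum_(i <- r) f i y) x = \sum_(i <- r) mean (f i) x.
Proof. by rewrite /mean exchange_big /= mulr_sumr. Qed.

Lemma mean_flip f x : mean f x = (2 * d)%:R^-1 * \sum_(s : step) f (x - vec s).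
Proof.
congr (_ * _); rewrite (reindex_inj (inv_inj flipK)).
by apply: eq_bigr => s _; rewrite vec_flip.
Qed.

Definition pk (k : nat) (x : V) : R := avg k (fun w => (pos w == x)%:R).

Lemma pk_ge0 k x : 0 <= pk k x. Proof. by apply: avg_ge0. Qed.

Lemma pk0 x : pk 0 x = (x == 0)%:R.
Proof. by rewrite /pk /= pos_nil eq_sym. Qed.

Lemma pkS k x : pk k.+1 x = mean (pk k) x.
Proof.
rewrite mean_flip /pk /=; congr (_ * _); apply: eq_bigr => s _.
by apply: eq_avg => w _; rewrite pos_cons eq_sym [vec s + _]addrC -subr_eq eq_sym.
Qed.

Lemma avg_mean k (f : V -> R) x :
  avg k.+1 (fun w => f (x + pos w)) = mean (fun y => avg k (fun w => f (y + pos w))) x.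
Proof.
congr (_ * _); apply: eq_bigr => s _; apply: eq_avg => w _.
by rewrite pos_cons addrA.
Qed.

Lemma avg_pk k m x : avg k (fun w => pk m (x + pos w)) = pk (k + m) x.
Proof.
elim: k x => [|k IHk] x; first by rewrite /= pos_nil addr0.
rewrite avg_mean addSn pkS; apply: eq_mean => s; exact: IHk.
Qed.

Lemma pkN k x : pk k (- x) = pk k x.
Proof.
elim: k x => [|k IHk] x; first by rewrite !pk0 oppr_eq0.
rewrite !pkS mean_flip /mean; congr (_ * _); apply: eq_bigr => s _.
by rewrite -opprD IHk.
Qed.

Lemma avg_pkB k m x : avg k (fun w => pk m (x - pos w)) = pk (k + m) x.
Proof.
under eq_avg do rewrite -pkN opprB addrC.
by rewrite avg_pk pkN.
Qed.

Section Reflection.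
Variables (h : V -> int) (v : V) (sigma : step -> step).
Hypotheses (hD : forall x y, h (x + y) = h x + h y) (hv : h v = 2).
Hypothesis (hZ : forall (a : int) x, h (a *: x) = a * h x).
Hypotheses (h_vec : forall s, h (vec s) <= 1) (sigmaK : involutive sigma).
Hypothesis vec_sigma : forall s, vec (sigma s) = vec s - h (vec s) *: v.

(* The step distribution is invariant under [y |-> y - h y *: v], and a walk
   cannot jump over the level [c]. *)
Lemma pk_reflect k (c : int) y z : h y <= c -> h z <= c ->
  pk k (y - (h y - c) *: v - z) <= pk k (y - z).
Proof.
elim: k y z => [|k IHk] y z yc zc.
  (* At time 0 the mirror image of y is z only if h z = 2c - h y; as both heights are at most c,
     this puts y on the mirror. *)
  rewrite !pk0 !subr_eq0; case: eqP => [zE|_]; last by rewrite ler0n.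
  have hN (x : V) : h (- x) = - h x by rewrite -scaleN1r hZ mulN1r.
  have : h z = c + c - h y by rewrite -zE hD hN hZ hv; ring.
  move=> hzE; have hyc : h y = c by lia.
  by rewrite -zE hyc subrr scale0r subr0 eqxx.
case: (eqVneq (h y) c) => [->|hyc]; first by rewrite subrr scale0r subr0.
rewrite !pkS /mean (reindex_inj (inv_inj sigmaK)) ler_wpM2l ?invr_ge0//.
apply: ler_sum => s _.
have -> : y - (h y - c) *: v - z + vec (sigma s) =
  (y + vec s) - (h (y + vec s) - c) *: v - z.
  by apply/rowP => l; rewrite vec_sigma hD !mxE; ring.
have -> : y - z + vec s = y + vec s - z by rewrite addrAC.
apply: IHk => //; rewrite hD; have := h_vec s; lia.
Qed.

(** The mirror is at level h x + t, which the two conditions put above both x and the origin; the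
    image of x is x + t v. *)
Lemma pk_push k (t : int) x : 0 <= t -> 0 <= h x + t ->
  pk k (x + t *: v) <= pk k x.
Proof.
move=> t0 xt; have := @pk_reflect k (h x + t) x 0.
have h0 : h 0 = 0 by rewrite -(scale0r 0) hZ mul0r.
rewrite !subr0 h0 (_ : h x - _ = - t); last by ring.
by rewrite scaleNr opprK; apply; lia.
Qed.

End Reflection.

(** Three families of mirrors preserve the lattice: x_i = c here, x_i + x_j = c and x_i - x_j = c in
    the next two lemmas. *)
Lemma pk_push_double k i (t : int) (x : V) : 0 <= t -> 0 <= x 0 i + t ->
  pk k (x + (2 * t) *: unitv i) <= pk k x.
Proof.
move=> t0 xt; rewrite mulrC -scalerA.
pose sg (s : step) : step := (s.1, if s.1 == i then ~~ s.2 else s.2).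
apply: (@pk_push (fun x => x 0 i) (2 *: unitv i) sg) => //.
- by move=> y z; rewrite mxE.
- by rewrite !mxE !eqxx.
- by move=> a y; rewrite mxE.
- by move=> s; rewrite vecE; case: eqP => // _; case: s.2.
- by case=> j b; rewrite /sg /=; case: eqP => //= _; rewrite negbK.
- case=> j b; apply/rowP => l; rewrite !(vecE, mxE) /= /sg /=.
  case: (eqVneq j i) => [->|ji]; first by case: (l == i); case: b.
  by rewrite ?(eq_sym i) ?(negPf ji) mul0r subr0.
Qed.

Lemma pk_push_plus k i j (t : int) (x : V) : i != j -> 0 <= t -> 0 <= x 0 i + x 0 j + t ->
  pk k (x + t *: (unitv i + unitv j)) <= pk k x.
Proof.
move=> ij t0 xt.
pose sg (s : step) : step :=
  (if s.1 == i then j else if s.1 == j then i else s.1,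
   if (s.1 == i) || (s.1 == j) then ~~ s.2 else s.2).
have ji : j != i by rewrite eq_sym.
apply: (@pk_push (fun x => x 0 i + x 0 j) _ sg) => //.
- by move=> y z; rewrite !mxE; ring.
- by rewrite !mxE !eqxx (negPf ij) (negPf ji).
- by move=> a y; rewrite !mxE; ring.
- move=> [l b]; rewrite !vecE /=; case: (eqVneq i l) => [<-|il].
    by rewrite (negPf ji); case: b.
  by case: eqP => // _; case: b.
- case=> l b; rewrite /sg /=; case: (eqVneq l i) => [->|li].
    by rewrite (negPf ji) eqxx orbT negbK.
  by case: (eqVneq l j) => [->|lj] /=; rewrite ?eqxx ?negbK// (negPf li) (negPf lj).
- case=> l b; apply/rowP => m; rewrite !(vecE, mxE) /= /sg /=.
  case: (eqVneq l i) => [->|li].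
    rewrite ?(negPf ji) ?eqxx /=.
    case: (eqVneq m i) => [->|mi]; rewrite ?(negPf ij); first by case: b.
    by case: (m == j); case: b.
  case: (eqVneq l j) => [->|lj].
    rewrite ?(negPf ij) ?eqxx /=.
    case: (eqVneq m j) => [->|mj]; rewrite ?(negPf ji); first by case: b.
    by case: (m == i); case: b.
  by rewrite ?(eq_sym i l) ?(eq_sym j l) ?(negPf li) ?(negPf lj) ?addr0 ?subr0 mul0r subr0.
Qed.

Lemma pk_push_minus k i j (t : int) (x : V) : i != j -> 0 <= t -> 0 <= x 0 i - x 0 j + t ->
  pk k (x + t *: (unitv i - unitv j)) <= pk k x.
Proof.
move=> ij t0 xt.
pose sg (s : step) : step :=
  (if s.1 == i then j else if s.1 == j then i else s.1, s.2).
have ji : j != i by rewrite eq_sym.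
apply: (@pk_push (fun x => x 0 i - x 0 j) _ sg) => //.
- by move=> y z; rewrite !mxE; ring.
- by rewrite !mxE !eqxx (negPf ij) (negPf ji).
- by move=> a y; rewrite !mxE; ring.
- move=> [l b]; rewrite !vecE /=; case: (eqVneq i l) => [<-|il].
    by rewrite (negPf ji); case: b.
  by case: eqP => // _; case: b.
- case=> l b; rewrite /sg /=; case: (eqVneq l i) => [->|li].
    by rewrite (negPf ji) eqxx.
  by case: (eqVneq l j) => [->|lj] /=; rewrite ?eqxx// (negPf li) (negPf lj).
- case=> l b; apply/rowP => m; rewrite !(vecE, mxE) /= /sg /=.
  case: (eqVneq l i) => [->|li].
    rewrite ?(negPf ji) ?eqxx /=.
    case: (eqVneq m i) => [->|mi]; rewrite ?(negPf ij); first by case: b.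
    by case: (m == j); case: b.
  case: (eqVneq l j) => [->|lj].
    rewrite ?(negPf ij) ?eqxx /=.
    case: (eqVneq m j) => [->|mj]; rewrite ?(negPf ji); first by case: b.
    by case: (m == i); case: b.
  by rewrite ?(eq_sym i l) ?(eq_sym j l) ?(negPf li) ?(negPf lj) ?addr0 ?subr0 mul0r subr0.
Qed.

Definition norm1 (x : V) : nat := (\sum_j `|x 0%R j|)%N.

(** Diagonal mirrors empty the coordinates other than i into coordinate i, one after the other,
    without changing the l^1 norm. *)
Lemma pk_norm1_le k i (x : V) : 0 <= x 0 i -> pk k ((norm1 x)%:Z *: unitv i) <= pk k x.
Proof.
have [m] := ubnP #|[pred j | (j != i) && (x 0 j != 0)]|.
elim: m x => // m IHm x; rewrite ltnS => cm xi.
case: (pickP [pred j | (j != i) && (x 0 j != 0)]) => [j /andP[ji xj]|none]; last first.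
  suff -> : (norm1 x)%:Z *: unitv i = x by [].
  have x0 j : j != i -> x 0 j = 0.
    by move=> ji; have := none j; rewrite /= ji /= => /negbFE/eqP.
  have -> : norm1 x = `|x 0%R i|%N.
    by rewrite /norm1 (bigD1 i)//= big1 ?addn0// => j /x0 ->.
  rewrite gez0_abs//; apply/rowP => l; rewrite !mxE /=.
  by case: (eqVneq l i) => [->|/x0 ->]; rewrite ?mulr1 ?mulr0.
pose a := `|x 0 j|.
pose y : V := x + a *: (if 0 <= x 0 j then unitv i - unitv j else unitv i + unitv j).
have ij : i != j by rewrite eq_sym.
have yE l : y 0 l = if l == i then x 0 i + a else if l == j then 0 else x 0 l.
  rewrite /y; case: ifP => xj0; rewrite !mxE /=; case: (eqVneq l i) => [->|li];
    rewrite ?(negPf ij) ?mulr0 ?addr0 ?oppr0 ?subr0 ?mulr1//;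
    case: (eqVneq l j) => [->|lj]; rewrite ?mulr0 ?subr0 ?addr0// /a; lia.
have -> : norm1 x = norm1 y.
  rewrite /norm1 (bigD1 i)//= [RHS](bigD1 i)//= (bigD1 j)//= [in RHS](bigD1 j)//=.
  rewrite !yE eqxx (negPf ji) eqxx.
  under [in RHS]eq_bigr => l /andP[li lj] do rewrite yE (negPf li) (negPf lj).
  rewrite /a; lia.
apply: (@le_trans _ _ (pk k y)); last first.
  rewrite /y; case: ifP => xj0; [apply: pk_push_minus|apply: pk_push_plus] => //;
    rewrite /a; lia.
apply: IHm; last by rewrite yE eqxx /a; lia.
apply: leq_trans cm; apply: proper_card; apply/properP; split.
  apply/fintype.subsetP => l; rewrite !inE => /andP[li]; rewrite yE (negPf li).
  by case: (l == j).
by exists j; rewrite !inE ji//= yE (negPf ji) eqxx.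
Qed.

Lemma norm1_vec x s : (norm1 (x + vec s) = (norm1 x).+1)
  \/ (norm1 x = (norm1 (x + vec s)).+1).
Proof.
rewrite /norm1 (bigD1 s.1)//= (bigD1 (P := predT) s.1)//=.
under eq_bigr => j js do rewrite mxE vecE (negPf js) addr0.
rewrite mxE vecE eqxx; move: (x _ _) (\sum_(_ < d | _) _)%N => a b.
by case: s.2; lia.
Qed.

Lemma norm1_pos w : exists t, (norm1 (pos w) + 2 * t = size w)%N.
Proof.
elim: w => [|s w [t IHw]].
  by exists 0%N; rewrite pos_nil /norm1 big1// => j _; rewrite mxE.
rewrite pos_cons addrC; case: (norm1_vec (pos w) s) => nE /=.
  by exists t; rewrite nE -IHw addSn.
by exists t.+1; rewrite -IHw nE mulnS !addnS addSn.
Qed.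

(** Straight words have the least likely endpoint: the length exceeds the l^1 norm by an even
    number, so pushes along the axis make up for the backtracking. *)
Lemma pk_line_le k i w : pk k ((size w)%:Z *: unitv i) <= pk k (pos w).
Proof.
have [t tE] := norm1_pos w.
have norm1N x : norm1 (- x) = norm1 x.
  by rewrite /norm1; apply: eq_bigr => j _; rewrite mxE abszN.
apply: (@le_trans _ _ (pk k ((norm1 (pos w))%:Z *: unitv i))).
  rewrite -tE PoszD PoszM scalerDl; apply: pk_push_double => //.
  by rewrite !mxE !eqxx /= mulr1 addr_ge0.
case: (leP 0 (pos w 0 i)) => wi; first exact: pk_norm1_le.
by rewrite -norm1N -(pkN _ (pos w)); apply: pk_norm1_le; rewrite mxE oppr_ge0 ltW.
Qed.

Lemma pk2E x : pk 2 x =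
  (2 * d)%:R^-1 ^+ 2 * \sum_(s : step) \sum_(t : step) (vec s + vec t == x)%:R.
Proof.
rewrite /pk /= expr2 -mulrA; congr (_ * _); rewrite mulr_sumr; apply: eq_bigr => s _.
by congr (_ * _); apply: eq_bigr => t _; rewrite !pos_cons pos_nil addr0.
Qed.

(** 2 e_i splits into two steps in one way only, while vec s + vec t can also be taken in the other
    order; each splitting has probability (2d)^-2. *)
Lemma pk2_corner i (s t : step) : s != t ->
  pk 2 (2%:Z *: unitv i) + (2 * d)%:R^-1 ^+ 2 <= pk 2 (vec s + vec t).
Proof.
move=> st; rewrite !pk2E -[X in _ + X]mulr1 -mulrDr ler_wpM2l ?exprn_ge0 ?invr_ge0//.
have -> : \sum_(a : step) \sum_(b : step) (vec a + vec b == 2%:Z *: unitv i)%:R = 1 :> R.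
  have key (a b : step) : vec a + vec b = 2%:Z *: unitv i ->
    (a = (i, true)) /\ (b = (i, true)).
    move=> /rowP/(_ i); rewrite !mxE !vecE !eqxx /= mulr1.
    case: a => a1 a2; case: b => b1 b2 /=.
    by case: eqP => [<-|_]; case: eqP => [<-|_]; case: a2; case: b2.
  rewrite (bigD1 (i, true))//= (bigD1 (i, true))//= big1 => [|b bi]; last first.
    by case: eqP => // /key[_ bE]; rewrite bE eqxx in bi.
  rewrite big1 => [|a ai]; last first.
    by apply: big1 => b _; case: eqP => // /key[aE]; rewrite aE eqxx in ai.
  rewrite !addr0 (_ : _ == _)//; apply/eqP/rowP => l.
  by rewrite mxE !vecE !mxE /=; case: eqP.
rewrite (bigD1 s)//= (bigD1 (P := fun j => j != s) t) ?[t == s]eq_sym//= addrA.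
rewrite ler_wpDr//; first by apply: sumr_ge0 => *; apply: sumr_ge0.
apply: lerD.
  by rewrite (bigD1 t)//= eqxx ler_wpDr//; apply: sumr_ge0.
by rewrite (bigD1 s)//= [vec t + _]addrC eqxx ler_wpDr//; apply: sumr_ge0.
Qed.

End Kernel.

(** * Decay of the transition kernel through its coordinates *)

Section HeatKernel.
Variables (R : realType) (d : nat).
Hypothesis d_gt0 : (0 < d)%N.
Let step := ('I_d * bool)%type.
Let V := 'rV[int]_d.

(** Kernel of the walk on Z; given the numbers of steps per axis, the coordinates of the
    d-dimensional walk are independent with this kernel. *)
Fixpoint bk (n : nat) (z : int) : R :=
  if n is m.+1 then 2^-1 * (bk m (z - 1) + bk m (z + 1)) else (z == 0)%:R.

Lemma bk_bin n z : bk n z = 0 \/ exists k : nat, bk n z = 'C(n, k)%:R / 2 ^+ n.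
Proof.
suff [bk1 bk2] : (forall k : nat, bk n ((2 * k)%:Z - n%:Z) = 'C(n, k)%:R / 2 ^+ n) /\
    (forall z : int, (forall k : nat, z <> (2 * k)%:Z - n%:Z) -> bk n z = 0).
  case: (pselect (exists k : nat, z = (2 * k)%:Z - n%:Z)) => [[k ->]|nk].
    by right; exists k.
  by left; apply: bk2 => k zk; apply: nk; exists k.
elim: n {z} => [|n [IH1 IH2]].
  split=> [[|k]|z zk] /=; first by rewrite bin0 expr0 divr1.
    by rewrite bin0n mul0r.
  by case: eqP => // z0; have := zk 0%N; rewrite z0.
split=> [k|z zk] /=; last first.
  by rewrite !IH2 ?addr0 ?mulr0// => k zE;
    first [by apply: (zk k.+1); lia | by apply: (zk k); lia].
have -> : (2 * k)%:Z - n.+1%:Z + 1 = (2 * k)%:Z - n%:Z by lia.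
have q0 : 2 ^+ n != 0 :> R by rewrite expf_neq0// pnatr_eq0.
rewrite IH1 exprS; case: k => [|k].
  rewrite IH2 => [|j]; last by lia.
  by rewrite !bin0; field.
have -> : (2 * k.+1)%:Z - n.+1%:Z - 1 = (2 * k)%:Z - n%:Z by lia.
by rewrite IH1 binS natrD; field.
Qed.

Lemma bin_odd_mid m : 'C((2 * m).+2, m.+1) = (2 * 'C((2 * m).+1, m))%N.
Proof.
have mid : 'C((2 * m).+1, m.+1) = 'C((2 * m).+1, m).
  by rewrite -bin_sub; [congr 'C(_, _)|]; lia.
by rewrite binS mid; lia.
Qed.

(** From m to m + 1 the left side is multiplied by 4(2m+1)(2m+3)/(m+1)^2 <= 16. This gives [bk] its
    order n^(-1/2) without Stirling's formula. *)
Lemma central_bin_le m : ((2 * m).+1 * 'C(2 * m, m) ^ 2 <= 16 ^ m)%N.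
Proof.
elim: m => [|m IHm] //.
have mE : (m.+1 * 'C(2 * m.+1, m.+1) = 2 * (2 * m).+1 * 'C(2 * m, m))%N.
  have -> : (2 * m.+1 = (2 * m).+2)%N by lia.
  have e0 := mul_bin_diag (2 * m).+1 m; rewrite /= in e0.
  have mid : 'C((2 * m).+1, m.+1) = 'C((2 * m).+1, m).
    by rewrite -bin_sub; [congr 'C(_, _)|]; lia.
  by rewrite bin_odd_mid mulnCA -mid -e0 mulnA.
have m1 : (0 < m.+1 ^ 2)%N by rewrite expn_gt0.
rewrite -(leq_pmul2l m1) mulnCA -expnMn mE expnS.
move: IHm; set c := 'C(2 * m, m); set p := (16 ^ m)%N => IHm.
have h1 : ((2 * m).+3 * (2 * m).+1 <= 4 * m.+1 ^ 2)%N by lia.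
have -> : ((2 * m.+1).+1 * (2 * (2 * m).+1 * c) ^ 2 =
  4 * ((2 * m).+3 * (2 * m).+1) * ((2 * m).+1 * c ^ 2))%N by lia.
apply: (leq_trans (leq_mul (leq_mul (leqnn 4) h1) IHm)).
rewrite [(16 ^ m.+1)%N]expnS -/p; lia.
Qed.

Lemma bin_le_mid n k : (2 * k <= n)%N -> ('C(n, k) <= 'C(n, n./2))%N.
Proof.
have [j] := ubnP (n./2 - k)%N; elim: j k => // j IHj k jk kn.
case: (eqVneq k n./2) => [->//|kn2].
have kn3 : (k < n./2)%N by lia.
apply: leq_trans (IHj k.+1 _ _); [|by lia|by lia].
have := mul_bin_left n k => e.
rewrite -(leq_pmul2l (ltn0Sn k)) e leq_mul2r; apply/orP; right; lia.
Qed.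

Lemma bin_sqr_le n k : (n.+1 * 'C(n, k) ^ 2 <= 4 ^ n)%N.
Proof.
have key : (n.+1 * 'C(n, n./2) ^ 2 <= 4 ^ n)%N.
  have [m [->|->]] : exists m, n = (2 * m)%N \/ n = (2 * m).+1.
    by exists n./2; lia.
  - have -> : ((2 * m)./2 = m)%N by lia.
    by rewrite expnM; exact: central_bin_le.
  - have -> : ((2 * m).+1./2 = m)%N by lia.
    have := central_bin_le m.+1; have -> : (2 * m.+1 = (2 * m).+2)%N by lia.
    rewrite bin_odd_mid !expnS expnM; set p := (16 ^ m)%N.
    rewrite !expn0 !muln1 mulnACA; move: (_ * 'C(_, _))%N => q; lia.
apply: leq_trans key; rewrite leq_mul2l leq_sqr; apply/orP; right.
case: (leqP (2 * k) n) => [|nk]; first exact: bin_le_mid.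
case: (leqP k n) => [kn|nk']; last by rewrite bin_small.
by rewrite -bin_sub//; apply: bin_le_mid; lia.
Qed.

Lemma bk_sqr_le n z : bk n z ^+ 2 <= (n.+1%:R)^-1.
Proof.
have [->|[k ->]] := bk_bin n z; first by rewrite expr2 mulr0 invr_ge0.
rewrite expr_div_n -exprM mulnC exprM -natrX -natrX -natrX.
rewrite ler_pdivrMr ?ltr0n ?expn_gt0// ler_pdivlMl ?ltr0n// -natrM ler_nat.
exact: bin_sqr_le.
Qed.

Definition upd (c : 'I_d -> nat) (i : 'I_d) : 'I_d -> nat :=
  fun j => (c j + (j == i))%N.

(* The expectation of [g] over the numbers of steps taken in each direction. *)
Fixpoint dirs (k : nat) (g : ('I_d -> nat) -> R) : R :=
  if k is m.+1 then d%:R^-1 * \sum_(j < d) dirs m (fun c => g (upd c j))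
  else g (fun=> 0%N).

Lemma dirsZ k a g : dirs k (fun c => a * g c) = a * dirs k g.
Proof.
elim: k g => [|k IHk] g //=.
by under eq_bigr do rewrite IHk; rewrite -mulr_sumr mulrCA.
Qed.

Lemma dirsD k g h : dirs k (fun c => g c + h c) = dirs k g + dirs k h.
Proof.
elim: k g h => [|k IHk] g h //=.
by under eq_bigr do rewrite IHk; rewrite big_split mulrDr.
Qed.

Lemma le_dirs k g h : (forall c, g c <= h c) -> dirs k g <= dirs k h.
Proof.
elim: k g h => [|k IHk] g h gh /=; first exact: gh.
by rewrite ler_wpM2l ?invr_ge0//; apply: ler_sum => j _; apply: IHk => c.
Qed.

Lemma dirs_const k a : dirs k (fun=> a) = a.
Proof.
elim: k => [|k IHk] //=; rewrite IHk sumr_const card_ord -[a *+ _]mulr_natl mulrA mulVf ?mul1r//.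
by rewrite pnatr_eq0 -lt0n.
Qed.

(** Size biasing: each of the k + 1 draws falls on axis i with probability 1/d, and the k remaining
    draws keep their law. *)
Lemma dirs_size_bias k i g :
  dirs k.+1 (fun c => (c i)%:R * g c) = k.+1%:R / d%:R * dirs k (fun c => g (upd c i)).
Proof.
elim: k g => [|k IHk] g.
  rewrite /= (bigD1 i)//= big1 => [|j ji]; last first.
    by rewrite /upd eq_sym (negPf ji) mul0r.
  by rewrite addr0 /upd eqxx mul1r div1r.
have -> : dirs k.+2 (fun c => (c i)%:R * g c) =
    d%:R^-1 * \sum_(j < d) (dirs k.+1 (fun c => (c i)%:R * g (upd c j)) +
      (i == j)%:R * dirs k.+1 (fun c => g (upd c j))).
  rewrite [LHS]/=; congr (_ * _); apply: eq_bigr => j _.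
  rewrite -dirsZ -dirsD; congr (_ * _); apply: eq_bigr => l _; congr (dirs k _).
  by apply/funext => c; rewrite {1}/upd natrD mulrDl.
rewrite big_split /= [X in _ * (_ + X)](bigD1 i)//= eqxx mul1r.
rewrite [X in _ * (_ + (_ + X))]big1 => [|j ji]; last by rewrite eq_sym (negPf ji) mul0r.
rewrite addr0.
have -> : \sum_(j < d) dirs k.+1 (fun c => (c i)%:R * g (upd c j)) =
    k.+1%:R * dirs k.+1 (fun c => g (upd c i)).
  have -> : dirs k.+1 (fun c => g (upd c i)) =
    d%:R^-1 * \sum_(j < d) dirs k (fun c => g (upd (upd c j) i)) by [].
  rewrite mulrA mulr_sumr; apply: eq_bigr => j _.
  rewrite (IHk (fun c => g (upd c j))); congr (_ * dirs k _); apply/funext => c.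
  by congr g; apply/funext => l; rewrite /upd addnAC.
have -> : dirs k.+1 (fun c => g (upd c i)) =
  d%:R^-1 * \sum_(j < d) dirs k (fun c => g (upd (upd c j) i)) by [].
by rewrite -(natr1 k.+1); ring.
Qed.

Definition inv_counts (I : seq 'I_d) (c : 'I_d -> nat) : R :=
  \prod_(i <- I) ((c i).+1%:R)^-1.

(** Size biasing read backwards turns a factor 1/(c i + 1) into d/(k + 1) at the price of one more
    draw, which only lowers the remaining factors. *)
Lemma dirs_inv_counts k I : uniq I ->
  dirs k (inv_counts I) <= (d%:R / k.+1%:R) ^+ size I.
Proof.
elim: I k => [|i I IHI] k.
  by move=> _; rewrite /inv_counts; under [X in dirs k X]funext do rewrite big_nil;
    rewrite dirs_const expr0.
move=> /= /andP[iI uI].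
have [dn0 kn0] : d%:R != 0 :> R /\ k.+1%:R != 0 :> R.
  by rewrite !pnatr_eq0 -lt0n.
have -> : dirs k (inv_counts (i :: I)) = d%:R / k.+1%:R *
    dirs k.+1 (fun c => (c i)%:R * ((c i)%:R^-1 * inv_counts I c)).
  rewrite dirs_size_bias mulrA mulf_div [k.+1%:R * d%:R]mulrC divff ?mulf_neq0//.
  rewrite mul1r; congr dirs; apply/funext => c.
  rewrite /inv_counts big_cons /upd eqxx addn1; congr (_ * _).
  rewrite !big_seq; apply: eq_bigr => j jI.
  by case: eqP jI => [->|]; rewrite ?(negPf iI)// addn0.
rewrite exprS ler_wpM2l ?divr_ge0//.
apply: (@le_trans _ _ (dirs k.+1 (inv_counts I))).
  apply: le_dirs => c; rewrite mulrA -[X in _ <= X]mul1r ler_wpM2r//.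
    by apply: prodr_ge0 => j _; rewrite invr_ge0.
  by case: (c i) => [|n]; rewrite ?mul0r// divff// pnatr_eq0.
apply: (le_trans (IHI _ uI)); rewrite lerXn2r ?nnegrE ?divr_ge0//.
by rewrite ler_wpM2l// lef_pV2 ?posrE// ler_nat.
Qed.

Lemma avg_coords k I (x : V) : uniq I ->
  avg k (fun w => (all (fun i => pos w 0 i == x 0 i) I)%:R) =
  dirs k (fun c => \prod_(i <- I) bk (c i) (x 0 i)).
Proof.
move=> uI; elim: k x => [|k IHk] x.
  rewrite /= pos_nil; elim: I {uI} => [|i I IHI]; first by rewrite big_nil.
  by rewrite big_cons -IHI /= mxE eq_sym -natrM mulnb.
have -> : avg k.+1 (fun w => (all (fun i => pos w 0 i == x 0 i) I)%:R) =
    (2 * d)%:R^-1 * \sum_(s : step)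
      dirs k (fun c => \prod_(i <- I) bk (c i) ((x - vec s) 0 i)).
  rewrite /=; congr (_ * _); apply: eq_bigr => s _; rewrite -IHk; apply: eq_avg => w _.
  congr (_%:R); congr nat_of_bool; apply: eq_all => i.
  by rewrite pos_cons !mxE eq_sym addrC -subr_eq eq_sym.
rewrite natrM invfM mulrC mulrA mulrC [dirs k.+1 _]/=; congr (_ * _).
rewrite -(pair_bigA _ (fun i b => dirs k (fun c => \prod_(l <- I) bk (c l) ((x - vec (i, b)) 0 l)))) /=.
rewrite mulr_suml; apply: eq_bigr => j _.
rewrite big_bool /= -dirsD mulrC -dirsZ; congr dirs; apply/funext => c.
case: (boolP (j \in I)) => jI; last first.
  have vj (b : bool) : \prod_(l <- I) bk (c l) ((x - vec (j, b)) 0 l) =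
      \prod_(l <- I) bk (upd c j l) (x 0 l).
    rewrite !big_seq; apply: eq_bigr => l lI; rewrite !mxE vecE /upd /=.
    by case: eqP lI => [->|]; rewrite ?(negPf jI)// subr0 addn0.
  by rewrite !vj; lra.
have vj (b : bool) : \prod_(l <- I) bk (c l) ((x - vec (j, b)) 0 l) =
    bk (c j) (x 0 j - if b then 1 else -1) * \prod_(l <- I | l != j) bk (upd c j l) (x 0 l).
  rewrite (bigD1_seq j)//= !mxE vecE eqxx /=; congr (_ * _).
  by apply: eq_bigr => l lj; rewrite !mxE vecE /upd /= (negPf lj) subr0 addn0.
rewrite !vj [RHS](bigD1_seq j)//= -mulrDl mulrA; congr (_ * _).
by rewrite /upd eqxx addn1 /= opprK.
Qed.

(** Jensen's inequality in the form 2 m g - m^2 <= g^2, m being the mean of g, then bk^2 <= 1/(c i +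
    1) in each factor: every observed axis contributes (d/(k+1))^(1/2). *)
Lemma avg_coords_sqr k I (x : V) : uniq I ->
  avg k (fun w => (all (fun i => pos w 0 i == x 0 i) I)%:R) ^+ 2 <=
  (d%:R / k.+1%:R) ^+ size I :> R.
Proof.
move=> uI; rewrite avg_coords//; apply: le_trans (dirs_inv_counts k uI).
set g := fun c => _; set m := dirs k g.
have key : dirs k (fun c => 2 * m * g c + - m ^+ 2) <= dirs k (inv_counts I).
  apply: le_dirs => c; apply: (@le_trans _ _ (g c ^+ 2)).
    rewrite -subr_ge0 (_ : _ - _ = (g c - m) ^+ 2) ?sqr_ge0//; ring.
  rewrite /g /inv_counts -prodrXl; apply: ler_prod => i _.
  by rewrite sqr_ge0 bk_sqr_le.
apply: le_trans key; rewrite dirsD dirsZ dirs_const -/m; nra.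
Qed.

End HeatKernel.

(** * The sequence j^(-3/2) *)

Section Decay.
Variable R : realType.

Definition decay (j : nat) : R := (j%:R * Num.sqrt j%:R)^-1.

Lemma decay_ge0 j : 0 <= decay j.
Proof. by rewrite invr_ge0 mulr_ge0// sqrtr_ge0. Qed.

Lemma decay_telescope j : (0 < j)%N ->
  (Num.sqrt j.+1%:R ^+ 5)^-1 <= 2 * (decay j - decay j.+1).
Proof.
move=> j0; rewrite /decay.
have s0 : 0 < Num.sqrt j%:R :> R by rewrite sqrtr_gt0 ltr0n.
have t0 : 0 < Num.sqrt j.+1%:R :> R by rewrite sqrtr_gt0 ltr0n.
have sE : Num.sqrt j%:R ^+ 2 = j%:R :> R by rewrite sqr_sqrtr.
have tE : Num.sqrt j.+1%:R ^+ 2 = j%:R + 1 :> R by rewrite sqr_sqrtr// natr1.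
move: s0 t0 sE tE; set s := Num.sqrt j%:R; set t := Num.sqrt j.+1%:R => s0 t0 sE tE.
have st : s <= t by rewrite ler_sqrt ?ler0n// ler_nat.
have ts : t - s = (t + s)^-1.
  by apply: (mulIf (lt0r_neq0 (addr_gt0 t0 s0))); rewrite mulVf ?gt_eqF ?addr_gt0// -subr_sqr; lra.
have -> : j%:R * s = s ^+ 2 * s by rewrite sE.
have -> : j.+1%:R * t = t ^+ 2 * t by rewrite tE natr1.
have -> : 2 * ((s ^+ 2 * s)^-1 - (t ^+ 2 * t)^-1) =
   2 * (t ^+ 2 + t * s + s ^+ 2) / ((t + s) * (s * s * s) * (t * t * t)).
  have -> : 2 * ((s ^+ 2 * s)^-1 - (t ^+ 2 * t)^-1) =
    2 * ((t - s) * (t ^+ 2 + t * s + s ^+ 2)) / ((s * s * s) * (t * t * t)).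
    by field; rewrite !gt_eqF.
  by rewrite ts; field; rewrite !gt_eqF// addr_gt0.
rewrite ler_pdivlMr; last by rewrite !mulr_gt0// addr_gt0.
have -> : (t ^+ 5)^-1 * ((t + s) * (s * s * s) * (t * t * t)) =
  (t + s) * (s * s * s) / (t * t) by field; rewrite gt_eqF.
rewrite ler_pdivrMr ?mulr_gt0//.
have h1 : (t + s) * s <= 2 * (t ^+ 2 + t * s + s ^+ 2) by nra.
have h2 : s * s <= t * t by nra.
by rewrite (_ : _ * (s * s * s) = (t + s) * s * (s * s)); [nra|ring].
Qed.

Lemma decay_le_telescope j : (0 < j)%N ->
  decay j.+1 <= 2 * ((Num.sqrt j%:R)^-1 - (Num.sqrt j.+1%:R)^-1).
Proof.
move=> j0; rewrite /decay.
have s0 : 0 < Num.sqrt j%:R :> R by rewrite sqrtr_gt0 ltr0n.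
have t0 : 0 < Num.sqrt j.+1%:R :> R by rewrite sqrtr_gt0 ltr0n.
have sE : Num.sqrt j%:R ^+ 2 = j%:R :> R by rewrite sqr_sqrtr.
have tE : Num.sqrt j.+1%:R ^+ 2 = j%:R + 1 :> R by rewrite sqr_sqrtr// natr1.
move: s0 t0 sE tE; set s := Num.sqrt j%:R; set t := Num.sqrt j.+1%:R => s0 t0 sE tE.
have st : s <= t by rewrite ler_sqrt ?ler0n// ler_nat.
have ts : t - s = (t + s)^-1.
  by apply: (mulIf (lt0r_neq0 (addr_gt0 t0 s0))); rewrite mulVf ?gt_eqF ?addr_gt0// -subr_sqr; lra.
have -> : j.+1%:R * t = t ^+ 2 * t by rewrite tE natr1.
have -> : 2 * (s^-1 - t^-1) = 2 / (s * t * (t + s)).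
  have -> : 2 * (s^-1 - t^-1) = 2 * (t - s) / (s * t) by field; rewrite !gt_eqF.
  by rewrite ts; field; rewrite !gt_eqF// addr_gt0.
rewrite ler_pdivlMr ?mulr_gt0 ?addr_gt0// mulrC ler_pdivrMr ?mulr_gt0//.
have h1 : s * (t + s) <= 2 * t ^+ 2 by nra.
have -> : s * t * (t + s) = s * (t + s) * t by ring.
by rewrite mulrA ler_pM2r.
Qed.

Lemma decay1 : decay 1 = 1. Proof. by rewrite /decay sqrtr1 mulr1 invr1. Qed.

Lemma sum_decay q : \sum_(1 <= j < q.+1) decay j <= 3.
Proof.
suff : \sum_(1 <= j < q.+1) decay j <= 3 - 2 * (Num.sqrt q%:R)^-1.
  by move=> /le_trans; apply; rewrite gerBl mulr_ge0// invr_ge0 sqrtr_ge0.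
elim: q => [|q IHq].
  by rewrite big_geq// sqrtr0 invr0; lra.
rewrite big_nat_recr//=; case: q IHq => [|q] IHq.
  by rewrite big_geq// decay1 sqrtr1 invr1; lra.
have := @decay_le_telescope q.+1 isT; lra.
Qed.

Lemma decayM j r : decay (j * r) = decay j * decay r.
Proof. by rewrite /decay natrM sqrtrM// -invfM; congr (_^-1); ring. Qed.

Lemma decay_small (e : R) : 0 < e ->
  exists n0, forall n, (n0 <= n)%N -> n%:R * decay n <= e.
Proof.
move=> e0; exists (Num.truncn (e^-1 ^+ 2)).+1 => n hn.
have n0 : (0 < n)%N by apply: leq_trans hn.
rewrite /decay invfM mulrA divff ?mul1r ?pnatr_eq0 -?lt0n//.
rewrite -[leRHS]invrK lef_pV2 ?posrE ?invr_gt0// ?sqrtr_gt0 ?ltr0n//.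
rewrite -[leLHS]gtr0_norm ?invr_gt0// -sqrtr_sqr ler_sqrt ?ler0n//.
apply: le_trans (ltW (truncnS_gt _)) _; by rewrite ler_nat.
Qed.

(** Pieces of length r about e n take a small fraction of the time, and the interaction n^2 r^(-3/2)
    across them is of order n^(1/2) only. *)
Lemma choose_gap (e : R) : 0 < e -> exists n0, forall n, (n0 <= n)%N ->
  exists r, [/\ (0 < r)%N, r%:R <= e * n%:R & n.+1%:R ^+ 2 * decay r <= e * n%:R].
Proof.
(* The 8 collects the losses in (n + 1)^2 <= 4 n^2 and e n <= 2 r. *)
move=> e0; have [r0 hr0] := @decay_small (e ^+ 2 / 8) (divr_gt0 (exprn_gt0 _ e0) (ltr0n _ 8)).
exists (Num.truncn (e^-1 * (r0 + 2)%:R)).+1 => n hn.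
have n_ge1 : 1 <= n%:R :> R by rewrite ler1n (leq_trans _ hn).
have en : (r0 + 2)%:R <= e * n%:R.
  rewrite mulrC -ler_pdivrMr// mulrC; apply: le_trans (ltW (truncnS_gt _)) _.
  by rewrite ler_nat.
have en0 : 0 <= e * n%:R by rewrite mulr_ge0// ltW.
have r1 : (Num.truncn (e * n%:R))%:R <= e * n%:R by rewrite truncn_le.
have r2 : e * n%:R < (Num.truncn (e * n%:R)).+1%:R by exact: truncnS_gt.
set r := Num.truncn (e * n%:R) in r1 r2 *.
have rr : (r0 + 2 <= r)%N.
  by rewrite -ltnS -(ltr_nat R); apply: le_lt_trans r2.
exists r; split=> //; first by lia.
have r3 : e * n%:R <= 2 * r%:R.
  have : 1 <= r%:R :> R by rewrite ler1n; lia.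
  move: r2; rewrite -natr1; lra.
have h := hr0 r ltac:(lia).
have d0 := decay_ge0 r.
have e1 : n.+1%:R ^+ 2 <= 4 * n%:R ^+ 2 :> R by rewrite -natr1; nra.
have e2 : n.+1%:R ^+ 2 * decay r <= 4 * n%:R ^+ 2 * decay r by rewrite ler_wpM2r.
apply: (le_trans e2); rewrite -(ler_pM2l e0).
have -> : e * (4 * n%:R ^+ 2 * decay r) = 4 * n%:R * (e * n%:R * decay r) by ring.
have -> : e * (e * n%:R) = 4 * n%:R * (2 * (e ^+ 2 / 8)) by field.
rewrite ler_wpM2l ?mulr_ge0//.
apply: le_trans (ler_wpM2r d0 r3) _; rewrite -mulrA; lra.
Qed.

End Decay.

(** * Green function *)

Section Green.
Variables (R : realType) (d : nat).
Hypothesis hd : (5 <= d)%N.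
Let step := ('I_d * bool)%type.
Let V := 'rV[int]_d.
Notation pk := (@pk R d).

Let d_gt0 : (0 < d)%N. Proof. exact: leq_trans hd. Qed.

Definition green_bound : R := 2 * Num.sqrt d%:R ^+ 5.

Lemma green_bound_ge0 : 0 <= green_bound.
Proof. by rewrite mulr_ge0 ?exprn_ge0 ?sqrtr_ge0. Qed.

(** Five coordinates give k^(-5/2) whatever d >= 5 is; the bound is written as a difference so that
    tails of the Green series telescope. *)
Lemma pk_le_decay k x : (0 < k)%N -> pk k x <= green_bound * (decay R k - decay R k.+1).
Proof.
move=> k0.
have h : pk k x ^+ 2 <= (d%:R / k.+1%:R) ^+ 5.
  pose I := take 5 (enum 'I_d).
  have uI : uniq I by rewrite take_uniq ?enum_uniq.
  have sI : size I = 5 by rewrite size_takel// size_enum_ord.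
  have := avg_coords_sqr R d_gt0 k x uI; rewrite sI; apply: le_trans.
  rewrite lerXn2r ?nnegrE ?pk_ge0 ?avg_ge0//.
  apply: le_avg => w _; case: eqP => [->|_]; last exact: ler0n.
  by rewrite (_ : all _ _ = true)//; apply/allP.
have : pk k x <= Num.sqrt (d%:R / k.+1%:R) ^+ 5.
  rewrite -(@ler_pXn2r _ 2)// ?nnegrE ?pk_ge0 ?exprn_ge0 ?sqrtr_ge0//.
  by rewrite exprAC sqr_sqrtr ?divr_ge0.
move=> /le_trans; apply; rewrite sqrtrM// sqrtrV// exprMn exprVn /green_bound.
have S0 : 0 <= Num.sqrt d%:R ^+ 5 :> R by rewrite exprn_ge0 ?sqrtr_ge0.
have := ler_wpM2l S0 (@decay_telescope R k k0).
by rewrite mulrCA mulrA.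
Qed.

Lemma sum_pk_tail r N x : (0 < r)%N -> \sum_(r <= k < N) pk k x <= green_bound * decay R r.
Proof.
move=> r0; case: (leqP r N) => [rN|Nr]; last first.
  by rewrite big_geq ?(ltnW Nr)// mulr_ge0 ?green_bound_ge0 ?decay_ge0.
suff : \sum_(r <= k < N) pk k x <= green_bound * (decay R r - decay R N).
  by move=> /le_trans; apply; rewrite ler_wpM2l ?green_bound_ge0// gerBl decay_ge0.
elim: N rN => [|N IHN]; first by rewrite leqn0 => /eqP r00; rewrite r00 in r0.
rewrite leq_eqVlt => /orP[/eqP <-|rN]; first by rewrite big_geq// subrr mulr0.
rewrite big_nat_recr//=; have := IHN rN.
have := @pk_le_decay N x (leq_trans r0 rN).
rewrite !mulrBr; lra.
Qed.

Definition greenN (N : nat) (x : V) : R := \sum_(0 <= k < N) pk k x.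

Definition green (x : V) : R := limn (greenN ^~ x).

Lemma greenN_nondecreasing x : nondecreasing_seq (greenN ^~ x).
Proof.
by apply/nondecreasing_seqP => n; rewrite /greenN big_nat_recr//= lerDl pk_ge0.
Qed.

Lemma pk_le1 k x : pk k x <= 1.
Proof.
rewrite -[leRHS](avg_const d_gt0 k _); apply: le_avg => w _.
by case: (_ == _).
Qed.

Lemma greenN_ub N x : greenN N x <= 1 + green_bound.
Proof.
rewrite /greenN; case: N => [|N]; first by rewrite big_geq// addr_ge0 ?green_bound_ge0.
rewrite big_nat_recl//= lerD ?pk_le1// -(big_add1 _ _ 0 N.+1 xpredT (fun i => pk i x)).
apply: le_trans (sum_pk_tail _ _ _) _ => //.
by rewrite decay1 mulr1.
Qed.

Lemma cvg_greenN x : greenN ^~ x @ \oo --> green x.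
Proof.
apply: nondecreasing_is_cvgn; first exact: greenN_nondecreasing.
by exists (1 + green_bound) => _ [n _ <-]; exact: greenN_ub.
Qed.

Lemma greenN_le N x : greenN N x <= green x.
Proof.
apply: nondecreasing_cvgn_le; first exact: greenN_nondecreasing.
exact: cvgP (@cvg_greenN x).
Qed.

Lemma green_ge0 x : 0 <= green x.
Proof. by apply: le_trans (greenN_le 0 x); rewrite /greenN big_geq. Qed.

Lemma green_le x a : (forall N, greenN N x <= a) -> green x <= a.
Proof.
by move=> h; apply: limr_le; [exact: cvgP (@cvg_greenN x)|apply: nearW].
Qed.

Lemma le_green x y : (forall k, pk k x <= pk k y) -> green x <= green y.
Proof.
by move=> h; apply: green_le => N; apply: le_trans (greenN_le N y); apply: ler_sum.
Qed.

Lemma le_green_gap x y k c : (forall k, pk k x <= pk k y) -> pk k x + c <= pk k y ->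
  green x + c <= green y.
Proof.
move=> h hc; rewrite -lerBrDr; apply: green_le => N.
rewrite lerBrDr; apply: le_trans (greenN_le (N + k.+1) y).
apply: (@le_trans _ _ (greenN (N + k.+1) x + c)).
  by rewrite lerD2r; apply: greenN_nondecreasing; exact: leq_addr.
rewrite /greenN !(big_cat_nat (n := k.+1) (leq0n _) (leq_addl _ _))/=.
rewrite addrAC lerD//; last exact: ler_sum.
rewrite !big_nat_recr//= -addrA lerD//; exact: ler_sum.
Qed.

Lemma green_opp x : green (- x) = green x.
Proof. by rewrite /green; congr (limn _); apply/funext => n; apply: eq_bigr => k _; rewrite pkN. Qed.

Lemma green_tail r x : (0 < r)%N -> green x - greenN r x <= green_bound * decay R r.
Proof.
move=> r0; rewrite lerBlDr; apply: green_le => N.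
apply: (le_trans (@greenN_nondecreasing x N (r + N) (leq_addl _ _))).
rewrite /greenN (big_cat_nat (n := r) (leq0n _) (leq_addr _ _))/= addrC lerD2r.
exact: sum_pk_tail.
Qed.

(** Averaging over r independent steps shifts the time of the kernel by r, so only the terms k >= r
    of the Green series remain. *)
Lemma avg_green_tail r z : (0 < r)%N ->
  avg r (fun w => green (z - pos w)) <= green_bound * decay R r.
Proof.
move=> r0.
have h N : avg r (fun w => greenN N (z - pos w)) <= green_bound * decay R r.
  rewrite /greenN avg_sum; under eq_bigr do rewrite avg_pkB.
  rewrite (_ : \sum_(_ <= _ < _) _ = \sum_(r <= k < N + r) pk k z) ?sum_pk_tail//.
  have := big_addn 0 (N + r) r xpredT (pk^~ z); rewrite add0n addnK => ->.
  by apply: eq_bigr => i _; rewrite addnC.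
(* [avg] is exchanged with finite sums only, so the Green series is cut at a time that is uniform in
   the point. *)
apply/ler_addgt0Pr => e e0.
have [n0 hn0] := @decay_small R (e / (green_bound + 1)) (divr_gt0 e0 (ltr_wpDl green_bound_ge0 ltr01)).
have tl x : green x <= greenN n0.+1 x + e.
  rewrite -lerBlDl; apply: (le_trans (green_tail x (ltn0Sn n0))).
  have b0 : 0 < green_bound + 1 by rewrite ltr_wpDl ?green_bound_ge0.
  have := hn0 n0.+1 (leqnSn _); rewrite ler_pdivlMr// => h1.
  apply: le_trans h1; rewrite mulrC -mulrA [_ * green_bound]mulrC.
  have dd := decay_ge0 R n0.+1; have g0 := green_bound_ge0.
  have h2 : 1 <= n0.+1%:R :> R by rewrite ler1n.
  have := ler_wpM2r dd h2; nra.
apply: (@le_trans _ _ (avg r (fun w => greenN n0.+1 (z - pos w) + e))).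
  by apply: le_avg => w _; exact: tl.
by rewrite avgD avg_const// lerD2r h.
Qed.

End Green.

(** * Energy forms of finitely supported measures *)

Section Form.
Variables (R : realType) (d : nat).
Let step := ('I_d * bool)%type.
Let V := 'rV[int]_d.
Implicit Types (K : V -> R) (L M : seq (R * V)).

(* A finitely supported signed measure is a list of pairs (weight, point). *)
Definition formK K L M : R :=
  \sum_(p <- L) \sum_(q <- M) p.1 * q.1 * K (p.2 - q.2).

Definition mass L : R := \sum_(p <- L) p.1.

Definition scale (a : R) L := [seq (a * p.1, p.2) | p <- L].

Lemma formK_catl K L1 L2 M : formK K (L1 ++ L2) M = formK K L1 M + formK K L2 M.
Proof. exact: big_cat. Qed.

Lemma formK_catr K L M1 M2 : formK K L (M1 ++ M2) = formK K L M1 + formK K L M2.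
Proof. by rewrite /formK -big_split; apply: eq_bigr => p _; rewrite big_cat. Qed.

Lemma formK_scalel K a L M : formK K (scale a L) M = a * formK K L M.
Proof.
rewrite /formK big_map mulr_sumr; apply: eq_bigr => p _ /=.
by rewrite mulr_sumr; apply: eq_bigr => q _; rewrite !mulrA.
Qed.

Lemma formK_scaler K a L M : formK K L (scale a M) = a * formK K L M.
Proof.
rewrite /formK mulr_sumr; apply: eq_bigr => p _ /=.
rewrite big_map mulr_sumr; apply: eq_bigr => q _ /=.
by rewrite !mulrA (mulrC _ a).
Qed.

Lemma formKC K L M : (forall x, K (- x) = K x) -> formK K L M = formK K M L.
Proof.
move=> KN; rewrite /formK exchange_big /=; apply: eq_bigr => q _.
by apply: eq_bigr => p _; rewrite (mulrC p.1) -KN opprB.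
Qed.

Lemma formKD K1 K2 L M :
  formK (fun x => K1 x + K2 x) L M = formK K1 L M + formK K2 L M.
Proof.
rewrite /formK -big_split; apply: eq_bigr => p _ /=.
by rewrite -big_split; apply: eq_bigr => q _; rewrite mulrDr.
Qed.

Lemma formKZ a K L M : formK (fun x => a * K x) L M = a * formK K L M.
Proof.
rewrite /formK mulr_sumr; apply: eq_bigr => p _ /=.
by rewrite mulr_sumr; apply: eq_bigr => q _; rewrite mulrCA.
Qed.

Lemma eq_formK K1 K2 L M : K1 =1 K2 -> formK K1 L M = formK K2 L M.
Proof.
by move=> K12; apply: eq_bigr => p _; apply: eq_bigr => q _; rewrite K12.
Qed.

(** One step of the walk applied to the measure; by symmetry of the steps it can be moved onto the
    kernel from either argument. *)
Definition smooth L : seq (R * V) :=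
  [seq ((2 * d)%:R^-1 * p.1, p.2 + vec s) | p <- L, s <- enum {: step}].

Lemma formK_smoothl K L M : formK K (smooth L) M = formK (mean K) L M.
Proof.
rewrite /formK /smooth big_allpairs_dep; apply: eq_bigr => p _.
rewrite exchange_big; apply: eq_bigr => q _ /=.
rewrite /mean big_enum /= !mulr_sumr; apply: eq_bigr => s _.
by rewrite addrAC; ring.
Qed.

Lemma formK_smoothr K L M : formK K L (smooth M) = formK (mean K) L M.
Proof.
rewrite /formK; apply: eq_bigr => p _.
rewrite /smooth big_allpairs_dep; apply: eq_bigr => q _ /=.
rewrite mean_flip big_enum /= !mulr_sumr; apply: eq_bigr => s _.
by rewrite opprD addrA; ring.
Qed.

(** This is the squared l^2 norm of the measure. A point may be listed several times, hence the sum
    over distinct points of squares of total weights. *)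
Lemma form_pk0_ge0 L : 0 <= formK (pk R 0) L L.
Proof.
pose Z := undup [seq p.2 | p <- L].
have ind (x y : V) : x \in Z -> (x - y == 0)%:R = \sum_(z <- Z) (x == z)%:R * (y == z)%:R :> R.
  move=> xZ; rewrite (bigD1_seq x) ?undup_uniq//= eqxx mul1r big1 => [|z zx].
    by rewrite addr0 subr_eq0 eq_sym.
  by rewrite eq_sym (negPf zx) mul0r.
have -> : formK (pk R 0) L L =
  \sum_(z <- Z) (\sum_(p <- L) p.1 * (p.2 == z)%:R) ^+ 2.
  rewrite /formK.
  under [RHS]eq_bigr do rewrite expr2 mulr_suml.
  rewrite [RHS]exchange_big /= !big_seq; apply: eq_bigr => p pL.
  under [RHS]eq_bigr do rewrite mulr_sumr.
  rewrite exchange_big; apply: eq_bigr => q _ /=.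
  rewrite pk0 ind ?mulr_sumr; last by rewrite mem_undup map_f.
  by apply: eq_bigr => z _; ring.
by apply: sumr_ge0 => z _; exact: sqr_ge0.
Qed.

Lemma mean_pk k (x : V) : mean (@pk R d k) x = pk R k.+1 x. Proof. by rewrite pkS. Qed.

(** As P is symmetric, this is the squared l^2 norm of [L] smoothed m times. *)
Lemma form_pk_even_ge0 m L : 0 <= formK (pk R (2 * m)) L L.
Proof.
elim: m L => [|m IHm] L; first exact: form_pk0_ge0.
have := IHm (smooth L); rewrite formK_smoothl formK_smoothr.
rewrite (_ : formK _ L L = formK (pk R (2 * m.+1)) L L)//.
apply: eq_formK => x; rewrite mulnS /= -[RHS]mean_pk; apply: eq_mean => s.
by rewrite mean_pk.
Qed.

(* [P^(2m) (I + P)^2] is nonnegative, [P] being the transition operator. *)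
Lemma form_pk_lazy_ge0 m L : 0 <= formK
  (fun x => pk R (2 * m) x + 2 * pk R (2 * m).+1 x + pk R (2 * m).+2 x) L L.
Proof.
have := form_pk_even_ge0 m (L ++ smooth L).
rewrite !formK_catl !formK_catr !formK_smoothl !formK_smoothr.
rewrite !(eq_formK _ _ (@mean_pk _)).
rewrite (eq_formK (K1 := mean (mean _)) (K2 := pk R (2 * m).+2)) => [|x]; last first.
  by rewrite -mean_pk; apply: eq_mean => s; rewrite mean_pk.
rewrite !formKD formKZ; lra.
Qed.

Lemma formK_dist K1 K2 L M (e : R) : (forall x, `|K1 x - K2 x| <= e) ->
  `|formK K1 L M - formK K2 L M| <=
  e * \sum_(p <- L) \sum_(q <- M) `|p.1 * q.1|.
Proof.
move=> K12; rewrite /formK -sumrB mulr_sumr.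
apply: (le_trans (ler_norm_sum _ _ _)); apply: ler_sum => p _.
rewrite -sumrB mulr_sumr; apply: (le_trans (ler_norm_sum _ _ _)).
apply: ler_sum => q _; rewrite -mulrBr normrM mulrC.
by rewrite ler_wpM2r.
Qed.

End Form.

(** * Coercivity of the Green form *)

Section GreenForm.
Variables (R : realType) (d : nat).
Hypothesis hd : (5 <= d)%N.
Let V := 'rV[int]_d.
Implicit Types L : seq (R * V).
Notation green := (@green R d).
Notation form := (formK green).

Lemma decay_to0 (e : R) : 0 < e -> exists n0, forall n, (n0 <= n)%N -> decay R n <= e.
Proof.
move=> e0; have [n0 hn] := decay_small e0.
exists n0.+1 => n n0n; apply: le_trans (hn n (ltnW n0n)).
by rewrite ler_peMl ?decay_ge0// ler1n (leq_ltn_trans (leq0n n0)).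
Qed.

Lemma sum_lazy N (x : V) :
  \sum_(0 <= m < N) (pk R (2 * m) x + 2 * pk R (2 * m).+1 x + pk R (2 * m).+2 x) =
  2 * greenN R (2 * N) x - pk R 0 x + pk R (2 * N) x.
Proof.
elim: N => [|N IHN]; first by rewrite /greenN !big_geq//; ring.
rewrite big_nat_recr//= IHN /greenN.
have -> : (2 * N.+1 = (2 * N).+2)%N by lia.
rewrite (big_nat_recr (2 * N).+1)//= (big_nat_recr (2 * N))//=; ring.
Qed.

(** This is (I - P)^-1 >= I/2. The lazy forms add up to 2 G - I + P^(2N), where G is the Green sum
    cut at time 2N, and P^(2N) vanishes as N grows. *)
Lemma green_form_ge L : 2^-1 * formK (pk R 0) L L <= form L L.
Proof.
set W := \sum_(p <- L) \sum_(q <- L) `|p.1 * q.1|.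
have W0 : 0 <= W by apply: sumr_ge0 => p _; apply: sumr_ge0.
have C0 := green_bound_ge0 R d; set C := green_bound R d in C0.
apply/ler_addgt0Pr => e e0.
have [n0 hn0] := @decay_to0 (e / (2 * C * W + 1)) (divr_gt0 e0 (ltr_wpDl (mulr_ge0 (mulr_ge0 (ler0n _ 2) C0) W0) ltr01)).
pose N := n0.+1.
have dN : C * decay R (2 * N) * W <= e / 2.
  have := hn0 (2 * N)%N; rewrite ler_pdivlMr; last first.
    by rewrite ltr_wpDl ?mulr_ge0.
  move=> h; have {}h := h ltac:(rewrite /N; lia).
  have := decay_ge0 R (2 * N); nra.
have N0 : (0 < 2 * N)%N by rewrite /N.
have h1 : `|form L L - formK (greenN R (2 * N)) L L| <= e / 2.
  apply: le_trans dN; apply: formK_dist => x.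
  by rewrite ger0_norm ?green_tail// subr_ge0 greenN_le.
have h2 : `|formK (pk R (2 * N)) L L - formK (fun=> 0) L L| <= e / 2.
  apply: le_trans dN; apply: formK_dist => x.
  rewrite subr0 ger0_norm ?pk_ge0//; apply: (le_trans (pk_le_decay R hd x N0)).
  by rewrite ler_wpM2l// gerBl decay_ge0.
have h3 : formK (fun=> 0) L L = 0.
  by rewrite /formK big1// => p _; rewrite big1// => q _; rewrite mulr0.
have h4 : 0 <= 2 * formK (greenN R (2 * N)) L L - formK (pk R 0) L L +
    formK (pk R (2 * N)) L L.
  rewrite -formKZ -[- formK _ _ _]mulN1r -formKZ -!formKD.
  rewrite (eq_formK (K2 := fun x => \sum_(0 <= m < N)
    (pk R (2 * m) x + 2 * pk R (2 * m).+1 x + pk R (2 * m).+2 x))) => [|x]; last first.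
    by rewrite sum_lazy mulN1r.
  elim: N {dN N0 h1 h2} => [|m IHm].
    by under eq_formK do rewrite big_geq//; rewrite h3.
  under eq_formK do rewrite big_nat_recr//=.
  by rewrite formKD addr_ge0// form_pk_lazy_ge0.
move: h1 h2; rewrite h3 subr0 !ler_norml => /andP[h1 _] /andP[_ h2]; lra.
Qed.

End GreenForm.

(** * Escape probabilities, equilibrium measure and capacity *)

Section Capacity.
Variables (R : realType) (d : nat).
Hypothesis hd : (5 <= d)%N.
Let V := 'rV[int]_d.
Implicit Types (A B : seq V) (L : seq (R * V)).
Notation green := (@green R d).
Notation form := (formK green).
Notation mean := (@mean R d).

Let d_gt0 : (0 < d)%N. Proof. exact: leq_trans hd. Qed.

(* Avoidance of [A] at times 1, ..., N: the starting point does not count. *)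
Fixpoint escN (N : nat) A (x : V) : R :=
  if N is M.+1 then mean (fun y => (y \notin A)%:R * escN M A y) x else 1.

Lemma escN_ge0 N A x : 0 <= escN N A x.
Proof.
elim: N x => [|N IHN] x //=; rewrite -(mean0 R x); apply: le_mean => s.
by rewrite mulr_ge0.
Qed.

Lemma mean1 (x : V) : mean (fun=> 1) x = 1. Proof. exact: mean_const. Qed.

Lemma escN_le1 N A x : escN N A x <= 1.
Proof.
elim: N x => [|N IHN] x //=; rewrite -[leRHS](mean1 x); apply: le_mean => s.
by case: (_ \notin _); rewrite ?mul1r ?mul0r.
Qed.

Lemma escN_nonincreasing A x : nonincreasing_seq (fun N => escN N A x).
Proof.
apply/nonincreasing_seqP => N; elim: N x => [|N IHN] x; first exact: escN_le1.
by apply: le_mean => s; rewrite ler_wpM2l//; exact: IHN.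
Qed.

Lemma escN_anti N A B x : {subset A <= B} -> escN N B x <= escN N A x.
Proof.
move=> AB; elim: N x => [|N IHN] x //=; apply: le_mean => s.
apply: ler_pM => //; first exact: escN_ge0.
case: (boolP (x + vec s \in A)) => [/AB -> //|_].
by case: (_ \notin _).
Qed.

Lemma escN_shift N A v x : escN N [seq y + v | y <- A] (x + v) = escN N A x.
Proof.
elim: N x => [|N IHN] x //=; congr (_ * _); apply: eq_bigr => s _.
by rewrite addrAC IHN; have /= -> := mem_map (@addIr _ v) A (x + vec s).
Qed.

Definition esc A x : R := limn (fun N => escN N A x).

Lemma cvg_escN A x : (fun N => escN N A x) @ \oo --> esc A x.
Proof.
apply: nonincreasing_is_cvgn; first exact: escN_nonincreasing.
by exists 0 => _ [n _ <-]; exact: escN_ge0.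
Qed.

Lemma esc_le N A x : esc A x <= escN N A x.
Proof.
by apply: nonincreasing_cvgn_ge; [exact: escN_nonincreasing|exact: cvgP (@cvg_escN A x)].
Qed.

Lemma esc_ge A x a : (forall N, a <= escN N A x) -> a <= esc A x.
Proof.
by move=> h; apply: limr_ge; [exact: cvgP (@cvg_escN A x)|apply: nearW].
Qed.

Lemma esc_ge0 A x : 0 <= esc A x. Proof. by apply: esc_ge => N; exact: escN_ge0. Qed.

Lemma esc_le1 A x : esc A x <= 1. Proof. exact: esc_le 0 A x. Qed.

Lemma esc_anti A B x : {subset A <= B} -> esc B x <= esc A x.
Proof. by move=> AB; apply: esc_ge => N; apply: le_trans (escN_anti N x AB); exact: esc_le. Qed.

Lemma esc_shift A v x : esc [seq y + v | y <- A] (x + v) = esc A x.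
Proof. by congr (limn _); apply/funext => N; rewrite escN_shift. Qed.

(* Decomposition according to the last visit to [A] up to time [N]. *)
Lemma last_exit N A x : 1 - (x \notin A)%:R * escN N A x =
  \sum_(0 <= k < N.+1) \sum_(y <- undup A) pk R k (x - y) * escN (N - k) A y.
Proof.
have ind f z : \sum_(y <- undup A) pk R 0 (z - y) * f y = (z \in A)%:R * f z.
  case: (boolP (z \in A)) => zA.
    rewrite (bigD1_seq z) ?undup_uniq ?mem_undup//= pk0 subrr eqxx.
    rewrite big1 ?addr0// => y yz; rewrite pk0 subr_eq0 eq_sym (negPf yz) mul0r//.
  rewrite mul0r big_seq big1// => y; rewrite mem_undup pk0 subr_eq0 => yA.
  by case: eqP yA zA => [->->//|_ _ _]; rewrite mul0r.
elim: N x => [|N IHN] x.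
  by rewrite big_nat1 ind /=; case: (x \in A); rewrite /= ?mulr1 ?mul0r; ring.
rewrite big_nat_recl//= ?subn0 (ind (escN N.+1 A)).
have -> : \sum_(0 <= k < N.+1) \sum_(y <- undup A) pk R k.+1 (x - y) * escN (N.+1 - k.+1) A y =
  mean (fun z => 1 - (z \notin A)%:R * escN N A z) x.
  rewrite (@eq_mean _ _ _ (fun z => \sum_(0 <= k < N.+1) \sum_(y <- undup A) pk R k (z - y) * escN (N - k) A y)) => [|s]; last exact: IHN.
  rewrite mean_sum; apply: eq_bigr => k _; rewrite mean_sum; apply: eq_bigr => y _.
  have -> : mean (fun z => pk R k (z - y) * escN (N - k) A y) x =
    mean (fun z => escN (N - k) A y * pk R k (z - y)) x.
    by apply: eq_mean => s; exact: mulrC.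
  rewrite meanZ mulrC pkS subSS; congr (_ * _); congr (_ * _).
  by apply: eq_bigr => s _; rewrite addrAC.
have -> : mean (fun z => 1 - (z \notin A)%:R * escN N A z) x =
  mean (fun z => 1 + -1 * ((z \notin A)%:R * escN N A z)) x.
  by apply: eq_mean => s; rewrite mulN1r.
rewrite meanD mean1 meanZ -/(escN N.+1 A x); case: (x \in A) => /=; ring.
Qed.

Lemma cvg_sum (I : Type) (r : seq I) (f : I -> nat -> R) (l : I -> R) :
  (forall i, f i @ \oo --> l i) ->
  (fun n => \sum_(i <- r) f i n) @ \oo --> \sum_(i <- r) l i.
Proof.
move=> h; elim: r => [|i r IHr].
  by rewrite big_nil; under eq_fun do rewrite big_nil; exact: cvg_cst.
by rewrite big_cons; under eq_fun do rewrite big_cons; exact: cvgD.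
Qed.

Lemma lim_le_const (u : nat -> R) (l a : R) :
  u @ \oo --> l -> (forall n, u n <= a) -> l <= a.
Proof.
move=> ul ua; rewrite -(cvg_lim _ ul)//.
by apply: limr_le; [exact: cvgP ul|exact: nearW].
Qed.

Lemma lim_ge_const (u : nat -> R) (l a : R) :
  u @ \oo --> l -> (forall n, a <= u n) -> a <= l.
Proof.
move=> ul ua; rewrite -(cvg_lim _ ul)//.
by apply: limr_ge; [exact: cvgP ul|exact: nearW].
Qed.

(** Limit of [last_exit] as N grows; its left side is 1 for x in A. *)
Lemma green_equilibrium A x : x \in A ->
  \sum_(y <- undup A) green (x - y) * esc A y = 1.
Proof.
move=> xA; have LE N : 1 = \sum_(0 <= k < N.+1) \sum_(y <- undup A) pk R k (x - y) * escN (N - k) A y.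
  by rewrite -last_exit xA mul0r subr0.
apply/eqP; rewrite eq_le; apply/andP; split.
  have h N : \sum_(y <- undup A) greenN R N (x - y) * esc A y <= 1.
    rewrite [leRHS](LE N) big_nat_recr//= ler_wpDr//.
      by apply: sumr_ge0 => y _; rewrite mulr_ge0 ?pk_ge0 ?escN_ge0.
    rewrite exchange_big /=; apply: ler_sum => y _.
    rewrite /greenN mulr_suml; apply: ler_sum => k _.
    by rewrite ler_wpM2l ?pk_ge0 ?esc_le.
  apply: lim_le_const h; apply: (cvg_sum (f := fun y N => greenN R N (x - y) * esc A y)) => y.
  by apply: cvgMl; exact: cvg_greenN.
set C := green_bound R d; have C0 : 0 <= C := green_bound_ge0 R d.
set n := size (undup A).
(* For last exits before time M the remaining time N - k tends to infinity; later exits cost at most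
   the Green tail beyond M at each point of A. *)
have h M : (0 < M)%N -> 1 <= \sum_(y <- undup A) green (x - y) * esc A y + n%:R * (C * decay R M).
  move=> M0.
  have h1 m : 1 <= \sum_(y <- undup A) greenN R M (x - y) * escN m A y + n%:R * (C * decay R M).
    rewrite {1}(LE (M + m)%N) (big_cat_nat (n := M) (leq0n _)) /=; last by lia.
    apply: lerD.
      rewrite exchange_big /=; apply: ler_sum => y _.
      rewrite /greenN mulr_suml !big_nat; apply: ler_sum => k /andP[_ kM].
      rewrite ler_wpM2l ?pk_ge0//; apply: escN_nonincreasing; lia.
    rewrite exchange_big /= /n -sum1_size natr_sum mulr_suml; apply: ler_sum => y _.
    rewrite mul1r; apply: le_trans (sum_pk_tail R hd (M + m).+1 (x - y) M0).
    apply: ler_sum => k _; rewrite -[leRHS]mulr1 ler_wpM2l ?pk_ge0 ?escN_le1//.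
  have h2 : 1 <= \sum_(y <- undup A) greenN R M (x - y) * esc A y + n%:R * (C * decay R M).
    apply: lim_ge_const h1; apply: cvgD; last exact: cvg_cst.
    apply: (cvg_sum (f := fun y m => greenN R M (x - y) * escN m A y)) => y.
    by apply: cvgMr; exact: cvg_escN.
  apply: (le_trans h2); rewrite lerD2r; apply: ler_sum => y _.
  by rewrite ler_wpM2r ?esc_ge0 ?greenN_le.
apply/ler_addgt0Pr => e e0.
have p0 : 0 < n%:R * C + 1 by rewrite ltr_wpDl ?mulr_ge0.
have [n0 hn0] := @decay_to0 R (e / (n%:R * C + 1)) (divr_gt0 e0 p0).
apply: (le_trans (h n0.+1 isT)); rewrite lerD2l.
have := hn0 n0.+1 (leqnSn _); rewrite ler_pdivlMr//.
have := decay_ge0 R n0.+1; rewrite mulrA; nra.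
Qed.

Definition equilibrium A : seq (R * V) := [seq (esc A y, y) | y <- undup A].

Definition cap A : R := \sum_(y <- undup A) esc A y.

Lemma cap_ge0 A : 0 <= cap A.
Proof. by apply: sumr_ge0 => y _; exact: esc_ge0. Qed.

Lemma mass_equilibrium A : mass (equilibrium A) = cap A.
Proof. by rewrite /mass big_map. Qed.

Lemma form_equilibrium L A : {in L, forall p, p.2 \in A} ->
  form L (equilibrium A) = mass L.
Proof.
move=> LA; rewrite /formK /mass !big_seq; apply: eq_bigr => p pL.
rewrite big_map -[RHS]mulr1 -(green_equilibrium (LA p pL)) mulr_sumr.
by apply: eq_bigr => y _ /=; rewrite -mulrA (mulrC (esc _ _)).
Qed.

Lemma mem_equilibrium A : {in equilibrium A, forall p, p.2 \in A}.
Proof. by move=> _ /seq.mapP[y yA ->]; rewrite -mem_undup. Qed.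

(* The equilibrium measure maximizes [2 mass L - form L L] among the measures
   carried by [A], and the form dominates half of the squared l^2 norm. *)
Lemma cap_variational L A : {in L, forall p, p.2 \in A} ->
  2 * mass L - form L L +
    2^-1 * formK (pk R 0) (L ++ scale (-1) (equilibrium A)) (L ++ scale (-1) (equilibrium A))
  <= cap A.
Proof.
move=> LA; have := green_form_ge hd (L ++ scale (-1) (equilibrium A)).
set X := formK (pk R 0) _ _.
rewrite !formK_catl !formK_catr !formK_scalel !formK_scaler.
rewrite (formKC (equilibrium A) L) => [|x]; last exact: green_opp.
rewrite !form_equilibrium//; last exact: mem_equilibrium.
rewrite mass_equilibrium; lra.
Qed.

Lemma cap_ge_mass L A : {in L, forall p, p.2 \in A} ->
  2 * mass L - form L L <= cap A.
Proof.
move=> LA; apply: le_trans (cap_variational LA).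
by rewrite lerDl mulr_ge0 ?invr_ge0 ?form_pk0_ge0.
Qed.

Lemma form_equilibrium_self A : form (equilibrium A) (equilibrium A) = cap A.
Proof. by rewrite form_equilibrium ?mass_equilibrium//; exact: mem_equilibrium. Qed.

(** The equilibrium measure of A is a test measure on B, of value 2 cap A - cap A. *)
Lemma cap_mono A B : {subset A <= B} -> cap A <= cap B.
Proof.
move=> AB; have := @cap_ge_mass (equilibrium A) B.
rewrite form_equilibrium_self mass_equilibrium (_ : 2 * _ - _ = cap A); last by ring.
by apply=> p /mem_equilibrium/AB.
Qed.

Lemma eq_cap A B : A =i B -> cap A = cap B.
Proof. by move=> AB; apply/eqP; rewrite eq_le !cap_mono// => x; rewrite AB. Qed.

Lemma cap_shift A v : cap [seq x + v | x <- A] = cap A.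
Proof.
rewrite /cap undup_map_inj; last exact: addIr.
by rewrite big_map; apply: eq_bigr => y _; rewrite esc_shift.
Qed.

Lemma ler_sum_undup (f : V -> R) A : (forall x, 0 <= f x) ->
  \sum_(x <- undup A) f x <= \sum_(x <- A) f x.
Proof.
move=> f0; elim: A => [|x A IHA] //=; rewrite big_cons.
by case: ifP => _; [rewrite ler_wpDl|rewrite big_cons lerD2l].
Qed.

Lemma cap_le_size A : cap A <= (size A)%:R.
Proof.
apply: (le_trans (ler_sum_undup _ (esc_ge0 A))).
by rewrite -sum1_size natr_sum; apply: ler_sum => x _; exact: esc_le1.
Qed.

Lemma cap_cat_le A B : cap (A ++ B) <= cap A + cap B.
Proof.
rewrite /cap undup_cat big_cat /= big_filter; apply: lerD.
  apply: (@le_trans _ _ (\sum_(y <- undup A) esc (A ++ B) y)).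
    by rewrite [leRHS](bigID (fun x => x \notin B)) /= lerDl sumr_ge0// => y _; exact: esc_ge0.
  by apply: ler_sum => y _; apply: esc_anti => z zA; rewrite mem_cat zA.
by apply: ler_sum => y _; apply: esc_anti => z zA; rewrite mem_cat zA orbT.
Qed.

(** The test measure is the sum of the two equilibrium measures, even if A and B overlap; in the
    cross energy their weights are bounded by 1. *)
Lemma cap_cat_ge A B : cap A + cap B -
  2 * \sum_(x <- A) \sum_(y <- B) green (x - y) <= cap (A ++ B).
Proof.
have := @cap_ge_mass (equilibrium A ++ equilibrium B) (A ++ B).
rewrite !formK_catl !formK_catr !form_equilibrium_self /mass big_cat /=.
rewrite -!/(mass _) !mass_equilibrium.
rewrite (formKC (equilibrium B)) => [|x]; last exact: green_opp.
move=> h; have {h} := h _.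
have : form (equilibrium A) (equilibrium B) <= \sum_(x <- A) \sum_(y <- B) green (x - y).
  rewrite /formK big_map.
  have s0 x : 0 <= \sum_(y <- B) green (x - y) by apply: sumr_ge0 => y _; exact: green_ge0.
  apply: le_trans (ler_sum_undup _ s0); apply: ler_sum => x _.
  have g0 y : 0 <= green (x - y) by exact: green_ge0.
  rewrite big_map /=; apply: le_trans (ler_sum_undup _ g0); apply: ler_sum => y _.
  rewrite ler_piMl ?green_ge0// mulr_ile1 ?esc_ge0 ?esc_le1//.
move=> h1 h2; suff: {in equilibrium A ++ equilibrium B, forall p, p.2 \in A ++ B} by move=> /h2; lra.
by move=> p; rewrite !mem_cat => /orP[] /mem_equilibrium ->; rewrite ?orbT.
Qed.

End Capacity.

(** * Capacity of a word, and gluing of blocks *)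

Section Paths.
Variables (R : realType) (d : nat).
Hypothesis hd : (5 <= d)%N.
Let step := ('I_d * bool)%type.
Let V := 'rV[int]_d.
Implicit Types (u v w U C : seq step) (x y z : V).
Notation green := (@green R d).
Notation cap := (@cap R d).

Let d_gt0 : (0 < d)%N. Proof. exact: leq_trans hd. Qed.

Fixpoint pts x w : seq V := x :: if w is s :: w' then pts (x + vec s) w' else [::].

Lemma pts_shift x z w : pts (x + z) w = [seq y + z | y <- pts x w].
Proof. by elim: w x => [|s w IHw] x //=; rewrite addrAC IHw. Qed.

Lemma size_pts x w : size (pts x w) = (size w).+1.
Proof. by elim: w x => [|s w IHw] x //=; rewrite IHw. Qed.

Lemma mem_pts_cat x u v : pts x (u ++ v) =i pts x u ++ pts (x + pos u) v.
Proof.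
elim: u x => [|s u IHu] x y; last by rewrite /= !inE IHu pos_cons addrA.
by rewrite /= pos_nil addr0 inE; case: v => [|t v] /=; rewrite !inE ?orbb ?orbA ?orbb.
Qed.

Lemma nth_pts x w i : (i <= size w)%N -> nth 0 (pts x w) i = x + pos (take i w).
Proof.
elim: w x i => [|s w IHw] x [|i] //=; rewrite ?pos_nil ?addr0//.
by rewrite ltnS => iw; rewrite IHw// pos_cons addrA.
Qed.

Definition capw w : R := cap (pts 0 w).

Lemma cap_pts x w : cap (pts x w) = capw w.
Proof. by rewrite -[x]add0r pts_shift cap_shift. Qed.

Lemma capw_ge0 w : 0 <= capw w. Proof. exact: cap_ge0. Qed.

Lemma capw_le_size w : capw w <= (size w).+1%:R.
Proof. by rewrite -(size_pts 0 w); exact: cap_le_size. Qed.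

Lemma capw_cat_le u v : capw (u ++ v) <= capw u + capw v.
Proof.
by rewrite {1}/capw (eq_cap R hd (mem_pts_cat 0 u v)) -(cap_pts (0 + pos u) v); exact: cap_cat_le.
Qed.

Lemma capw_catl u v : capw u <= capw (u ++ v).
Proof. by apply: cap_mono => // y yu; rewrite mem_pts_cat mem_cat yu. Qed.

Definition prob (n : nat) (a : R) : R := avg n (fun w => (a <= capw w)%R%:R).

Lemma prob_ge0 n a : 0 <= prob n a. Proof. by apply: avg_ge0. Qed.

Lemma prob_le1 n a : prob n a <= 1.
Proof.
rewrite -[leRHS](avg_const d_gt0 n 1); apply: le_avg => w _.
by case: (a <= capw w)%R.
Qed.

Lemma prob_anti n a b : a <= b -> prob n b <= prob n a.
Proof.
move=> ab; apply: le_avg => w _; rewrite ler_nat.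
by case: (leP b) => // /(le_trans ab) ->.
Qed.

Lemma prob_mono n m a : (n <= m)%N -> prob n a <= prob m a.
Proof.
move=> nm; rewrite -(subnKC nm) /prob avg_cat; apply: le_avg => u _.
rewrite -[leLHS](avg_const d_gt0 (m - n)); apply: le_avg => v _; rewrite ler_nat.
by case: leP => // /le_trans-/(_ _ (capw_catl u v)) ->.
Qed.

Lemma prob_ge_word n a w : size w = n -> a <= capw w -> (2 * d)%:R^-1 ^+ n <= prob n a.
Proof.
move=> sw aw; rewrite -[leLHS]mulr1.
have := @avg_ge_word R d n (fun w => (a <= capw w)%R%:R) w _ sw.
by rewrite aw; apply => v _; exact: ler0n.
Qed.

Section Blocks.
Variables n r : nat.
Hypothesis r_gt0 : (0 < r)%N.

(* Words are cut into [q] blocks of length [n], each followed by a connecting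
   piece of length [r]; [U] lists the blocks and [C] the connecting pieces. *)
Fixpoint interleave q U C : seq step :=
  if q is q'.+1 then
    take n U ++ take r C ++ interleave q' (drop n U) (drop r C) else [::].

(** Only the points of the blocks: those of the connecting pieces are dropped, which can only lower
    the capacity. *)
Fixpoint bpts q x U C : seq V :=
  if q is q'.+1 then
    pts x (take n U) ++
      bpts q' (x + pos (take n U) + pos (take r C)) (drop n U) (drop r C)
  else [::].

Lemma bpts_shift q x y U C : bpts q (x + y) U C = [seq z + y | z <- bpts q x U C].
Proof.
elim: q x U C => [|q IHq] x U C //=; rewrite map_cat pts_shift; congr (_ ++ _).
by rewrite -IHq; congr bpts; rewrite [x + y + _]addrAC [LHS]addrAC.
Qed.

Lemma mem_bpts q x U C : {subset bpts q x U C <= pts x (interleave q U C)}.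
Proof.
elim: q x U C => [|q IHq] x U C y //=.
rewrite mem_cat mem_pts_cat mem_cat => /orP[-> //|/IHq yi].
by rewrite mem_pts_cat mem_cat yi !orbT.
Qed.

Lemma avg_interleave q F : avg (q * (n + r)) F =
  avg (q * n) (fun U => avg (q * r) (fun C => F (interleave q U C))) :> R.
Proof.
elim: q F => [|q IHq] F //=.
rewrite !mulSn -addnA avg_cat [RHS]avg_cat; apply: eq_avg => u su.
rewrite avg_cat; under eq_avg do rewrite IHq.
rewrite avg_exchange; apply: eq_avg => U sU.
rewrite avg_cat; apply: eq_avg => c sc; apply: eq_avg => C sC.
by rewrite /= -su -sc !take_size_cat// !drop_size_cat.
Qed.

(** The blocks are frozen and only connecting steps are averaged: k of them before the first block,
    r more before each next one. The point z is arbitrary so as to absorb the displacement of a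
    frozen block. *)
Lemma avg_cross q k U z : (0 < k)%N -> size U = (q * n)%N ->
  avg k (fun s => avg (q * r) (fun C =>
    \sum_(y <- bpts q (pos s) U C) green (z - y))) <=
  n.+1%:R * green_bound R d * \sum_(0 <= j < q) decay R (k + j * r).
Proof.
have CB0 := green_bound_ge0 R d.
elim: q k U z => [|q IHq] k U z k0 sU.
  by rewrite big_geq//= mulr0; under eq_avg do rewrite big_nil; rewrite avg0.
pose u := take n U; pose U' := drop n U.
have su : size u = n by rewrite size_takel// sU mulSn leq_addr.
have sU' : size U' = (q * n)%N by rewrite size_drop sU mulSn addKn.
have -> : avg k (fun s => avg (q.+1 * r) (fun C =>
    \sum_(y <- bpts q.+1 (pos s) U C) green (z - y))) =
  \sum_(y <- pts 0 u) avg k (fun s => green (z - y - pos s)) +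
  avg (k + r) (fun s => avg (q * r) (fun C =>
    \sum_(y <- bpts q (pos s) U' C) green (z - pos u - y))) :> R.
  rewrite avg_cat -avg_sum -avgD; apply: eq_avg => s _.
  rewrite mulSn avg_cat -(avg_const d_gt0 r (\sum_(y <- pts 0 u) _)) -avgD.
  apply: eq_avg => c sc.
  rewrite -(avg_const d_gt0 (q * r) (\sum_(y <- pts 0 u) _)) -avgD.
  apply: eq_avg => C sC /=.
  rewrite -/u -/U' big_cat /= -sc take_size_cat// drop_size_cat//; congr (_ + _).
    rewrite -[pos s]add0r pts_shift big_map; apply: eq_bigr => y _.
    by rewrite add0r opprD addrA.
  rewrite pos_cat (addrAC (pos s)) (bpts_shift q (pos s + pos c) (pos u)) big_map; apply: eq_bigr => y _.
  by rewrite opprD addrA addrAC.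
rewrite big_nat_recl//= mul0n addn0 mulrDr; apply: lerD.
  rewrite -mulrA -su -(size_pts 0 u) -sum1_size natr_sum mulr_suml; apply: ler_sum => y _.
  by rewrite mul1r; exact: avg_green_tail.
apply: le_trans (IHq _ _ _ _ sU') _; first by rewrite addn_gt0 k0.
rewrite ler_wpM2l ?mulr_ge0//; apply: ler_sum => j _.
by rewrite mulSn addnA.
Qed.

Fixpoint block_caps q U : R :=
  if q is q'.+1 then capw (take n U) + block_caps q' (drop n U) else 0.

Fixpoint block_err q U C : R :=
  if q is q'.+1 then
    \sum_(x <- pts 0 (take n U)) \sum_(y <- bpts q' (pos (take n U) + pos (take r C))
       (drop n U) (drop r C)) green (x - y) + block_err q' (drop n U) (drop r C)
  else 0.

Lemma block_err_ge0 q U C : 0 <= block_err q U C.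
Proof.
elim: q U C => [|q IHq] U C //=; rewrite addr_ge0//.
by apply: sumr_ge0 => x _; apply: sumr_ge0 => y _; exact: green_ge0.
Qed.

Lemma cap_bpts_ge q U C : block_caps q U - 2 * block_err q U C <= cap (bpts q 0 U C).
Proof.
elim: q U C => [|q IHq] U C; first by rewrite /= mulr0 subr0 cap_ge0.
rewrite /= add0r.
set B := bpts q _ _ _.
have capB : cap B = cap (bpts q 0 (drop n U) (drop r C)).
  by rewrite /B -[pos _ + _]add0r bpts_shift cap_shift.
have := cap_cat_ge R hd (pts 0 (take n U)) B; rewrite capB -/(capw _).
have := IHq (drop n U) (drop r C); lra.
Qed.

(** Blocks at distance j interact by at most a constant times (n+1)^2 (j r)^(-3/2), and the sum over
    j of j^(-3/2) is at most 3: the total error is linear in the number of blocks. *)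
Lemma avg_block_err q U : size U = (q * n)%N ->
  avg (q * r) (block_err q U) <=
  q%:R * (3 * green_bound R d * n.+1%:R ^+ 2 * decay R r).
Proof.
have CB0 := green_bound_ge0 R d.
elim: q U => [|q IHq] U sU; first by rewrite mul0r.
pose u := take n U; pose U' := drop n U.
have su : size u = n by rewrite size_takel// sU mulSn leq_addr.
have sU' : size U' = (q * n)%N by rewrite size_drop sU mulSn addKn.
have -> : avg (q.+1 * r) (block_err q.+1 U) =
  \sum_(x <- pts 0 u) avg r (fun c => avg (q * r) (fun C =>
    \sum_(y <- bpts q (pos c) U' C) green (x - pos u - y))) +
  avg (q * r) (block_err q U') :> R.
  rewrite mulSn avg_cat -avg_sum -(avg_const d_gt0 r (avg _ (block_err q U'))) -avgD.
  apply: eq_avg => c sc; rewrite -avg_sum -avgD; apply: eq_avg => C sC /=.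
  rewrite -/u -/U' -sc take_size_cat// drop_size_cat//; congr (_ + _).
  apply: eq_bigr => x _; rewrite addrC bpts_shift big_map; apply: eq_bigr => y _.
  by rewrite opprD addrA addrAC.
rewrite -natr1 addrC mulrDl mul1r; apply: lerD; first exact: IHq.
have step_le x : avg r (fun c => avg (q * r) (fun C =>
    \sum_(y <- bpts q (pos c) U' C) green (x - pos u - y))) <=
    n.+1%:R * green_bound R d * (3 * decay R r).
  apply: le_trans (avg_cross _ r_gt0 sU') _; rewrite ler_wpM2l ?mulr_ge0//.
  have -> : \sum_(0 <= j < q) decay R (r + j * r) =
      \sum_(1 <= j < q.+1) decay R j * decay R r.
    by rewrite big_add1 /=; apply: eq_bigr => j _; rewrite -mulSn decayM.
  by rewrite -mulr_suml ler_wpM2r ?decay_ge0// sum_decay.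
apply: (@le_trans _ _ (\sum_(x <- pts 0 u) n.+1%:R * green_bound R d * (3 * decay R r))).
  by apply: ler_sum => x _; exact: step_le.
rewrite big_const_seq count_predT size_pts su iter_addr_0 -[_ *+ _]mulr_natl.
by rewrite le_eqVlt; apply/orP; left; apply/eqP; ring.
Qed.

Fixpoint block_ind (a : seq R) U : R :=
  if a is t :: a' then (t <= capw (take n U))%R%:R * block_ind a' (drop n U) else 1.

Lemma avg_block_ind a : avg (size a * n) (block_ind a) = \prod_(t <- a) prob n t.
Proof.
elim: a => [|t a IHa]; first by rewrite big_nil.
rewrite big_cons mulSn avg_cat -IHa -avgM; apply: eq_avg => u su; apply: eq_avg => v sv /=.
by rewrite -su take_size_cat// drop_size_cat.
Qed.

Lemma block_indP a U : block_ind a U = 0 \/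
  (block_ind a U = 1 /\ \sum_(t <- a) t <= block_caps (size a) U).
Proof.
elim: a U => [|t a IHa] U /=; first by right; rewrite big_nil.
rewrite big_cons; case: leP => tu; last by left; rewrite mul0r.
have [->|[-> sa]] := IHa (drop n U); first by left; rewrite mulr0.
by right; rewrite mulr1 lerD.
Qed.

(** For fixed blocks, with probability at least 1/2 the connecting pieces have error at most 2 K, by
    Markov; the error counts twice in the capacity, hence 4 K. *)
Lemma prob_blocks (a : seq R) (K : R) : 0 < K ->
  (size a)%:R * (3 * green_bound R d * n.+1%:R ^+ 2 * decay R r) <= K ->
  2^-1 * \prod_(t <- a) prob n t <=
  prob (size a * (n + r)) (\sum_(t <- a) t - 4 * K).
Proof.
move=> K0 hK; rewrite -avg_block_ind /prob avg_interleave -avgZ; apply: le_avg => U sU.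
have [->|[-> sa]] := block_indP a U; first by rewrite mulr0; apply: avg_ge0.
rewrite mulr1; apply: le_trans (avg_markov d_gt0 (F := block_err (size a) U) _ K0 _) _.
- by move=> C _; exact: block_err_ge0.
- by apply: le_trans hK; exact: avg_block_err.
apply: le_avg => C _; rewrite ler_nat; case: leP => // errK; rewrite (_ : _ <= _)%R//.
apply: (@le_trans _ _ (cap (bpts (size a) 0 U C))).
  by apply: le_trans (cap_bpts_ge _ _ _); lra.
by apply: cap_mono => //; exact: mem_bpts.
Qed.

End Blocks.

End Paths.

(** * Straight lines: escape probability, corners, speed *)

Section Line.
Variables (R : realType) (d : nat).
Hypothesis hd : (5 <= d)%N.
Let step := ('I_d * bool)%type.
Let V := 'rV[int]_d.
Implicit Types (u v w : seq step) (x y z : V).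
Notation green := (@green R d).
Notation cap := (@cap R d).
Notation capw := (@capw R d).
Notation esc := (@esc R d).
Notation escN := (@escN R d).

Let d_gt0 : (0 < d)%N. Proof. exact: leq_trans hd. Qed.

Definition axis : 'I_d := Ordinal d_gt0.

Definition line (n : nat) : seq step := nseq n (axis, true).

Definition linept (k : nat) : V := k%:Z *: unitv axis.

Lemma linepts n x : pts x (line n) = [seq x + linept k | k <- iota 0 n.+1].
Proof.
elim: n x => [|n IHn] x; first by rewrite /= /linept scale0r addr0.
rewrite -[iota 0 n.+2]/(0%N :: iota (1 + 0) n.+1) iotaDl map_cons -map_comp.
rewrite -[pts x _]/(x :: pts (x + vec (axis, true)) (line n)) IHn.
congr (_ :: _); first by rewrite /linept scale0r addr0.
apply: eq_map => k /=; rewrite -addrA /linept; congr (_ + _).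
by rewrite PoszD scalerDl scale1r.
Qed.

Lemma linept_inj : injective linept.
Proof. by move=> i j /rowP/(_ axis); rewrite !mxE !eqxx /= !mulr1 => -[]. Qed.

Lemma size_line n : size (line n) = n. Proof. exact: size_nseq. Qed.

(** Four axes other than [axis]: visits to a subspace of codimension 4 have probability of order
    k^(-2), which is summable. *)
Definition axis_perp : seq 'I_d := take 4 (rem axis (enum 'I_d)).

Lemma uniq_axis_perp : uniq axis_perp.
Proof. by apply: take_uniq; apply: rem_uniq; exact: enum_uniq. Qed.

Lemma size_axis_perp : size axis_perp = 4%N.
Proof. by rewrite size_takel// size_rem ?mem_enum// size_enum_ord -ltnS (ltn_predK hd). Qed.

Lemma axis_perp_neq j : j \in axis_perp -> j != axis.
Proof. by move/mem_take; rewrite mem_rem_uniq ?enum_uniq// => /andP[]. Qed.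

(* A subspace of codimension 4 containing the axis; unlike the finite line it
   is invariant under translations along the axis, and the walk still leaves
   it for ever with positive probability. *)
Definition flat : pred V := fun x => all (fun j => x 0 j == 0) axis_perp.

Lemma flat_line k : flat (linept k).
Proof. by apply/allP => j /axis_perp_neq ja; rewrite !mxE /= (negPf ja) mulr0. Qed.

Lemma flatD x y : flat y -> flat (x + y) = flat x.
Proof.
move=> /allP fy; apply: eq_in_all => j jp.
by rewrite mxE (eqP (fy _ jp)) addr0.
Qed.

Lemma avg_flat_le k : avg k (fun w => (flat (pos w))%:R) <= (d%:R / k.+1%:R) ^+ 2 :> R.
Proof.
rewrite -(@ler_pXn2r _ 2)// ?nnegrE ?avg_ge0// ?exprn_ge0 ?divr_ge0//.
have := avg_coords_sqr R d_gt0 k 0 uniq_axis_perp; rewrite size_axis_perp -exprM.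
apply: le_trans; rewrite lerXn2r ?nnegrE ?avg_ge0//.
apply: le_avg => w _; rewrite ler_nat /flat.
by under [X in (_ <= nat_of_bool X)%N]eq_all do rewrite mxE.
Qed.

Fixpoint esc_flat (N : nat) (x : V) : R :=
  if N is M.+1 then mean (fun y => (~~ flat y)%:R * esc_flat M y) x else 1.

Lemma esc_flat_ge0 N x : 0 <= esc_flat N x.
Proof.
elim: N x => [|N IHN] x //=; rewrite -(mean0 R x); apply: le_mean => s.
by rewrite mulr_ge0.
Qed.

Lemma esc_flat_le1 N x : esc_flat N x <= 1.
Proof.
elim: N x => [|N IHN] x //=; rewrite -[leRHS](mean1 R hd x); apply: le_mean => s.
by case: flat; rewrite ?mul1r ?mul0r.
Qed.

Lemma esc_flat_nonincreasing x : nonincreasing_seq (fun N => esc_flat N x).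
Proof.
apply/nonincreasing_seqP => N; elim: N x => [|N IHN] x; first exact: esc_flat_le1.
by apply: le_mean => s; rewrite ler_wpM2l//; exact: IHN.
Qed.

Lemma esc_flatD N x y : flat y -> esc_flat N (x + y) = esc_flat N x.
Proof.
move=> fy; elim: N x => [|N IHN] x //=; congr (_ * _); apply: eq_bigr => s _.
by rewrite addrAC IHN (flatD _ fy).
Qed.

(** All points of the subspace are equivalent by translation, so the escape probability factors out
    of the sum over the point last visited. *)
Lemma last_exit_flat N x : 1 - (~~ flat x)%:R * esc_flat N x =
  \sum_(0 <= k < N.+1) avg k (fun w => (flat (x + pos w))%:R) * esc_flat (N - k) 0.
Proof.
elim: N x => [|N IHN] x.
  rewrite big_nat1 /= pos_nil addr0 mulr1; case: flat => /=; rewrite ?mul0r ?mul1r; ring.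
rewrite big_nat_recl//.
have -> : \sum_(0 <= k < N.+1)
    avg k.+1 (fun w => (flat (x + pos w))%:R) * esc_flat (N.+1 - k.+1) 0 =
  mean (fun z => 1 + -1 * ((~~ flat z)%:R * esc_flat N z)) x.
  have -> : mean (fun z => 1 + -1 * ((~~ flat z)%:R * esc_flat N z)) x =
     mean (fun z => \sum_(0 <= k < N.+1) avg k (fun w => (flat (z + pos w))%:R) * esc_flat (N - k) 0) x.
    by apply: eq_mean => s; rewrite mulN1r IHN.
  rewrite mean_sum; apply: eq_bigr => k _.
  rewrite (avg_mean k (fun y => (flat y)%:R)) mulrC -meanZ subSS.
  by apply: eq_mean => s; exact: mulrC.
rewrite meanD (mean1 R hd) meanZ -[mean _ x]/(esc_flat N.+1 x) subn0.
have -> : avg 0 (fun w => (flat (x + pos w))%:R) = (flat x)%:R :> R by rewrite /= pos_nil addr0.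
case: (boolP (flat x)) => fx; last by rewrite mul0r mul1r; ring.
by rewrite mul0r mul1r -[x]add0r esc_flatD//; ring.
Qed.

(** This is 1/(2r) for r = 2 d^2, a time after which the expected number of visits to the subspace
    is at most d^2/r = 1/2. *)
Definition esc_bound : R := (4 * d%:R ^+ 2)^-1.

Lemma esc_bound_gt0 : 0 < esc_bound.
Proof. by rewrite invr_gt0 mulr_gt0// exprn_gt0// ltr0n. Qed.

Lemma esc_flat_ge N : esc_bound <= esc_flat N 0.
Proof.
pose r := (2 * d ^ 2)%N.
have r0 : (0 < r)%N by rewrite muln_gt0 expn_gt0 d_gt0.
have := last_exit_flat (N + r) 0.
have -> : flat 0 by apply/allP => j _; rewrite mxE.
rewrite mul0r subr0 (big_cat_nat (n := r) (leq0n _)) /=; last by lia.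
have h1 : \sum_(0 <= k < r) avg k (fun w => (flat (0 + pos w))%:R) * esc_flat (N + r - k) 0 <=
    r%:R * esc_flat N 0.
  have -> : r%:R * esc_flat N 0 = \sum_(0 <= k < r) esc_flat N 0.
    by rewrite sumr_const_nat subn0 mulr_natl.
  rewrite !big_nat.
  apply: ler_sum => k /andP[_ kr]; rewrite -[leRHS]mul1r; apply: ler_pM.
  - exact: avg_ge0.
  - exact: esc_flat_ge0.
  - by rewrite -[leRHS](avg_const d_gt0 k 1); apply: le_avg => w _; case: flat.
  - by apply: esc_flat_nonincreasing; lia.
have h2 : \sum_(r <= k < (N + r).+1) avg k (fun w => (flat (0 + pos w))%:R) * esc_flat (N + r - k) 0 <= 2^-1.
  have tele m : (r <= m)%N -> \sum_(r <= k < m) (d%:R / k.+1%:R) ^+ 2 <=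
      d%:R ^+ 2 * (r%:R^-1 - m%:R^-1) :> R.
    elim: m => [|m IHm]; first by rewrite leqn0 => /eqP r00; rewrite r00 in r0.
    rewrite leq_eqVlt => /orP[/eqP <-|rm]; first by rewrite big_geq// subrr mulr0.
    rewrite big_nat_recr//=.
    have m0 : 0 < m%:R :> R by rewrite ltr0n; lia.
    have hm : (d%:R / m.+1%:R) ^+ 2 <= d%:R ^+ 2 * (m%:R^-1 - m.+1%:R^-1) :> R.
      rewrite expr_div_n ler_wpM2l ?exprn_ge0//.
      have -> : m%:R^-1 - m.+1%:R^-1 = (m%:R * m.+1%:R)^-1 :> R.
        by rewrite -natr1; field; rewrite gt_eqF//= gt_eqF// addr_gt0.
      rewrite lef_pV2 ?posrE ?exprn_gt0 ?mulr_gt0// expr2 ler_wpM2r//.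
      by rewrite ler_nat.
    by apply: (le_trans (lerD (IHm rm) hm)); rewrite -mulrDr addrA subrK.
  apply: le_trans (_ : d%:R ^+ 2 * (r%:R^-1 - (N + r).+1%:R^-1) <= _).
    apply: le_trans (tele _ _); last by lia.
    apply: ler_sum => k _; rewrite -[leRHS]mulr1; apply: ler_pM.
    - exact: avg_ge0.
    - exact: esc_flat_ge0.
    - by under eq_avg do rewrite add0r; exact: avg_flat_le.
    - exact: esc_flat_le1.
  rewrite mulrBr (@le_trans _ _ (d%:R ^+ 2 * r%:R^-1))//.
    by rewrite gerBl mulr_ge0 ?exprn_ge0 ?invr_ge0.
  rewrite /r natrM natrX invfM mulrCA divff ?mulr1// expf_neq0// pnatr_eq0 -lt0n//.
move=> e.
have h3 : 1 <= r%:R * esc_flat N 0 + 2^-1 by rewrite {1}e lerD.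
rewrite /esc_bound.
rewrite -(@ler_pM2l _ r%:R) ?ltr0n//.
have -> : r%:R * (4 * d%:R ^+ 2)^-1 = 2^-1 :> R.
  by rewrite /r natrM natrX; field; rewrite pnatr_eq0 -lt0n.
lra.
Qed.

Lemma esc_line n i : esc_bound <= esc (pts 0 (line n)) (linept i).
Proof.
apply: esc_ge => // N; apply: le_trans (esc_flat_ge N) _.
rewrite -(esc_flatD N 0 (flat_line i)) add0r.
elim: N (linept i) => [|N IHN] x //=; apply: le_mean => s.
apply: ler_pM => //; first exact: esc_flat_ge0.
rewrite ler_nat; case: (boolP (_ \in _)) => [|_]; last by case: flat.
by rewrite linepts => /seq.mapP[k _ ->]; rewrite add0r flat_line.
Qed.


(** Here s plays the step before w, so a change at the first letter counts as well; this makes the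
    law of the number of corners uniform. *)
Fixpoint corners (s : step) w : nat :=
  if w is t :: w' then ((s != t) + corners t w')%N else 0%N.

Lemma cornersE s w : corners s w =
  (\sum_(0 <= i < size w) (nth s (s :: w) i != nth s (s :: w) i.+1))%N.
Proof.
elim: w s => [|t w IHw] s; first by rewrite big_geq.
rewrite /= IHw big_nat_recl//=; congr (_ + _)%N; rewrite !big_nat.
apply: eq_bigr => i /andP[_ iw]; congr (nat_of_bool (_ != _)).
  by apply: set_nth_default; rewrite /= ltnS ltnW.
exact: set_nth_default.
Qed.

Definition corner_gain : R := (2 * d)%:R^-1 ^+ 2.

(** The displacement of the path between times i and j is that of a word of length j - i, so
    [pk_line_le] applies. *)
Lemma green_line_le i j w : (i <= j)%N -> (j <= size w)%N ->
  green (linept i - linept j) <= green (nth 0 (pts 0 w) i - nth 0 (pts 0 w) j).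
Proof.
move=> ij jw; rewrite !nth_pts ?(leq_trans ij)// !add0r.
rewrite -green_opp opprB -[leRHS]green_opp opprB.
have -> : pos (take j w) - pos (take i w) = pos (drop i (take j w)).
  rewrite -{1}(cat_take_drop i (take j w)) pos_cat -take_min (minn_idPl ij).
  by rewrite addrAC subrr add0r.
have -> : linept j - linept i = linept (size (drop i (take j w))).
  rewrite size_drop size_takel// /linept -scalerBl; congr (_ *: _); lia.
by apply: le_green => // k; exact: pk_line_le.
Qed.

Lemma green_line_sym i j w : (i <= size w)%N -> (j <= size w)%N ->
  green (linept i - linept j) <= green (nth 0 (pts 0 w) i - nth 0 (pts 0 w) j).
Proof.
move=> iw jw; case: (leqP i j) => ij; first exact: green_line_le.
rewrite -green_opp opprB -[leRHS]green_opp opprB.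
by apply: green_line_le => //; exact: ltnW.
Qed.

Lemma green_corner s0 i w : (i.+2 <= size w)%N -> nth s0 w i != nth s0 w i.+1 ->
  green (linept i - linept i.+2) + corner_gain <=
  green (nth 0 (pts 0 w) i - nth 0 (pts 0 w) i.+2).
Proof.
move=> iw ci; have iw2 : (i <= size w)%N by apply: leq_trans iw; rewrite ltnW.
rewrite !nth_pts// !add0r.
rewrite -green_opp opprB -[leRHS]green_opp opprB.
have -> : pos (take i.+2 w) - pos (take i w) = vec (nth s0 w i) + vec (nth s0 w i.+1).
  rewrite (take_nth s0)// (take_nth s0 (ltnW iw)) -!cats1 !pos_cat !pos_cons !pos_nil !addr0.
  by rewrite -[_ + _ + vec _]addrA (addrC (pos _)) addrK.
have -> : linept i.+2 - linept i = linept 2.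
  by rewrite /linept -scalerBl; congr (_ *: _); lia.
apply: (@le_green_gap R d hd _ _ 2) => [k|].
  have := @pk_line_le R d k axis [:: nth s0 w i; nth s0 w i.+1].
  by rewrite !pos_cons pos_nil addr0.
exact: pk2_corner.
Qed.

(** Indexing distinct points by the time of their last visit lets a measure on the range be carried
    over to the line, time by time. *)
Lemma sum_last_occurrence (f : V -> R) (P : seq V) :
  \sum_(0 <= k < size P) (nth 0 P k \notin drop k.+1 P)%:R * f (nth 0 P k) =
  \sum_(y <- undup P) f y.
Proof.
elim: P => [|x P IHP]; first by rewrite big_geq// big_nil.
rewrite [size _]/= big_nat_recl// drop1 [behead _]/= IHP [undup _]/=.
by rewrite /=; case: (x \in P) => /=; rewrite ?big_cons ?mul0r ?mul1r ?add0r.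
Qed.

Lemma form_map (K : V -> R) (a b : nat -> R) (p q : nat -> V) n :
  formK K [seq (a k, p k) | k <- iota 0 n] [seq (b k, q k) | k <- iota 0 n] =
  \sum_(0 <= i < n) \sum_(0 <= j < n) a i * b j * K (p i - q j).
Proof.
rewrite /formK big_map /index_iota subn0; apply: eq_bigr => i _.
by rewrite big_map.
Qed.

(** Worst case when weights are compared with c/2, c being [esc_bound]: two larger weights give
    [corner_gain] c^2/4, and a smaller one gives c^2/16, which is no less because [corner_gain] <=
    1/4. *)
Definition corner_cost : R := corner_gain * esc_bound ^+ 2 / 4.

Lemma corner_gain_gt0 : 0 < corner_gain.
Proof. by rewrite exprn_gt0// invr_gt0 ltr0n muln_gt0. Qed.

Lemma corner_cost_gt0 : 0 < corner_cost.
Proof. by rewrite divr_gt0// mulr_gt0 ?corner_gain_gt0 ?exprn_gt0 ?esc_bound_gt0. Qed.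

Lemma corner_gain_le : corner_gain <= 4^-1.
Proof.
rewrite /corner_gain exprVn lef_pV2 ?posrE ?exprn_gt0 ?ltr0n ?muln_gt0 ?d_gt0//.
by rewrite -natrX ler_nat; have := d_gt0; nia.
Qed.

(* Either both weights are comparable to those of the line, and the corner is
   paid in the energy, or the measure is far from the equilibrium measure of
   the line. *)
Lemma corner_tradeoff (a b e f : R) : 0 <= a -> 0 <= b -> esc_bound <= e ->
  esc_bound <= f ->
  corner_cost <= 4^-1 * ((a - e) ^+ 2 + (b - f) ^+ 2) + corner_gain * (a * b).
Proof.
have c0 := esc_bound_gt0; have g0 := corner_gain_gt0; have g1 := corner_gain_le.
rewrite /corner_cost; move: c0 g0 g1; set c := esc_bound; set g := corner_gain.
move=> c0 g0 g1 a0 b0 ce cf.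
have c2 : 0 <= c ^+ 2 by exact: sqr_ge0.
have gc : g * c ^+ 2 <= 4^-1 * c ^+ 2 by rewrite ler_wpM2r.
have ab0 : 0 <= g * (a * b) by rewrite !mulr_ge0// ltW.
case: (leP a (c / 2)) => ac.
  have h1 : (c / 2) ^+ 2 <= (e - a) ^+ 2 by rewrite lerXn2r ?nnegrE ?divr_ge0 ?(ltW c0)//; lra.
  have := sqr_ge0 (b - f); have -> : (a - e) ^+ 2 = (e - a) ^+ 2 by ring.
  move: h1; rewrite expr_div_n; nra.
case: (leP b (c / 2)) => bc.
  have h1 : (c / 2) ^+ 2 <= (f - b) ^+ 2 by rewrite lerXn2r ?nnegrE ?divr_ge0 ?(ltW c0)//; lra.
  have := sqr_ge0 (a - e); have -> : (b - f) ^+ 2 = (f - b) ^+ 2 by ring.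
  move: h1; rewrite expr_div_n; nra.
have h2 : (c / 2) * (c / 2) <= a * b by apply: ler_pM; rewrite ?divr_ge0 ?ltW.
have h3 : g * ((c / 2) * (c / 2)) <= g * (a * b) by rewrite ler_pM2l.
have := sqr_ge0 (a - e); have := sqr_ge0 (b - f); lra.
Qed.

Lemma sum_shift2_le (f : nat -> R) n : (forall k, 0 <= f k) ->
  \sum_(0 <= i < n.-1) (f i + f i.+2) <= 2 * \sum_(0 <= k < n.+1) f k.
Proof.
move=> f0; rewrite big_split mulr_natl mulr2n /=; apply: lerD.
  rewrite (big_cat_nat (n := n.-1) (p := n.+1) (leq0n _)) /=; last by lia.
  by rewrite lerDl sumr_ge0.
case: n => [|n]; first by rewrite big_geq// sumr_ge0.
by rewrite /= big_nat_recl// (big_nat_recl n)//= addrA lerDr addr_ge0.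
Qed.

(** The subtracted 1 discards the comparison of s with the first letter, which is not a corner of
    the path. *)
Lemma corners_le s w : (corners s w)%:R - 1 <=
  \sum_(0 <= i < (size w).-1) (nth s w i != nth s w i.+1)%:R :> R.
Proof.
rewrite cornersE; case: (size w) => [|n].
  by rewrite !big_geq// sub0r lerN10.
rewrite big_nat_recl//= natrD natr_sum lerBlDr addrC lerD2l.
by case: eqP.
Qed.

Lemma pk0_line (a b : nat -> R) n :
  \sum_(0 <= i < n) \sum_(0 <= j < n) a i * b j * pk R 0 (linept i - linept j) =
  \sum_(0 <= i < n) a i * b i.
Proof.
rewrite [LHS]big_seq [RHS]big_seq; apply: eq_bigr => i iN.
rewrite (bigD1_seq i) ?iota_uniq//= subrr pk0 eqxx mulr1 big1 ?addr0// => j ji.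
by rewrite pk0 subr_eq0 (inj_eq linept_inj) eq_sym (negPf ji) mulr0.
Qed.

(** The equilibrium weights of the path, placed on the line at the times of last visit, are the test
    measure [L], of mass [capw w]. Its energy Q is at most [capw w] - X, where X collects the corner
    gains; the variational formula adds the l^2 defect D, and X + D pays for the corners. *)
Lemma path_cap_corners s w :
  capw w + corner_cost * ((corners s w)%:R - 1) <= capw (line (size w)).
Proof.
set n := size w; pose P := pts 0 w; pose A := pts 0 (line n).
pose e k := esc A (linept k).
pose wt k : R := (nth 0 P k \notin drop k.+1 P)%:R * esc P (nth 0 P k).
have wt0 k : 0 <= wt k by rewrite mulr_ge0 ?esc_ge0.
have szP : size P = n.+1 by rewrite size_pts.
have wtE (f : V -> R) : \sum_(0 <= k < n.+1) wt k * f (nth 0 P k) =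
    \sum_(y <- undup P) esc P y * f y.
  rewrite -(sum_last_occurrence (fun y => esc P y * f y)) szP.
  by apply: eq_bigr => k _; rewrite mulrA.
have AE : A = [seq linept k | k <- iota 0 n.+1].
  by rewrite /A linepts; apply: eq_map => k; rewrite add0r.
have uA : undup A = A.
  by apply: undup_id; rewrite AE (map_inj_uniq linept_inj) iota_uniq.
have eqA : equilibrium R A = [seq (e k, linept k) | k <- iota 0 n.+1].
  by rewrite /equilibrium uA {2}AE -map_comp.
pose L : seq (R * V) := [seq (wt k, linept k) | k <- iota 0 n.+1].
have LA : {in L, forall p, p.2 \in A}.
  by move=> _ /seq.mapP[k kn ->]; rewrite /= AE; exact: map_f.
have := cap_variational hd LA.
rewrite !formK_catl !formK_catr !formK_scalel !formK_scaler eqA !form_map !pk0_line.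
have -> : mass L = capw w.
  have := wtE (fun=> 1); rewrite /index_iota subn0.
  rewrite (eq_bigr wt) => [|k _]; last exact: mulr1.
  rewrite (eq_bigr (esc P)) => [|k _]; last exact: mulr1.
  by rewrite /mass big_map.
set Q := \sum_(0 <= i < n.+1) \sum_(0 <= j < n.+1) _ * _ * green _.
set D := 2^-1 * _.
have De : D = 2^-1 * \sum_(0 <= k < n.+1) (wt k - e k) ^+ 2.
  congr (_ * _); rewrite !mulr_sumr -!big_split; apply: eq_bigr => k _ /=; ring.
pose co i : R := (nth s w i != nth s w i.+1)%:R.
pose X := \sum_(0 <= i < n.-1) co i * (corner_gain * (wt i * wt i.+2)).
have g0 := corner_gain_gt0.
have QX : Q + X <= capw w.
  have -> : capw w = \sum_(0 <= i < n.+1) \sum_(0 <= j < n.+1) wt i * wt j * green (nth 0 P i - nth 0 P j).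
    rewrite /capw -(form_equilibrium_self R hd) /formK big_map /=.
    have := wtE (fun x => \sum_(y <- undup P) esc P y * green (x - y)).
    rewrite (eq_bigr (fun i => \sum_(0 <= j < n.+1) wt i * wt j * green (nth 0 P i - nth 0 P j))) => [|i _]; last first.
      rewrite -(wtE (fun y => green (nth 0 P i - y))) mulr_sumr.
      by apply: eq_bigr => j _; exact: mulrA.
    move=> ->; apply: eq_bigr => x _; rewrite big_map mulr_sumr; apply: eq_bigr => y _ /=.
    by rewrite mulrA.
  (* A corner at time i + 1 shows in the pair of times (i, i + 2); one order of the pair is
     enough. *)
  pose gap i j : R := [&& (i < n.-1)%N, nth s w i != nth s w i.+1 & j == i.+2]%:R * corner_gain.
  have gap0 i j : 0 <= gap i j by rewrite mulr_ge0 ?(ltW g0).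
  have XX : X <= \sum_(0 <= i < n.+1) \sum_(0 <= j < n.+1) wt i * wt j * gap i j.
    rewrite (big_cat_nat (n := n.-1) (p := n.+1) (leq0n _)) /=; last by lia.
    rewrite -[leLHS]addr0; apply: lerD; last first.
      by apply: sumr_ge0 => i _; apply: sumr_ge0 => j _; exact: (mulr_ge0 (mulr_ge0 (wt0 _) (wt0 _)) (gap0 _ _)).
    rewrite /X !big_nat; apply: ler_sum => i /andP[_ iN].
    rewrite (bigD1_seq i.+2) ?iota_uniq//=; last by rewrite mem_index_iota /=; lia.
    rewrite -[leLHS]addr0; apply: lerD.
      rewrite /gap iN eqxx andbT /= /co; move: (wt i * _) => z.
      by rewrite le_eqVlt; apply/orP; left; apply/eqP; ring.
    by apply: sumr_ge0 => j _; exact: (mulr_ge0 (mulr_ge0 (wt0 _) (wt0 _)) (gap0 _ _)).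
  rewrite -lerBrDl; apply: (le_trans XX); rewrite lerBrDl -big_split /= !big_nat.
  apply: ler_sum => i /andP[_ iN]; rewrite -big_split /= !big_nat.
  apply: ler_sum => j /andP[_ jN]; rewrite -mulrDr.
  apply: (ler_wpM2l (mulr_ge0 (wt0 i) (wt0 j))); rewrite /gap.
  case: (boolP [&& _, _ & _]) => [/and3P[i2 ci /eqP ->]|_].
    by rewrite mul1r (green_corner (s0 := s))//; lia.
  by rewrite mul0r addr0 green_line_sym.
have XD : corner_cost * ((corners s w)%:R - 1) <= X + D.
  apply: (@le_trans _ _ (corner_cost * \sum_(0 <= i < n.-1) co i)).
    by rewrite ler_pM2l ?corner_cost_gt0// corners_le.
  (* Each time lies in at most two pairs (i, i + 2), so 1/4 per pair fits into the 1/2 of D. *)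
  have h := @sum_shift2_le (fun k => (wt k - e k) ^+ 2) n (fun k => sqr_ge0 _).
  have h2 : corner_cost * \sum_(0 <= i < n.-1) co i <= X +
      4^-1 * \sum_(0 <= i < n.-1) ((wt i - e i) ^+ 2 + (wt i.+2 - e i.+2) ^+ 2).
    rewrite /X !mulr_sumr -big_split /=; apply: ler_sum => i _.
    have := @corner_tradeoff (wt i) (wt i.+2) (e i) (e i.+2) (wt0 _) (wt0 _) (esc_line _ _) (esc_line _ _).
    have := sqr_ge0 (wt i - e i); have := sqr_ge0 (wt i.+2 - e i.+2).
    rewrite /co; case: (_ != _) => /=; rewrite ?mulr1 ?mul1r ?mulr0 ?mul0r ?add0r; last by lra.
    lra.
  by apply: (le_trans h2); rewrite De lerD2l; lra.
rewrite -[capw (line n)]/(cap A); move: QX XD; lra.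
Qed.

Lemma path_cap_le_line w : capw w <= capw (line (size w)).
Proof.
case: w => [|t w]; first exact: lexx.
(* The preceding step is taken opposite to the first letter: there is at least one corner, which
   offsets the -1. *)
apply: le_trans (path_cap_corners (flip t) (t :: w)).
rewrite lerDl mulr_ge0 ?(ltW corner_cost_gt0)// subr_ge0 ler1n /=.
have -> : (flip t != t).
  by case: t => i b; rewrite /flip /= xpair_eqE eqxx; case: b.
by [].
Qed.

Lemma line_cat n m : line (n + m) = line n ++ line m.
Proof. exact: nseqD. Qed.

(** The constant gamma*; as the capacity is subadditive, the infimum is also the limit of these
    quotients. *)
Definition line_speed : R := inf [set capw (line n.+1) / n.+1%:R | n in setT].

Lemma line_speed_has_inf : has_inf [set capw (line n.+1) / n.+1%:R | n in setT].
Proof.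
split; first by exists (capw (line 1) / 1%:R), 0%N.
by exists 0 => _ [n _ <-]; rewrite divr_ge0 ?capw_ge0.
Qed.

Lemma line_speed_le n : n%:R * line_speed <= capw (line n).
Proof.
case: n => [|n]; first by rewrite mul0r capw_ge0.
rewrite mulrC -ler_pdivlMr//; apply: ge_inf; last by exists n.
by case: line_speed_has_inf.
Qed.

Lemma line_speed_ge0 : 0 <= line_speed.
Proof.
apply: lb_le_inf; first by case: line_speed_has_inf.
by move=> _ [n _ <-]; rewrite divr_ge0 ?capw_ge0.
Qed.

Lemma line_mul q m : capw (line (q * m)) <= q%:R * capw (line m) + 1.
Proof.
elim: q => [|q IHq]; first by rewrite mul0r add0r; exact: capw_le_size.
rewrite mulSn line_cat; apply: (le_trans (capw_cat_le R hd _ _)) => //.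
rewrite -natr1; lra.
Qed.

Lemma line_speed_approx (ep : R) : 0 < ep -> exists n0, forall n, (n0 <= n)%N ->
  capw (line n) <= n%:R * (line_speed + ep).
Proof.
move=> ep0; have e2 : 0 < ep / 2 by rewrite divr_gt0.
have [_ [m _ <-] hm] := inf_adherent e2 line_speed_has_inf.
rewrite -/line_speed ltr_pdivrMr// in hm.
exists (Num.truncn ((m.+1%:R + 2) / (ep / 2))).+1 => n hn.
have hn2 : m.+1%:R + 2 <= n%:R * (ep / 2).
  rewrite -ler_pdivrMr//; apply: le_trans (ltW (truncnS_gt _)) _.
  by rewrite ler_nat.
rewrite {1}(divn_eq n m.+1) line_cat; apply: (le_trans (capw_cat_le R hd _ _)) => //.
have h1 := line_mul (n %/ m.+1) m.+1.
have h2 : capw (line (n %% m.+1)) <= m.+1%:R.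
  apply: (le_trans (capw_le_size R hd _)) => //.
  by rewrite size_line ler_nat ltn_mod.
have h3 : (n %/ m.+1)%:R * (m.+1%:R * (line_speed + ep / 2)) <= n%:R * (line_speed + ep / 2).
  rewrite mulrA -natrM ler_wpM2r ?addr_ge0 ?line_speed_ge0 ?(ltW e2)//.
  by rewrite ler_nat leq_divM.
have h4 : (n %/ m.+1)%:R * capw (line m.+1) <= (n %/ m.+1)%:R * (m.+1%:R * (line_speed + ep / 2)).
  by rewrite ler_wpM2l// mulrC ltW.
move: h1 h2 h3 h4 hn2; rewrite !mulrDr; lra.
Qed.

End Line.

(** * Exponential bounds near the top level and above the mean *)

Section Exponential.
Variables (R : realType) (d : nat).
Hypothesis hd : (5 <= d)%N.
Let step := ('I_d * bool)%type.
Implicit Types (u v w : seq step).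
Notation capw := (@capw R d).
Notation prob := (@prob R d).
Notation line_speed := (@line_speed R d hd).

Let d_gt0 : (0 < d)%N. Proof. exact: leq_trans hd. Qed.

Definition entropy : R := ln (2 * d)%:R.

Lemma entropy_gt0 : 0 < entropy.
Proof. by rewrite ln_gt0// ltr1n; lia. Qed.

Lemma expR_entropy n : expR (- (n%:R * entropy)) = (2 * d)%:R^-1 ^+ n.
Proof.
rewrite mulrC expRN expRM_natr /entropy lnK ?exprVn//.
by rewrite posrE ltr0n muln_gt0.
Qed.

(** Each step repeats the previous one with probability 1/(2d), independently of the past, so the
    number of corners is binomial. *)
Lemma avg_corners n s (z : R) : avg n (fun w => z ^+ corners s w) =
  ((1 + (2 * d - 1)%:R * z) / (2 * d)%:R) ^+ n.
Proof.
elim: n s => [|n IHn] s //=.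
under eq_bigr => t _ do under eq_avg do rewrite exprD.
under eq_bigr => t _ do rewrite avgZ IHn.
rewrite -mulr_suml mulrA exprSr [RHS]mulrC; congr (_ * _).
rewrite mulrC; congr (_ * _).
rewrite (bigD1 s)//= eqxx expr0; congr (_ + _).
rewrite (eq_bigr (fun=> z)) => [|t ts]; last by rewrite eq_sym ts expr1.
by rewrite sumr_const cardC1 card_step mulr_natl subn1.
Qed.

(** A capacity at least n (gamma* - ep) allows at most m = 1 + 2 ep n/k corners; a Chernoff bound
    with weight e^(-b) per corner shows how rare such words are. *)
Lemma prob_near_top (eta : R) : 0 < eta ->
  exists2 ep, 0 < ep & exists n0, forall n, (n0 <= n)%N ->
    prob n (n%:R * (line_speed - ep)) <= expR (- (n%:R * (entropy - eta))).
Proof.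
move=> eta0.
have D0 : 0 < (2 * d)%:R :> R by rewrite ltr0n muln_gt0.
(* Each third of eta covers one loss: b makes the weight of the turning choices at most eta/3, [ep]
   makes b (m - 1) at most n eta/3, and n large pays for the remaining b. *)
pose b : R := ln (1 + 3 * (2 * d)%:R / eta).
have q0 : 0 < 3 * (2 * d)%:R / eta by rewrite divr_gt0// mulr_gt0.
have b0 : 0 <= b by rewrite ln_ge0// lerDl ltW.
have zE : expR (- b) = (1 + 3 * (2 * d)%:R / eta)^-1.
  by rewrite expRN lnK// posrE addr_gt0.
have zle : (2 * d)%:R * expR (- b) <= eta / 3.
  rewrite zE ler_pdivrMr ?addr_gt0// mulrDr mulr1.
  rewrite (_ : eta / 3 * (_ / eta) = (2 * d)%:R) ?lerDr ?divr_ge0 ?(ltW eta0)//.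
  by field; rewrite gt_eqF.
have k0 := corner_cost_gt0 R hd; set k := corner_cost R d in k0.
pose ep := k * eta / (6 * (b + 1)).
have b1 : 0 < b + 1 by rewrite ltr_wpDl.
have ep0 : 0 < ep by apply: divr_gt0; apply: mulr_gt0.
exists ep => //.
have [n1 hn1] := line_speed_approx hd ep0.
exists (maxn n1 (Num.truncn (b / (eta / 3))).+1) => n; rewrite geq_max => /andP[/hn1 nl nb].
have {}nb : b <= n%:R * (eta / 3).
  rewrite -ler_pdivrMr ?divr_gt0//; apply: le_trans (ltW (truncnS_gt _)) _.
  by rewrite ler_nat.
pose s : step := (axis hd, true).
pose m : R := 1 + 2 * ep * n%:R / k.
have step1 : prob n (n%:R * (line_speed - ep)) <=
    expR (b * m) * avg n (fun w => expR (- b) ^+ corners s w).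
  rewrite /prob -avgZ; apply: le_avg => w sw.
  case: (leP _ (capw w)) => hw /=; last by rewrite mulr_ge0 ?exprn_ge0 ?expR_ge0.
  rewrite -expRM_natr -expRD -[leLHS]expR0 ler_expR mulNr -mulrBr mulr_ge0// subr_ge0.
  have := path_cap_corners R hd s w; rewrite sw -/k => h.
  rewrite /m -lerBlDl ler_pdivlMr// mulrC.
  by move: h nl hw; rewrite !mulrDr mulrN; lra.
apply: (le_trans step1); rewrite avg_corners.
have step2 : (1 + (2 * d - 1)%:R * expR (- b)) / (2 * d)%:R <= expR (eta / 3 - entropy).
  rewrite expRD (expRN entropy) /entropy lnK ?posrE// ler_wpM2r ?invr_ge0 ?(ltW D0)//.
  apply: le_trans (expR_ge1Dx _); rewrite lerD2l; apply: le_trans zle.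
  by rewrite ler_wpM2r ?expR_ge0// ler_nat leq_subr.
have step3 : ((1 + (2 * d - 1)%:R * expR (- b)) / (2 * d)%:R) ^+ n <= expR (n%:R * (eta / 3 - entropy)).
  rewrite [n%:R * _]mulrC expRM_natr lerXn2r ?nnegrE ?expR_ge0//.
apply: (le_trans (ler_wpM2l (expR_ge0 _) step3)); rewrite -expRD ler_expR.
have h4 : b * (2 * ep * n%:R / k) <= n%:R * (eta / 3).
  rewrite /ep (_ : _ * _ = b / (b + 1) * (n%:R * (eta / 3))); last first.
    by field; rewrite !gt_eqF.
  by rewrite ler_piMl ?mulr_ge0 ?divr_ge0 ?(ltW eta0)// ler_pdivrMr// mul1r lerDl.
by rewrite /m mulrDr mulr1; move: h4 nb; rewrite !mulrBr; lra.
Qed.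

Lemma expR_le_quad (x : R) : 0 <= x -> x <= 2^-1 -> expR x <= 1 + x + 2 * x ^+ 2.
Proof.
move=> x0 x1; have := expR_ge1Dx (- x); rewrite expRN => h.
have x2 : 0 < 1 - x by lra.
have : expR x <= (1 - x)^-1 by rewrite -[leLHS]invrK lef_pV2 ?posrE ?invr_gt0 ?expR_gt0.
move=> /le_trans; apply; rewrite -[leLHS]mul1r ler_pdivrMr//.
have h2 : x * x ^+ 2 <= 2^-1 * x ^+ 2 by rewrite ler_wpM2r ?sqr_ge0.
rewrite (_ : (1 + x + 2 * x ^+ 2) * (1 - x) = 1 + x ^+ 2 - 2 * (x * x ^+ 2)); [lra|ring].
Qed.

Definition mgf (t : R) (n : nat) : R := avg n (fun w => expR (t * capw w)).

(** Subadditivity makes exponential moments submultiplicative over independent pieces; the last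
    piece is bounded by its length. *)
Lemma mgf_mul t n q r : 0 <= t ->
  mgf t (q * n + r) <= mgf t n ^+ q * expR (t * r.+1%:R).
Proof.
move=> t0; elim: q => [|q IHq].
  rewrite mul0n add0n expr0 mul1r -(avg_const d_gt0 r (expR _)); apply: le_avg => w sw.
  by rewrite ler_expR ler_wpM2l// -sw; exact: capw_le_size.
rewrite mulSn -addnA exprS -mulrA.
apply: (@le_trans _ _ (mgf t n * mgf t (q * n + r))); last first.
  by rewrite ler_wpM2l//; apply: avg_ge0 => w _; exact: expR_ge0.
rewrite /mgf avg_cat -avgM; apply: le_avg => u _; apply: le_avg => v _.
by rewrite -expRD ler_expR -mulrDr ler_wpM2l//; exact: capw_cat_le.
Qed.

(** A mean below the level at a single length n suffices: second-order expansion of the exponential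
    moment at small t, then [mgf_mul]. *)
Lemma prob_exp_decay (n : nat) (x eta : R) : (0 < n)%N -> 0 <= x -> 0 < eta ->
  avg n capw <= n%:R * (x - eta) ->
  exists2 c, 0 < c & exists C, forall N, prob N (N%:R * x) <= expR (C - c * N%:R).
Proof.
move=> n0 x0 eta0 hE; have nR : 0 < n%:R :> R by rewrite ltr0n.
(* Then t n <= 1/16 keeps t [capw w] below 1/2, and t n <= eta/16 lets the quadratic term 8 (t n)^2
   use at most half of t n eta. *)
pose t := eta / (16 * n%:R * (1 + eta)).
have e1 : 0 < 1 + eta by rewrite addr_gt0.
have t0 : 0 < t by rewrite divr_gt0// !mulr_gt0.
have tn : t * n%:R = eta / (16 * (1 + eta)) by rewrite /t; field; rewrite !gt_eqF.
have tn1 : t * n%:R <= 16^-1.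
  rewrite tn ler_pdivrMr ?mulr_gt0// mulrA mulVf ?mul1r ?lerDr//; lra.
have tn2 : t * n%:R <= eta / 16.
  by rewrite tn ler_pM2l// lef_pV2 ?posrE ?mulr_gt0// ler_peMr// lerDl ltW.
have n1 : 1 <= n%:R :> R by rewrite ler1n.
have hM : mgf t n <= expR (t * n%:R * (x - eta / 2)).
  apply: (@le_trans _ _ (avg n (fun w => 1 + 8 * (t * n%:R) ^+ 2 + t * capw w))).
    apply: le_avg => w sw.
    have c0 := capw_ge0 R hd w; have c1 := capw_le_size R hd w; rewrite sw -natr1 in c1.
    have c2 : capw w <= 2 * n%:R by lra.
    have u0 : 0 <= t * capw w by rewrite mulr_ge0// ltW.
    have u2 : t * capw w <= 2 * (t * n%:R) by rewrite mulrCA ler_pM2l.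
    have u1 : t * capw w <= 2^-1 by lra.
    apply: (le_trans (expR_le_quad u0 u1)).
    have : (t * capw w) ^+ 2 <= (2 * (t * n%:R)) ^+ 2 by rewrite lerXn2r ?nnegrE// mulr_ge0// mulr_ge0// ltW.
    rewrite exprMn; lra.
  rewrite avgD avg_const// avgZ.
  apply: (le_trans _ (expR_ge1Dx _)); rewrite -addrA lerD2l.
  have h : t * avg n capw <= t * (n%:R * (x - eta)) by rewrite ler_pM2l.
  apply: (le_trans (lerD (lexx _) h)).
  have h2 : (t * n%:R) * (t * n%:R) <= (eta / 16) * (t * n%:R).
    by rewrite ler_wpM2r// mulr_ge0// ltW.
  rewrite expr2 mulrA; move: h2; rewrite !(mulrBr (t * n%:R)); lra.
exists (t * eta / 2); first by rewrite divr_gt0// mulr_gt0.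
exists (t * eta / 2 * n%:R + t * n%:R) => N.
have step1 : prob N (N%:R * x) <= expR (- (t * (N%:R * x))) * mgf t N.
  rewrite /prob /mgf -avgZ; apply: le_avg => w _; rewrite -expRD.
  case: (leP _ (capw w)) => h /=; last exact: expR_ge0.
  have h2 : 0 <= - (t * (N%:R * x)) + t * capw w by rewrite addrC subr_ge0 ler_pM2l.
  by rewrite -[leLHS]expR0 ler_expR.
apply: (le_trans step1).
have NE := divn_eq N n; set q := (N %/ n)%N in NE; set r := (N %% n)%N in NE.
have rn : (r < n)%N by rewrite ltn_mod.
have h3 : mgf t N <= expR (q%:R * (t * n%:R * (x - eta / 2))) * expR (t * n%:R).
  rewrite {1}NE; apply: (le_trans (@mgf_mul t n q r (ltW t0))).
  apply: ler_pM; rewrite ?expR_ge0 ?exprn_ge0//; first by apply: avg_ge0 => w _; exact: expR_ge0.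
    rewrite [in leRHS]mulrC expRM_natr lerXn2r ?nnegrE ?expR_ge0//.
    by apply: avg_ge0 => w _; exact: expR_ge0.
  by rewrite ler_expR ler_pM2l// ler_nat.
apply: (le_trans (ler_wpM2l (expR_ge0 _) h3)); rewrite -!expRD ler_expR.
have qn : q%:R * n%:R <= N%:R :> R by rewrite -natrM ler_nat leq_divM.
have qn2 : N%:R <= q%:R * n%:R + n%:R :> R by rewrite -natrM -natrD ler_nat NE leq_add2l ltnW.
have h5 : t * x * (q%:R * n%:R) <= t * x * N%:R by rewrite ler_wpM2l// mulr_ge0// ltW.
have h6 : t * eta / 2 * N%:R <= t * eta / 2 * (q%:R * n%:R + n%:R).
  by rewrite ler_wpM2l// divr_ge0// mulr_ge0// ltW.
rewrite (_ : q%:R * (t * n%:R * (x - eta / 2)) = t * x * (q%:R * n%:R) - t * eta / 2 * (q%:R * n%:R)); last by field.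
rewrite (_ : t * (N%:R * x) = t * x * N%:R); last by ring.
move: h5 h6; rewrite mulrDr; lra.
Qed.

End Exponential.

(** * Discrete random variables and null sets *)

Section DiscreteVariables.
Context (R : realType) (disp : measure_display) (Omega : measurableType disp).
Variable P : probability Omega R.

Lemma discrete_seq (E : countType) (X : nat -> Omega -> E) :
  (forall n, discrete_rv (X n)) ->
  forall n k, discrete_rv (fun w => [seq X i w | i <- iota k n]).
Proof.
move=> hX; elim=> [|n IHn] k B.
  case: (pselect (B [::])) => Bn.
    by rewrite (_ : _ @^-1` B = setT)//; apply/seteqP; split.
  by rewrite (_ : _ @^-1` B = set0)//; apply/seteqP; split.
rewrite (_ : _ @^-1` B = \bigcup_(e : E) (X k @^-1` [set e] `&`
    (fun w => [seq X i w | i <- iota k.+1 n]) @^-1` [set s | B (e :: s)])).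
  apply: countable_bigcupT_measurable => [|e]; first exact: countableP.
  by apply: measurableI; [exact: hX|exact: IHn].
apply/seteqP; split=> w /=; first by move=> Bw; exists (X k w).
by move=> [e _ [/= <-]].
Qed.

Lemma discrete_comp (E F : Type) (X : Omega -> E) (f : E -> F) :
  discrete_rv X -> discrete_rv (f \o X).
Proof. by move=> hX B; exact: (hX (f @^-1` B)). Qed.

Lemma prob_fin_num A : measurable A -> P A \is a fin_num.
Proof. by move=> mA; exact: fin_num_measure. Qed.

Lemma fineP_K A : measurable A -> (fine (P A))%:E = P A.
Proof. by move=> mA; rewrite fineK// prob_fin_num. Qed.

Lemma prob_split (T : finType) (X : Omega -> T) A : discrete_rv X -> measurable A ->
  fine (P A) = \sum_(t : T) fine (P (A `&` X @^-1` [set t])).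
Proof.
move=> hX mA.
have mt t : measurable (A `&` X @^-1` [set t]) by apply: measurableI => //; exact: hX.
apply: EFin_inj; rewrite fineP_K// -sumEFin.
under eq_bigr do rewrite fineP_K//.
have AE : A = \bigcup_(t in [set: T]) (A `&` X @^-1` [set t]).
  apply/seteqP; split=> w /=; last by move=> [t _ []].
  by move=> Aw; exists (X w).
rewrite [in LHS]AE measure_fin_bigcup//.
- rewrite (_ : [set: T] = [set` index_enum T]); last first.
    by apply/seteqP; split=> // t _; rewrite /= mem_index_enum.
  by rewrite -fsbig_seq ?index_enum_uniq.
- exact: finite_finset.
- apply/trivIsetP => i j _ _ ij; apply/seteqP; split=> w //= [[_ Xi] [_ Xj]].
  by move: ij; rewrite -Xi -Xj eqxx.
Qed.

Lemma prob_le_null (A B N : set Omega) : measurable A -> measurable B -> measurable N ->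
  P N = 0%E -> A `<=` B `|` N -> fine (P A) <= fine (P B).
Proof.
move=> mA mB mN N0 AB; rewrite fine_le ?prob_fin_num//.
apply: (@le_trans _ _ (P (B `|` N))).
  by apply: le_measure; rewrite ?inE//; exact: measurableU.
apply: (le_trans (measureU2 _ _ _)) => //.
rewrite -[leRHS]adde0; apply: leeD => //.
by rewrite le_eqVlt; apply/orP; left; apply/eqP; exact: N0.
Qed.

End DiscreteVariables.

(** * The walk on [Omega] compared with averages over words *)

Section WalkLaw.
Context (R : realType) (disp : measure_display) (Omega : measurableType disp).
Variables (P : probability Omega R) (d : nat).
Hypothesis hd : (5 <= d)%N.
Variable S : nat -> Omega -> 'rV[int]_d.
Hypothesis hS : simple_random_walk P S.
Let step := ('I_d * bool)%type.
Let V := 'rV[int]_d.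

Let d_gt0 : (0 < d)%N. Proof. exact: leq_trans hd. Qed.

Let s0 : step := (axis hd, true).

(* Increments other than unit vectors have probability zero, so the default
   value [s0] is harmless. *)
Definition decode (v : V) : step := odflt s0 [pick s | vec s == v].

Lemma vecK : cancel (@vec d) decode.
Proof.
move=> s; rewrite /decode; case: pickP => [t /eqP/vec_inj //|/(_ s)].
by rewrite eqxx.
Qed.

Definition stp (n : nat) (w : Omega) : step := decode (increment S n w).

Let h_inc : forall n, discrete_rv (increment S n). Proof. by case: hS. Qed.

Lemma stp_discrete n : discrete_rv (stp n).
Proof. exact: (discrete_comp decode (h_inc n)). Qed.

Notation c := ((2 * d)%:R^-1 : R).

Lemma prob_vec n s : P (increment S n @^-1` [set vec s]) = c%:E.
Proof.
have [_ _ _ hp] := hS.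
by case: s => i [] /=; have [h1 h2] := hp n i; rewrite /vec /= ?h1 ?h2.
Qed.

(** The law of the increments bounds each of the 2d probabilities from below by 1/(2d); they add up
    to 1, so all bounds are equalities. *)
Lemma prob_stp n s : P (stp n @^-1` [set s]) = c%:E.
Proof.
have ge t : 0 <= fine (P (stp n @^-1` [set t])) - c.
  rewrite subr_ge0 -[X in X <= _](_ : fine (P (increment S n @^-1` [set vec t])) = _); last first.
    by rewrite prob_vec.
  rewrite fine_le ?prob_fin_num//; [exact: h_inc|exact: stp_discrete|].
  apply: le_measure; rewrite ?inE; [exact: h_inc|exact: stp_discrete|].
  by move=> w /= wt; rewrite /stp wt vecK.
have sum1 : \sum_(t : step) fine (P (stp n @^-1` [set t])) = 1.
  have := prob_split P (@stp_discrete n) measurableT.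
  rewrite probability_setT /= => ->; apply: eq_bigr => t _.
  by rewrite setTI.
have sum0 : \sum_(t : step) (fine (P (stp n @^-1` [set t])) - c) = 0.
  rewrite sumrB sum1 sumr_const card_step -[_ *+ _]mulr_natl mulfV ?subrr//.
  exact: step_neq0.
move/eqP: sum0; rewrite psumr_eq0// => /allP/(_ s (mem_index_enum _)).
move=> /implyP/(_ isT)/eqP/subr0_eq e.
by rewrite -fineP_K ?e//; exact: stp_discrete.
Qed.

Definition bad : set Omega :=
  \bigcup_n [set w | increment S n w <> vec (stp n w)].

Lemma measurable_bad : measurable bad.
Proof.
apply: bigcup_measurable => n _.
exact: (h_inc n [set v | v <> vec (decode v)]).
Qed.

(** The event that the decoded step is t contains the event that the increment is vec t, and both
    have probability 1/(2d). *)
Lemma prob_bad : P bad = 0%E.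
Proof.
apply/negligibleP; first exact: measurable_bad.
apply: negligible_bigcup => n.
have mE : measurable [set w | increment S n w <> vec (stp n w)].
  exact: (h_inc n [set v | v <> vec (decode v)]).
suff e : fine (P [set w | increment S n w <> vec (stp n w)]) = 0.
  by apply/negligibleP => //; exact: (etrans (esym (fineP_K P mE)) (congr1 EFin e)).
rewrite (prob_split P (@stp_discrete n))// big1// => t _.
have -> : [set w | increment S n w <> vec (stp n w)] `&` stp n @^-1` [set t] =
    stp n @^-1` [set t] `\` increment S n @^-1` [set vec t].
  apply/seteqP; split=> w /=; first by move=> [h <-].
  by move=> [<-].
have sub : stp n @^-1` [set t] `&` increment S n @^-1` [set vec t] =
    increment S n @^-1` [set vec t].
  by apply/seteqP; split=> w /=; [case|move=> h; split=> //; rewrite /stp h vecK].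
rewrite measureD; [|exact: stp_discrete|exact: h_inc|]; last first.
  exact: (eq_ind_r (fun z => z < +oo)%E (ltry c) (prob_stp n t)).
rewrite sub; transitivity (fine (c%:E - c%:E)%E); last by rewrite /= subrr.
by congr (fine (_ - _)%E); [exact: prob_stp|exact: prob_vec].
Qed.

Lemma walk_pos w n : ~ bad w -> S n w = pos [seq stp i w | i <- iota 0 n].
Proof.
move=> nb; elim: n => [|n IHn]; first by rewrite pos_nil; case: hS.
have -> : iota 0 n.+1 = iota 0 n ++ [:: n] by rewrite -[n.+1]addn1 iotaD.
rewrite map_cat pos_cat -IHn /= pos_cons pos_nil addr0.
have -> : vec (stp n w) = increment S n w.
  by apply: contrapT => h; apply: nb; exists n => //= e; apply: h; exact: esym.
by rewrite /increment addrC subrK.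
Qed.

Definition past n w : seq step := [seq stp i w | i <- iota 0 n].

Lemma past_discrete n : discrete_rv (past n).
Proof. exact: discrete_seq stp_discrete n 0. Qed.

Lemma prob_past u : fine (P (past (size u) @^-1` [set u])) = c ^+ size u.
Proof.
have [_ _ hind _] := hS.
have := hind (iota 0 (size u)) (fun j => decode @^-1` [set nth s0 u j]) (iota_uniq _ _).
have -> : \bigcap_(j in [set` iota 0 (size u)])
    (increment S j @^-1` (decode @^-1` [set nth s0 u j])) = past (size u) @^-1` [set u].
  apply/seteqP; split=> w /=.
    move=> h; apply: (@eq_from_nth _ s0); first by rewrite size_map size_iota.
    rewrite size_map size_iota => i iu.
    rewrite (nth_map 0%N) ?size_iota// nth_iota// add0n.
    by apply: h; rewrite /= mem_iota.
  move=> <- i /=; rewrite mem_iota add0n size_map size_iota => /andP[_ iu].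
  by rewrite (nth_map 0%N) ?size_iota// nth_iota.
move=> ->; rewrite (eq_bigr (fun=> c%:E)) => [|j _]; last exact: (prob_stp j).
by rewrite prodEFin /= big_const_seq count_predT size_iota iter_mulr_1.
Qed.

(** The prefix u is arbitrary so that the induction can append the next step to it, while [avg]
    reads the future from the left. *)
Lemma law_past (Q : pred (seq step)) n u :
  fine (P (past (size u) @^-1` [set u] `&` past (size u + n) @^-1` [set s | Q s])) =
  c ^+ size u * avg n (fun v => (Q (u ++ v))%:R).
Proof.
elim: n u => [|n IHn] u.
  rewrite addn0 /= cats0; case: (boolP (Q u)) => Qu.
    rewrite mulr1 -prob_past; congr (fine (P _)); apply/seteqP; split=> w /=; first by case.
    by move=> pu; split=> //; rewrite pu.
  rewrite mulr0 (_ : _ `&` _ = set0) ?measure0//.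
  by apply/seteqP; split=> w //= [->]; rewrite (negPf Qu).
rewrite (prob_split P (@stp_discrete (size u))); last first.
  by apply: measurableI; exact: past_discrete.
rewrite /= mulrA [_ * c]mulrC -exprS mulr_sumr; apply: eq_bigr => t _.
have := IHn (rcons u t); rewrite size_rcons => e.
transitivity (c ^+ (size u).+1 * avg n (fun v => (Q (rcons u t ++ v))%:R)); last first.
  by congr (_ * _); apply: eq_avg => v _; rewrite cat_rcons.
rewrite -e addnS addSn; congr (fine (P _)).
have pastS w : past (size u).+1 w = rcons (past (size u) w) (stp (size u) w).
  by rewrite /past -addn1 iotaD map_cat cats1.
apply/seteqP; split=> w /=; rewrite pastS; first by move=> [[-> ?] ->].
by move=> [/rcons_inj[-> ->]].
Qed.

Lemma law_walk (Q : pred (seq step)) n :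
  fine (P (past n @^-1` [set s | Q s])) = avg n (fun v => (Q v)%:R).
Proof.
have := law_past Q n [::]; rewrite expr0 mul1r /= => <-.
by congr (fine (P _)); apply/seteqP; split=> w //= [].
Qed.

(** Positions are functions of the raw increments, so events on S are measurable as they stand, not
    merely up to the null set [bad]. *)
Lemma walk_discrete n : discrete_rv (fun w => [seq S i w | i <- iota 0 n]).
Proof.
have SE w i : S i w = \sum_(v <- [seq increment S j w | j <- iota 0 i]) v.
  elim: i => [|i IHi]; first by rewrite big_nil; case: hS.
  have -> : iota 0 i.+1 = iota 0 i ++ [:: i] by rewrite -[i.+1]addn1 iotaD.
  by rewrite map_cat big_cat -IHi /= big_seq1 /increment addrC subrK.
pose f (s : seq V) := [seq \sum_(v <- take i s) v | i <- iota 0 n].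
have -> : (fun w => [seq S i w | i <- iota 0 n]) =
    f \o (fun w => [seq increment S j w | j <- iota 0 n]).
  apply/funext => w; apply/eq_in_map => i; rewrite mem_iota add0n => /andP[_ iN].
  rewrite /= -map_take SE; congr (\sum_(v <- [seq _ | _ <- _]) v).
  by rewrite take_iota; congr iota; apply/esym/minn_idPl/ltnW.
apply: discrete_comp; exact: discrete_seq h_inc n 0.
Qed.

Fixpoint avoids (A : {fset V}) (x : V) (w : seq step) : bool :=
  if w is s :: w' then (x + vec s \notin A) && avoids A (x + vec s) w' else true.

Lemma avg_avoids A x n : avg n (fun w => (avoids A x w)%:R) = escN R n A x.
Proof.
elim: n x => [|n IHn] x //=; congr (_ * _); apply: eq_bigr => s _.
case: (x + vec s \in A) => /=; first by rewrite avg0 mul0r.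
by rewrite IHn mul1r.
Qed.

Lemma avoidsP A x w : reflect
  (forall n, (1 <= n <= size w)%N -> x + pos (take n w) \notin A) (avoids A x w).
Proof.
elim: w x => [|s w IHw] x /=; first by apply: ReflectT => -[|n].
apply: (iffP andP) => [[xA /IHw h] [//|[|n]] nw|h].
- by rewrite /= take0 pos_cons pos_nil addr0.
- by rewrite /= pos_cons addrA; apply: h.
- split; first by have := h 1%N isT; rewrite /= take0 pos_cons pos_nil addr0.
  apply/IHw => n /andP[n1 nw]; have := h n.+1; rewrite /= pos_cons addrA; apply.
  by rewrite !ltnS.
Qed.

Definition no_return (A : {fset V}) (x : V) (N : nat) : set Omega :=
  [set w | forall n, (1 <= n <= N)%N -> x + S n w \notin A].

Lemma measurable_no_return A x N : measurable (no_return A x N).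
Proof.
have [m mE] : exists m, m = N.+1 by exists N.+1.
rewrite (_ : no_return A x N = (fun w => [seq S i w | i <- iota 0 m]) @^-1`
  [set s | forall n, (1 <= n <= N)%N -> x + nth 0 s n \notin A]).
  exact: walk_discrete.
apply/seteqP; split=> w /= h n nN; have := h n nN;
  by rewrite (nth_map 0%N) ?size_iota ?nth_iota// mE ltnS; case/andP: nN.
Qed.

Lemma prob_no_return A x N : fine (P (no_return A x N)) = escN R N A x.
Proof.
rewrite -avg_avoids -(law_walk (avoids A x) N).
have ind w : ~ bad w -> no_return A x N w <-> (past N @^-1` [set s | avoids A x s]) w.
  move=> nb; have e n : (n <= N)%N -> pos (take n (past N w)) = S n w.
    move=> nN; rewrite (walk_pos _ nb) /past -map_take take_iota.
    by rewrite (minn_idPl nN).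
  have sz : size (past N w) = N by rewrite size_map size_iota.
  split=> [h|/avoidsP h n nN] /=.
    by apply/avoidsP => n; rewrite sz => nN; rewrite e ?h//; case/andP: nN.
  by rewrite -e ?h ?sz//; case/andP: nN.
have [mn mp] : measurable (no_return A x N) /\ measurable (past N @^-1` [set s | avoids A x s]).
  by split; [exact: measurable_no_return|exact: past_discrete].
apply/eqP; rewrite eq_le; apply/andP; split;
  apply: (prob_le_null _ _ measurable_bad prob_bad) => // w hw;
  by case: (pselect (bad w)) => bw; [right|left; apply/(ind w bw)].
Qed.

(** An infimum over the empty set is +oo, so never returning is the decreasing limit of [no_return]
    over N. *)
Lemma prob_never_return A x :
  fine (P [set w | return_time R S A x w = +oo%E]) = esc R A x.
Proof.
have -> : [set w | return_time R S A x w = +oo%E] = \bigcap_N no_return A x N.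
  apply/seteqP; split=> w /=.
    move=> rt N _ n /andP[n1 _]; apply/negP => xA.
    have : (return_time R S A x w <= n%:R%:E)%E.
      by apply: ereal_inf_lbound; exists n.
    by rewrite rt.
  move=> h; rewrite /return_time (_ : [set _ | _ in _] = set0) ?ereal_inf0//.
  apply/seteqP; split=> // e [n /= [n1 xA] _].
  by have := h n Logic.I n; rewrite n1 leqnn xA => /(_ isT).
have dec : nonincreasing_seq (no_return A x).
  apply/nonincreasing_seqP => N; apply/subsetPset => w h n /andP[n1 nN].
  by apply: h; rewrite n1 ltnW.
have cv : (P \o no_return A x) @ \oo --> P (\bigcap_N no_return A x N).
  apply: nonincreasing_cvg_mu => //.
  - by rewrite (le_lt_trans (probability_le1 _ _)) ?ltry//; exact: measurable_no_return.
  - by move=> N; exact: measurable_no_return.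
  - by apply: bigcap_measurable => // N _; exact: measurable_no_return.
have cf : (fun N => escN R N A x) @ \oo --> fine (P (\bigcap_N no_return A x N)).
  under eq_fun do rewrite -prob_no_return.
  by apply: fine_cvg; rewrite fineK// prob_fin_num//; apply: bigcap_measurable => // N _;
    exact: measurable_no_return.
by rewrite -(cvg_lim _ cf).
Qed.

Lemma capacityE A : capacity P S A = cap R A.
Proof.
rewrite /capacity /cap undup_id; last exact: fset_uniq.
by apply: eq_bigr => x _; rewrite prob_never_return.
Qed.

Lemma walk_range_pts n w : ~ bad w -> walk_range S n w =i pts 0 (past n w).
Proof.
move=> nb x; have -> : pts 0 (past n w) = [seq S k w | k <- iota 0 n.+1].
  apply: (@eq_from_nth _ 0); rewrite size_pts !size_map !size_iota// => i iN.
  rewrite nth_pts ?size_map ?size_iota// add0r (nth_map 0%N) ?size_iota// nth_iota//.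
  by rewrite add0n (walk_pos _ nb) /past -map_take take_iota (minn_idPl _).
apply/imfsetP/seq.mapP => /= -[k kn ->]; by exists k.
Qed.

Lemma capacity_capw n w : ~ bad w -> capacity P S (walk_range S n w) = capw R (past n w).
Proof. by move=> nb; rewrite capacityE; apply: eq_cap => //; exact: walk_range_pts. Qed.

Lemma measurable_capacity n (B : set R) :
  measurable [set w | B (capacity P S (walk_range S n w))].
Proof.
rewrite (_ : [set w | _] = (fun w => [seq S i w | i <- iota 0 n.+1]) @^-1`
  [set s | B (cap R s)]); first exact: walk_discrete.
have e w : capacity P S (walk_range S n w) = cap R [seq S i w | i <- iota 0 n.+1].
  rewrite capacityE; apply: eq_cap => // x.
  by apply/imfsetP/seq.mapP => -[k kn ->]; exists k.
by apply/seteqP; split=> w; rewrite /mkset e.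
Qed.

Lemma prob_capacity_ge n a :
  fine (P [set w | a <= capacity P S (walk_range S n w)]) = @prob R d n a.
Proof.
rewrite /prob -(law_walk (fun s => a <= capw R s) n).
have ind w : ~ bad w -> [set w | a <= capacity P S (walk_range S n w)] w <->
   (past n @^-1` [set s | a <= capw R s]) w.
  by move=> nb /=; rewrite capacity_capw.
have [mn mp] : measurable [set w | a <= capacity P S (walk_range S n w)] /\
    measurable (past n @^-1` [set s | a <= capw R s]).
  by split; [exact: (measurable_capacity n [set x | a <= x])|exact: past_discrete].
apply/eqP; rewrite eq_le; apply/andP; split;
  apply: (prob_le_null _ _ measurable_bad prob_bad) => // w hw;
  by case: (pselect (bad w)) => bw; [right|left; apply/(ind w bw)].
Qed.

Variable gamma : R.
Hypothesis hgamma : is_capacity_speed P S gamma.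

Let dev n e : set Omega :=
  [set w | e <= `|n%:R^-1 * capacity P S (walk_range S n w) - gamma|].

Let measurable_dev n e : measurable (dev n e).
Proof. exact: (measurable_capacity n [set z | e <= `|n%:R^-1 * z - gamma|]). Qed.

(** The tail unions [B N] decrease to an event on which the convergence fails. *)
Lemma capacity_speed_in_prob (e ep : R) : 0 < e -> 0 < ep ->
  exists n0, forall n, (n0 <= n)%N -> fine (P (dev n e)) <= ep.
Proof.
move=> e0 ep0; pose B N := \bigcup_(n >= N) dev n e.
have mB N : measurable (B N) by apply: bigcup_measurable => n _; exact: measurable_dev.
have mI : measurable (\bigcap_N B N) by apply: bigcap_measurable => // N _.
have B0 : P (\bigcap_N B N) = 0%E.
  apply/negligibleP => //; apply: negligibleS hgamma => w /= hw cv.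
  have /cvgrPdist_lt/(_ e e0) [N _ hN] := cv.
  have [n /= Nn] := hw N Logic.I; rewrite /dev /= leNgt => /negP; apply.
  by have := hN n Nn; rewrite distrC.
have cvB : (P \o B) @ \oo --> P (\bigcap_N B N).
  apply: nonincreasing_cvg_mu => //.
    by rewrite (le_lt_trans (probability_le1 _ _)) ?ltry.
  apply/nonincreasing_seqP => N; apply/subsetPset => w [n /= Nn dn].
  by exists n => //=; exact: ltnW.
have cf : (fun N => fine (P (B N))) @ \oo --> (0 : R).
  by apply: fine_cvg; rewrite -[X in _ --> X]B0.
have /cvgrPdist_le/(_ ep ep0) [N _ hN] := cf.
exists N => n Nn; have := hN N (leqnn N); rewrite sub0r normrN => h.
apply: le_trans (le_trans (ler_norm _) h).
rewrite fine_le ?prob_fin_num//.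
by apply: le_measure; rewrite ?inE//; move=> w dw; exists n.
Qed.

Lemma prob_above_speed (e ep : R) : 0 < e -> 0 < ep ->
  exists n0, forall n, (n0 <= n)%N -> @prob R d n (n%:R * (gamma + e)) <= ep.
Proof.
move=> e0 ep0; have [n0 hn0] := capacity_speed_in_prob e0 ep0.
exists (maxn n0 1) => n; rewrite geq_max => /andP[/hn0 h n1].
apply: le_trans h; rewrite -prob_capacity_ge.
have n1R : 0 < n%:R :> R by rewrite ltr0n.
pose A := [set w | n%:R * (gamma + e) <= capacity P S (walk_range S n w)].
have mA : measurable A by exact: (measurable_capacity n [set z | _ <= z]).
have mD := measurable_dev n e.
rewrite -/A fine_le ?prob_fin_num//; apply: le_measure; rewrite ?inE//.
move=> w /= hw; rewrite /dev /=; apply: le_trans (ler_norm _).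
by rewrite lerBrDl mulrC ler_pdivlMr// mulrC.
Qed.

Lemma prob_below_speed (e ep : R) : 0 < e -> 0 < ep ->
  exists n0, forall n, (n0 <= n)%N -> 1 - ep <= @prob R d n (n%:R * (gamma - e)).
Proof.
move=> e0 ep0; have [n0 hn0] := capacity_speed_in_prob e0 ep0.
exists (maxn n0 1) => n; rewrite geq_max => /andP[/hn0 h n1].
have n1R : 0 < n%:R :> R by rewrite ltr0n.
rewrite lerBlDr; apply: (@le_trans _ _ (@prob R d n (n%:R * (gamma - e)) + fine (P (dev n e)))); last by rewrite lerD2l.
rewrite -prob_capacity_ge.
pose A := [set w | n%:R * (gamma - e) <= capacity P S (walk_range S n w)].
have mA : measurable A by exact: (measurable_capacity n [set z | _ <= z]).
have mD := measurable_dev n e.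
rewrite -/A -fineD ?prob_fin_num//.
rewrite -[1]/(fine 1%E) -(probability_setT P) fine_le ?prob_fin_num//.
  by rewrite fin_numD !prob_fin_num.
apply: le_trans (measureU2 _ mA mD).
apply: le_measure; rewrite ?inE//; first exact: measurableU.
move=> w _ /=; case: (leP (n%:R * (gamma - e)) (capacity P S (walk_range S n w))) => hw.
  by left.
right; rewrite /dev /= distrC; apply: le_trans (ler_norm _).
by rewrite lerBrDl -lerBrDr mulrC ler_pdivrMr// mulrC ltW.
Qed.

(** If gamma were negative, the negative level gamma/2 would be exceeded with probability at most
    1/2, although capacities are nonnegative. *)
Lemma speed_ge0 : 0 <= gamma.
Proof.
rewrite leNgt; apply/negP => g0.
have e0 : 0 < - gamma / 2 by rewrite divr_gt0// oppr_gt0.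
have h2 : 0 < 2^-1 :> R by [].
have [n0 h] := prob_above_speed e0 h2.
have := h n0 (leqnn _); rewrite leNgt => /negP; apply.
have -> : @prob R d n0 (n0%:R * (gamma + - gamma / 2)) = 1.
  rewrite -[RHS](avg_const d_gt0 n0); apply: eq_avg => w _.
  rewrite (_ : (_ <= _) = true)//; apply: le_trans (capw_ge0 R hd w).
  by rewrite mulr_ge0_le0//; lra.
by rewrite invf_lt1// ltr1n.
Qed.

End WalkLaw.

(** The limit is the liminf, obtained as the supremum of eventual lower bounds; one late term near
    it bounds all sufficiently later terms up to e. *)
Lemma cvgn_almost_decreasing (R : realType) (u : nat -> R) (M : R) :
  (forall n, 0 <= u n <= M) ->
  (forall e, 0 < e -> exists n0, forall n, (n0 <= n)%N ->
     exists N0, forall N, (N0 <= N)%N -> u N <= u n + e) ->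
  cvgn u.
Proof.
move=> ub dec; pose A := [set a | exists n0, forall n, (n0 <= n)%N -> a <= u n].
have AM : ubound A M.
  by move=> a [n0 h]; apply: le_trans (h n0 (leqnn _)) _; case/andP: (ub n0).
have sA : has_sup A by split; [exists 0, 0%N => n _; case/andP: (ub n)|exists M].
apply/cvg_ex; exists (sup A); apply/cvgrPdist_le => e e0.
have e2 : 0 < e / 2 by rewrite divr_gt0.
have [a [n1 h1] aA] := sup_adherent e2 sA.
have [n2 h2] := dec _ e2.
have [n n2n un] : exists2 n, (n2 <= n)%N & u n < sup A + e / 2.
  apply: contrapT => h; have : A (sup A + e / 2).
    by exists n2 => n hn; rewrite leNgt; apply/negP => hu; apply: h; exists n.
  by move=> /(ub_le_sup (proj2 sA)); lra.
have [N0 hN] := h2 n n2n.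
exists (maxn n1 N0) => // N /=; rewrite geq_max => /andP[/h1 k1 /hN k2].
by rewrite ler_norml; apply/andP; split; lra.
Qed.

(** * Finite-n rates and mixing of two levels *)

Section RateFunction.
Variables (R : realType) (d : nat).
Hypothesis hd : (5 <= d)%N.
Notation prob := (@prob R d).
Notation top := (@line_speed R d hd).
Notation entropy := (@entropy R d).

Let d_gt0 : (0 < d)%N. Proof. exact: leq_trans hd. Qed.

Definition rate (n : nat) (x : R) : R := - ln (prob n (n%:R * x)) / n%:R.

Lemma prob_ge_entropy n x : x <= top -> expR (- (n%:R * entropy)) <= prob n (n%:R * x).
Proof.
move=> xt; rewrite expR_entropy//; apply: (@prob_ge_word _ _ _ _ (line hd n)).
  exact: size_line.
by apply: le_trans (line_speed_le R hd n); rewrite ler_wpM2l.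
Qed.

Lemma prob_gt0 n x : x <= top -> 0 < prob n (n%:R * x).
Proof. by move=> /(prob_ge_entropy n); apply: lt_le_trans; exact: expR_gt0. Qed.

Lemma prob_rate n x : x <= top -> ln (prob n (n%:R * x)) = - (n%:R * rate n x).
Proof.
move=> xt; rewrite /rate; case: n => [|n]; last by rewrite [_ * (_ / _)]mulrC divfK ?opprK// pnatr_eq0.
have := prob_ge_entropy 0 xt; rewrite !mul0r oppr0 expR0 => h.
by rewrite (_ : prob 0 0 = 1) ?ln1//; apply/eqP; rewrite eq_le h prob_le1.
Qed.

Lemma rate_itv n x : x <= top -> 0 <= rate n x <= entropy.
Proof.
move=> xt; case: n => [|n]; first by rewrite /rate invr0 mulr0 lexx ltW// entropy_gt0.
have n0 : 0 < n.+1%:R :> R by [].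
rewrite -(pmulr_rge0 _ n0) -[rate _ _ <= _](ler_pM2l n0) -[_ * rate _ _]opprK -prob_rate//.
rewrite oppr_ge0 lerNl ln_le0 ?prob_le1//=.
by rewrite -[leLHS]expRK ler_ln ?posrE ?expR_gt0 ?prob_gt0// prob_ge_entropy.
Qed.

Lemma rate_mono n x y : x <= y -> y <= top -> rate n x <= rate n y.
Proof.
move=> xy yt; rewrite ler_wpM2r ?invr_ge0// lerN2 ler_ln ?posrE ?prob_gt0//.
  by apply: prob_anti; rewrite ler_wpM2l.
exact: le_trans yt.
Qed.

(* A fraction [t] of the blocks of length [n] is asked for level [x], the others
   for level [y]. *)
Lemma rate_mix (t x y e : R) : 0 <= t <= 1 -> x <= top -> y <= top -> 0 < e ->
  exists n0, forall n, (n0 <= n)%N -> exists N0, forall N, (N0 <= N)%N ->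
    rate N (t * x + (1 - t) * y - e) <= t * rate n x + (1 - t) * rate n y + e.
Proof.
move=> /andP[t0 t1] xt yt e0.
(* B bounds both |m| and |x - y|: it prices the time lost to connections and to rounding. *)
pose B := `|x| + `|y| + 1; pose G := green_bound R d.
have B0 : 0 < B by rewrite ltr_wpDl ?addr_ge0.
have G0 : 0 <= G by exact: green_bound_ge0.
have D0 : 0 < B + 12 * (G + 1) by lra.
pose m := t * x + (1 - t) * y.
have mB : `|m| <= B.
  apply: (le_trans (ler_normD _ _)); rewrite !normrM (ger0_norm t0) (@ger0_norm _ (1 - t)) ?subr_ge0//.
  rewrite /B ler_wpDr// lerD// ler_piMl// gerBl//.
have mt : m - e <= top.
  have : t * x <= t * top by rewrite ler_wpM2l.
  have : (1 - t) * y <= (1 - t) * top by rewrite ler_wpM2l// subr_ge0.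
  rewrite /m; lra.
(* Relative to q n, the connections lose B e' and the interaction 4 K loses 12 (G + 1) e', in all
   e/2; the other e/2 absorbs the rounding terms, which do not grow with N. *)
have [e' e'0 e'E] : exists2 e', 0 < e' & e' * (B + 12 * (G + 1)) = e / 2.
  exists (e / (2 * (B + 12 * (G + 1)))); first by rewrite divr_gt0// mulr_gt0.
  by field; rewrite gt_eqF.
have [n1 hn1] := choose_gap e'0.
exists (maxn n1 1) => n; rewrite geq_max => /andP[n1n n_gt0].
have [r [r0 rn gap]] := hn1 n n1n.
have nR : 0 < n%:R :> R by rewrite ltr0n.
have En : 0 < entropy by exact: entropy_gt0.
exists (maxn (n + r) (maxn (Num.truncn ((B * (2 * n%:R + r%:R)) / (e / 2))).+1
  (Num.truncn ((ln 2 + n%:R * entropy) / e)).+1)) => N.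
rewrite !geq_max => /and3P[Nnr N1 N2].
have {}N1 : B * (2 * n%:R + r%:R) <= N%:R * (e / 2).
  rewrite -ler_pdivrMr ?divr_gt0//; apply: le_trans (ltW (truncnS_gt _)) _.
  by rewrite ler_nat.
have {}N2 : ln 2 + n%:R * entropy <= N%:R * e.
  rewrite -ler_pdivrMr//; apply: le_trans (ltW (truncnS_gt _)) _.
  by rewrite ler_nat.
have nr0 : (0 < n + r)%N by rewrite addn_gt0 n_gt0.
have NE := divn_eq N (n + r); set q := (N %/ (n + r))%N in NE.
have q_gt0 : (0 < q)%N by rewrite divn_gt0 ?nr0.
have NR : 0 < N%:R :> R by rewrite ltr0n (leq_trans nr0).
have qR : 0 < q%:R :> R by rewrite ltr0n.
have Nq : q%:R * (n%:R + r%:R) <= N%:R :> R by rewrite -natrD -natrM ler_nat NE leq_addr.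
have qN : N%:R <= q%:R * (n%:R + r%:R) + (n%:R + r%:R) :> R.
  by rewrite -natrD -natrM -natrD ler_nat {1}NE leq_add2l ltnW// ltn_mod.
pose k := Num.truncn (t * q%:R).
have tq0 : 0 <= t * q%:R by rewrite mulr_ge0.
have [k1 k2] : k%:R <= t * q%:R /\ t * q%:R <= k%:R + 1.
  by have /andP[h1 h2] := truncn_itv tq0; split=> //; rewrite natr1 ltW.
have kq : (k <= q)%N.
  have : k%:R <= q%:R :> R by apply: (le_trans k1); rewrite ler_piMl.
  by rewrite ler_nat.
have qnN : q%:R * n%:R <= N%:R :> R by apply: le_trans Nq; rewrite ler_wpM2l ?lerDl.
pose a := nseq k (n%:R * x) ++ nseq (q - k) (n%:R * y).
have sa : size a = q by rewrite size_cat !size_nseq subnKC.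
have sumE : \sum_(s <- a) s = n%:R * (k%:R * x + (q%:R - k%:R) * y).
  rewrite big_cat /= !big_nseq !iter_addr_0 -natrB//; ring.
have prodE : \prod_(s <- a) prob n s =
    prob n (n%:R * x) ^+ k * prob n (n%:R * y) ^+ (q - k).
  by rewrite big_cat !big_nseq !iter_mulr_1.
(* G + 1 in place of G makes [K] positive, as [prob_blocks] requires. *)
pose K := q%:R * (3 * (G + 1) * (e' * n%:R)).
have K0 : 0 < K by rewrite /K !mulr_gt0// ltr_wpDl.
have hK : (size a)%:R * (3 * G * n.+1%:R ^+ 2 * decay R r) <= K.
  have -> : 3 * G * n.+1%:R ^+ 2 * decay R r = 3 * G * (n.+1%:R ^+ 2 * decay R r) by ring.
  rewrite sa ler_pM2l//; apply: ler_pM gap; first by rewrite mulr_ge0.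
    by rewrite mulr_ge0 ?decay_ge0.
  by rewrite ler_pM2l// lerDl.
have := prob_blocks hd r0 K0 hK; rewrite sa sumE prodE => hblocks.
have target : N%:R * (m - e) <= n%:R * (k%:R * x + (q%:R - k%:R) * y) - 4 * K.
  have h1 : n%:R * (q%:R * m) - n%:R * B <= n%:R * (k%:R * x + (q%:R - k%:R) * y).
    rewrite -mulrBr ler_pM2l//.
    have : (t * q%:R - k%:R) * (x - y) <= B.
      apply: le_trans (ler_norm _) _; rewrite normrM ger0_norm ?subr_ge0//.
      apply: (@le_trans _ _ (1 * `|x - y|)); first by rewrite ler_wpM2r//; lra.
      by rewrite mul1r; apply: le_trans (ler_normB _ _) _; rewrite /B; lra.
    rewrite /m; lra.
  have h2 : (N%:R - q%:R * n%:R) * m <= B * (q%:R * r%:R + n%:R + r%:R).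
    apply: le_trans (ler_norm _) _; rewrite normrM ger0_norm ?subr_ge0// mulrC.
    by apply: ler_pM => //; [rewrite subr_ge0|move: qN; rewrite !mulrDr; lra].
  have h3 : B * (q%:R * r%:R) <= B * (q%:R * (e' * n%:R)).
    by rewrite ler_pM2l// ler_pM2l.
  have h4 : q%:R * n%:R * (e / 2) <= N%:R * (e / 2) by rewrite ler_pM2r// divr_gt0.
  have h5 : B * (q%:R * (e' * n%:R)) + 4 * K = q%:R * n%:R * (e / 2).
    by rewrite -e'E /K; ring.
  move: N1 h1 h2 h3 h4 h5; clear; lra.
have hp : 2^-1 * (prob n (n%:R * x) ^+ k * prob n (n%:R * y) ^+ (q - k)) <=
    prob N (N%:R * (m - e)).
  apply: le_trans hblocks _; apply: le_trans (prob_anti d (q * (n + r)) target) _.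
  by apply: prob_mono => //; rewrite NE leq_addr.
have px := prob_gt0 n xt; have py := prob_gt0 n yt; have pm := prob_gt0 N mt.
move: hp; rewrite -ler_ln ?posrE ?mulr_gt0 ?exprn_gt0//.
rewrite lnM ?posrE ?mulr_gt0 ?exprn_gt0// lnV ?posrE// lnM ?posrE ?exprn_gt0//.
rewrite !lnXn// !prob_rate// => hl.
have /andP[x0 x1] := rate_itv n xt; have /andP[y0 y1] := rate_itv n yt.
set fx := rate n x in x0 x1 hl *; set fy := rate n y in y0 y1 hl *.
rewrite -(ler_pM2l NR); apply: (@le_trans _ _ (ln 2 + n%:R * (k%:R * fx + (q%:R - k%:R) * fy))).
  by move: hl; rewrite -(mulr_natl _ k) -(mulr_natl _ (q - k)) natrB//; lra.
have h6 : k%:R * fx + (q%:R - k%:R) * fy <= q%:R * (t * fx + (1 - t) * fy) + entropy.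
  have h7 : k%:R * fx <= t * q%:R * fx by rewrite ler_wpM2r.
  have h8 : (t * q%:R - k%:R) * fy <= 1 * entropy.
    by apply: ler_pM => //; lra.
  move: h7 h8; lra.
have h9 : n%:R * (k%:R * fx + (q%:R - k%:R) * fy) <=
    n%:R * (q%:R * (t * fx + (1 - t) * fy) + entropy) by rewrite ler_pM2l.
have h10 : q%:R * n%:R * (t * fx + (1 - t) * fy) <= N%:R * (t * fx + (1 - t) * fy).
  by rewrite ler_wpM2r// addr_ge0// mulr_ge0// subr_ge0.
move: h9 h10 N2; rewrite [N%:R * (_ + e)]mulrDr; lra.
Qed.

End RateFunction.

(** * Limit rate: existence, continuity, convexity *)

Section LimitRate.
Variables (R : realType) (d : nat).
Hypothesis hd : (5 <= d)%N.
Notation prob := (@prob R d).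
Notation top := (@line_speed R d hd).
Notation entropy := (@entropy R d).
Notation rate := (@rate R d).

Definition lrate (x : R) : R := limn (rate ^~ x).

(* Mixing with [top] raises the level by [(1 - t) (top - x)], which pays for
   the loss [e]. *)
Lemma is_cvg_rate_lt x : x < top -> cvgn (rate ^~ x).
Proof.
have entropy0 := entropy_gt0 R hd.
move=> xt; apply: (@cvgn_almost_decreasing _ _ entropy) => [n|e e0].
  by apply: rate_itv; exact: ltW.
have D0 : 0 < top - x by rewrite subr_gt0.
have D1 : 0 < e + (entropy + (top - x)) by rewrite addr_gt0// addr_gt0.
(* The share s of blocks at [top] costs at most s entropy, and the allowed loss s (top - x) equals
   the level gained; together they stay below e. *)
pose s := e / (e + (entropy + (top - x))).
have s0 : 0 < s by rewrite divr_gt0.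
have s1 : s <= 1 by rewrite /s ler_pdivrMr// mul1r lerDl addr_ge0 ?ltW.
have sD : s * (entropy + (top - x)) <= e.
  by rewrite /s mulrAC ler_pdivrMr// ler_pM2l// lerDr ltW.
have t01 : 0 <= 1 - s <= 1 by lra.
have [n0 hn0] := rate_mix t01 (ltW xt) (lexx top) (mulr_gt0 s0 D0).
exists n0 => n /hn0[N0 hN0]; exists N0 => N /hN0.
rewrite (_ : _ - s * (top - x) = x); last by ring.
have /andP[x0 _] := rate_itv n (ltW xt); have /andP[_ top1] := rate_itv n (lexx top).
have := ler_wpM2l (ltW s0) top1; have := mulr_ge0 (ltW s0) x0.
move: sD; clear; lra.
Qed.

Lemma rate_near_top (eta : R) : 0 < eta ->
  exists2 ep, 0 < ep & exists n0, forall n, (n0 <= n)%N -> entropy - eta <= rate n (top - ep).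
Proof.
move=> eta0; have [ep ep0 [n0 hn0]] := prob_near_top hd eta0.
exists ep => //; exists (maxn n0 1) => n; rewrite geq_max => /andP[/hn0 + n1].
have te : top - ep <= top by rewrite gerBl ltW.
have nR : 0 < n%:R :> R by rewrite ltr0n.
rewrite -ler_ln ?posrE ?expR_gt0 ?(prob_gt0 _ te)// expRK (prob_rate n te).
by rewrite lerN2 ler_pM2l.
Qed.

(** No higher level is left to absorb a loss here; the limit comes from the upper bound log(2d) and
    the corner estimate just below [top]. *)
Lemma cvg_rate_top : rate ^~ top @ \oo --> entropy.
Proof.
apply/cvgrPdist_le => e e0; have [ep ep0 [n0 hn0]] := rate_near_top e0.
exists n0 => // n /hn0 h.
have := @rate_mono R d hd n (top - ep) top; rewrite gerBl (ltW ep0) lexx => /(_ isT isT).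
have /andP[_ h2] := rate_itv n (lexx top).
by move=> h3; rewrite ger0_norm ?subr_ge0//; lra.
Qed.

Lemma cvg_rate x : x <= top -> rate ^~ x @ \oo --> lrate x.
Proof.
rewrite le_eqVlt => /orP[/eqP->|]; last exact: is_cvg_rate_lt.
by apply/cvg_ex; exists entropy; exact: cvg_rate_top.
Qed.

Lemma lrate_top : lrate top = entropy.
Proof. exact: (cvg_lim _ cvg_rate_top). Qed.

Lemma lrate_le x a : x <= top ->
  (exists n0, forall n, (n0 <= n)%N -> rate n x <= a) -> lrate x <= a.
Proof.
move=> xt [n0 h]; apply: limr_le; first exact: cvg_rate.
by exists n0.
Qed.

Lemma lrate_ge x a : x <= top ->
  (exists n0, forall n, (n0 <= n)%N -> a <= rate n x) -> a <= lrate x.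
Proof.
move=> xt [n0 h]; apply: limr_ge; first exact: cvg_rate.
by exists n0.
Qed.

Lemma lrate_ge0 x : x <= top -> 0 <= lrate x.
Proof.
move=> xt; apply: lrate_ge => //; exists 0%N => n _.
by have /andP[] := rate_itv n xt.
Qed.

Lemma lrate_le_entropy x : x <= top -> lrate x <= entropy.
Proof.
move=> xt; apply: lrate_le => //; exists 0%N => n _.
by have /andP[] := rate_itv n xt.
Qed.

Lemma lrate_mono x y : x <= y -> y <= top -> lrate x <= lrate y.
Proof.
move=> xy yt; apply: ler_lim; [exact: cvg_rate (le_trans xy yt)|exact: cvg_rate|].
by apply: nearW => n; exact: rate_mono yt.
Qed.

Lemma lrate_mix (t x y e : R) : 0 <= t <= 1 -> x <= top -> y <= top -> 0 < e ->
  lrate (t * x + (1 - t) * y - e) <= t * lrate x + (1 - t) * lrate y + e.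
Proof.
move=> t01 xt yt e0; have [n0 hn0] := rate_mix t01 xt yt e0.
have mt : t * x + (1 - t) * y - e <= top.
  have /andP[t0 t1] := t01.
  have : t * x <= t * top by rewrite ler_wpM2l.
  have : (1 - t) * y <= (1 - t) * top by rewrite ler_wpM2l// subr_ge0.
  move: e0; clear; lra.
have h n : (n0 <= n)%N -> lrate (t * x + (1 - t) * y - e) <= t * rate n x + (1 - t) * rate n y + e.
  by move=> /hn0 h; apply: lrate_le.
have cv : (fun n => t * rate n x + (1 - t) * rate n y + e) @ \oo -->
    t * lrate x + (1 - t) * lrate y + e.
  by apply: cvgD; [apply: cvgD; apply: cvgMr; exact: cvg_rate|exact: cvg_cst].
rewrite -(cvg_lim _ cv)//; apply: limr_ge; first exact: cvgP cv.
by exists n0.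
Qed.

(** For z < top, w is mixed with [top] so as to overshoot z by e', the loss of [lrate_mix]; as e'
    shrinks, the weight of [top] tends to (z - w)/(top - w). *)
Lemma lrate_lipschitz w z : w < top -> w <= z -> z <= top ->
  lrate z <= lrate w + entropy * ((z - w) / (top - w)).
Proof.
have entropy0 := entropy_gt0 R hd.
move=> wt wz; rewrite le_eqVlt => /orP[/eqP->|zt].
  rewrite divff ?subr_eq0 ?gt_eqF// mulr1 lrate_top lerDr lrate_ge0//; exact: ltW.
have D0 : 0 < top - w by rewrite subr_gt0.
apply/ler_addgt0Pr => e e0.
have De : 0 < entropy / (top - w) + 1 by rewrite addr_gt0// divr_gt0.
pose e' := Num.min (top - z) (e / (entropy / (top - w) + 1)).
have e'0 : 0 < e' by rewrite lt_min subr_gt0 zt divr_gt0.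
have e'1 : e' <= top - z by rewrite ge_min lexx.
have e'2 : e' * (entropy / (top - w) + 1) <= e by rewrite -ler_pdivlMr// ge_min lexx orbT.
pose s := (z - w + e') / (top - w).
have s01 : 0 <= 1 - s <= 1.
  rewrite subr_ge0 gerBl ler_pdivrMr// mul1r divr_ge0 ?(ltW D0)//; last by lra.
  by rewrite andbT; lra.
have := lrate_mix s01 (ltW wt) (lexx top) e'0.
have sE : s * (top - w) = z - w + e' by rewrite divfK ?gt_eqF.
rewrite (_ : _ - e' = z); last first.
  rewrite (_ : _ - e' = w + s * (top - w) - e'); last by ring.
  by rewrite sE; ring.
rewrite lrate_top => /le_trans; apply.
have sE2 : s * entropy = entropy * ((z - w) / (top - w)) + e' * (entropy / (top - w)).
  by rewrite /s; ring.
have s0 : 0 <= s by lra.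
have := mulr_ge0 s0 (lrate_ge0 (ltW wt)).
move: sE2 e'2; rewrite mulrDr mulr1; lra.
Qed.

(** The Lipschitz bound degenerates at [top], where the corner estimate takes over. *)
Lemma lrate_continuous z (e : R) : z <= top -> 0 < e ->
  exists2 del, 0 < del & forall w, w <= top -> `|z - w| < del -> `|lrate z - lrate w| <= e.
Proof.
have entropy0 := entropy_gt0 R hd.
rewrite le_eqVlt => /orP[/eqP->|zt] e0.
  have [ep ep0 h] := rate_near_top e0; exists ep => // w wt wz.
  have h1 : entropy - e <= lrate (top - ep) by apply: lrate_ge => //; rewrite gerBl ltW.
  have h2 : lrate (top - ep) <= lrate w.
    by apply: lrate_mono => //; move: wz; rewrite ger0_norm ?subr_ge0//; lra.
  have h3 := lrate_le_entropy wt.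
  by rewrite lrate_top ger0_norm ?subr_ge0//; lra.
have D0 : 0 < top - z by rewrite subr_gt0.
have De : 0 < e * (top - z) / entropy by rewrite divr_gt0// mulr_gt0.
exists (e * (top - z) / entropy) => // w wt zw.
have zw2 : entropy * (`|z - w| / (top - z)) <= e.
  rewrite mulrA ler_pdivrMr// mulrC -ler_pdivlMr//; exact: ltW.
case: (leP w z) => h.
  have wz : w < top by exact: le_lt_trans zt.
  have h1 := lrate_lipschitz wz h (ltW zt).
  have h2 := lrate_mono h (ltW zt).
  rewrite ger0_norm ?subr_ge0// lerBlDl; apply: (le_trans h1); rewrite lerD2l.
  apply: le_trans zw2; rewrite ler_pM2l// ger0_norm ?subr_ge0//.
  rewrite ler_wpM2l ?subr_ge0// lef_pV2 ?posrE ?subr_gt0// lerD2l lerN2//.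
have h1 := lrate_lipschitz zt (ltW h) wt.
have h2 := lrate_mono (ltW h) wt.
rewrite distrC ger0_norm ?subr_ge0// lerBlDl; apply: (le_trans h1); rewrite lerD2l.
by apply: le_trans zw2; rewrite ler_pM2l// distrC ger0_norm// subr_ge0 ltW.
Qed.

(** Continuity at m removes the loss e' of [lrate_mix]. *)
Lemma lrate_convex (t x y : R) : 0 <= t <= 1 -> x <= top -> y <= top ->
  lrate (t * x + (1 - t) * y) <= t * lrate x + (1 - t) * lrate y.
Proof.
move=> t01 xt yt; set m := t * x + _.
have mt : m <= top.
  have /andP[t0 t1] := t01.
  have : t * x <= t * top by rewrite ler_wpM2l.
  have : (1 - t) * y <= (1 - t) * top by rewrite ler_wpM2l// subr_ge0.
  rewrite /m; clear; lra.
apply/ler_addgt0Pr => e e0; have e2 : 0 < e / 2 by rewrite divr_gt0.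
have [del del0 hdel] := lrate_continuous mt e2.
pose e' := Num.min (e / 2) (del / 2).
have e'0 : 0 < e' by rewrite lt_min !divr_gt0.
have e'1 : e' <= e / 2 by rewrite ge_min lexx.
have e'2 : e' <= del / 2 by rewrite ge_min lexx orbT.
have := lrate_mix t01 xt yt e'0; rewrite -/m => h1.
have : `|lrate m - lrate (m - e')| <= e / 2.
  by apply: hdel; [lra|rewrite opprD addNKr opprK gtr0_norm//; lra].
move=> /(le_trans (ler_norm _)); lra.
Qed.

End LimitRate.

(** * The function psi on both sides of gamma and of gamma* *)

Section Psi.
Variables (R : realType) (disp : measure_display) (Omega : measurableType disp).
Variables (P : probability Omega R) (d : nat).
Hypothesis hd : (5 <= d)%N.
Variable S : nat -> Omega -> 'rV[int]_d.
Hypothesis hS : simple_random_walk P S.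
Notation prob := (@prob R d).
Notation top := (@line_speed R d hd).
Notation entropy := (@entropy R d).
Notation rate := (@rate R d).
Notation lrate := (@lrate R d).

Lemma log_prob_rateE x n : x <= top -> log_prob_rate P S x n = (- rate n x)%:E.
Proof.
move=> xt; rewrite /log_prob_rate -fineP_K; last first.
  exact: (measurable_capacity hd hS n [set a | n%:R * x <= a]).
rewrite (prob_capacity_ge hd hS) lne_EFin ?(prob_gt0 _ xt)//.
rewrite -EFinM; congr EFin.
by rewrite -[RHS]/(- (- ln (prob n (n%:R * x)) / n%:R)) mulNr opprK mulrC.
Qed.

Lemma cvg_log_prob_rate x : x <= top -> log_prob_rate P S x @ \oo --> (- lrate x)%:E.
Proof.
move=> xt; rewrite (_ : log_prob_rate P S x = EFin \o (fun n => - rate n x)); last first.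
  by apply/funext => n /=; exact: log_prob_rateE.
by apply: cvg_EFin; [exact: nearW|apply: cvgN; exact: cvg_rate].
Qed.

Lemma psiE x : x <= top -> psi P S x = (lrate x)%:E.
Proof. by move=> xt; rewrite /psi (cvg_lim _ (cvg_log_prob_rate xt))// EFinN oppeK. Qed.

Lemma prob_eq0_above x : top < x ->
  exists n0, forall n, (n0 <= n)%N -> prob n (n%:R * x) = 0.
Proof.
move=> tx; have e0 : 0 < (x - top) / 2 by rewrite divr_gt0// subr_gt0.
have [n0 hn0] := line_speed_approx hd e0.
exists (maxn n0 1) => n; rewrite geq_max => /andP[/hn0 h n1].
rewrite -[RHS](avg0 R d n); apply: eq_avg => w sw.
have nR : 0 < n%:R :> R by rewrite ltr0n.
suff -> : (n%:R * x <= capw R w) = false by [].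
apply/negbTE; rewrite -ltNge.
apply: le_lt_trans (path_cap_le_line R hd w) _; rewrite sw.
by apply: (le_lt_trans h); rewrite ltr_pM2l//; lra.
Qed.

Lemma cvg_log_prob_rate_above x : top < x -> log_prob_rate P S x @ \oo --> -oo%E.
Proof.
move=> /prob_eq0_above[n0 h]; apply: cvg_near_cst.
exists (maxn n0 1) => // n /=; rewrite geq_max => /andP[/h p0 n1].
rewrite /log_prob_rate -fineP_K; last first.
  exact: (measurable_capacity hd hS n [set a | n%:R * x <= a]).
rewrite (prob_capacity_ge hd hS) p0 le0_lneNy//.
by rewrite gt0_muleNy// lte_fin invr_gt0 ltr0n.
Qed.

Lemma psi_above x : top < x -> psi P S x = +oo%E.
Proof. by move=> tx; rewrite /psi (cvg_lim _ (cvg_log_prob_rate_above tx)). Qed.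

Variable gamma : R.
Hypothesis hgamma : is_capacity_speed P S gamma.

(** If gamma were at least [top], the level top - ep would be reached with probability at least 2/3
    for large n, against the exponential decay there. *)
Lemma speed_lt_top : gamma < top.
Proof.
rewrite ltNge; apply/negP => tg.
have e2 : 0 < entropy / 2 by rewrite divr_gt0// entropy_gt0.
have [ep ep0 [n0 hn0]] := rate_near_top hd e2.
have h3 : 0 < 3^-1 :> R by [].
have [n1 hn1] := prob_below_speed hd hS hgamma ep0 h3.
pose n := maxn (maxn n0 n1) (Num.truncn (ln 3 / (entropy / 2))).+1.
have te : top - ep <= top by rewrite gerBl ltW.
have h1 : entropy / 2 <= rate n (top - ep).
  by have := hn0 n; rewrite !leq_max leqnn => /(_ isT); lra.
have h2 : 3^-1 < prob n (n%:R * (top - ep)).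
  apply: lt_le_trans (prob_anti d n (ler_wpM2l (ler0n R n) (lerB tg (lexx ep)))).
  apply: lt_le_trans (hn1 n _); first by lra.
  by rewrite !leq_max leqnn orbT.
have h4 : ln 3 < n%:R * (entropy / 2).
  rewrite -ltr_pdivrMr//; apply: (lt_le_trans (truncnS_gt _)).
  by rewrite ler_nat leq_maxr.
move: h2; rewrite -ltr_ln ?posrE ?(prob_gt0 _ te)// lnV ?posrE// prob_rate//.
rewrite ltrN2 => /(lt_trans)/(_ h4); rewrite ltNge => /negP; apply.
by rewrite ler_wpM2l.
Qed.

(** Strictly below gamma the probabilities are eventually at least 1/2; the value at gamma follows
    by continuity. *)
Lemma lrate_below_speed x : x <= gamma -> lrate x = 0.
Proof.
have lt0 y : y < gamma -> lrate y <= 0.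
  move=> yg; have yt := ltW (lt_trans yg speed_lt_top).
  have e0 : 0 < gamma - y by rewrite subr_gt0.
  have h2 : 0 < 2^-1 :> R by [].
  have [n0 hn0] := prob_below_speed hd hS hgamma e0 h2.
  apply/ler_addgt0Pr => e ep0; rewrite add0r; apply: (lrate_le yt).
  exists (maxn n0 (Num.truncn (ln 2 / e)).+1) => n; rewrite geq_max => /andP[/hn0 + n1].
  rewrite (_ : gamma - (gamma - y) = y); last by ring.
  rewrite (_ : 1 - 2^-1 = 2^-1 :> R); last by field.
  move=> hp; have h : n%:R * rate n y <= ln 2.
    rewrite -lerN2 -(prob_rate _ yt) -lnV ?posrE// ler_ln ?posrE//.
    exact: prob_gt0 yt.
  have nR : 0 < n%:R :> R by rewrite ltr0n (leq_trans _ n1).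
  rewrite -(ler_pM2l nR); apply: (le_trans h).
  rewrite -ler_pdivrMr//; apply: (le_trans (ltW (truncnS_gt _))).
  by rewrite ler_nat.
move=> xg; have xt := ltW (le_lt_trans xg speed_lt_top).
apply/eqP; rewrite eq_le lrate_ge0// andbT.
apply/ler_addgt0Pr => e e0; rewrite add0r.
have [del del0 hdel] := lrate_continuous xt e0.
have yg : x - del / 2 < gamma by apply: lt_le_trans xg; rewrite gtrBl divr_gt0.
have := hdel (x - del / 2) (ltW (lt_trans yg speed_lt_top)).
rewrite subKr gtr0_norm ?divr_gt0// ltr_pdivrMr// => /(_ ltac:(lra)).
move=> /(le_trans (ler_norm _)); have := lt0 _ yg; lra.
Qed.

Lemma mean_cap_le x : gamma < x -> exists n, (0 < n)%N /\
  avg n (@capw R d) <= n%:R * (x - (x - gamma) / 2).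
Proof.
(* The target is gamma + 2 e: one e is the margin of the level, the other pays for the event above
   it, since (n + 1) e/2 <= n e. *)
move=> gx; pose e := (x - gamma) / 4; have e0 : 0 < e by rewrite divr_gt0// subr_gt0.
have ep0 : 0 < e / 2 by rewrite divr_gt0.
have [n0 hn0] := prob_above_speed hd hS hgamma e0 ep0.
exists n0.+1; split=> //; have := hn0 n0.+1 (leqnSn _); set n := n0.+1 => hp.
have n1 : 1 <= n%:R :> R by rewrite ler1n.
have g0 : 0 <= n%:R * (gamma + e).
  by rewrite mulr_ge0// addr_ge0 ?(ltW e0)// (speed_ge0 hd hS hgamma).
have d0 : (0 < d)%N by exact: leq_trans hd.
apply: (@le_trans _ _ (n%:R * (gamma + e) + n.+1%:R * prob n (n%:R * (gamma + e)))).
  rewrite -[X in X + _](avg_const d0 n) -[prob _ _]/(avg n _) -avgZ -avgD; apply: le_avg => w sw.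
  case: (leP _ (capw R w)) => h /=; last by rewrite mulr0 addr0 ltW.
  by rewrite mulr1 ler_wpDl// -sw; exact: capw_le_size.
have : n.+1%:R * prob n (n%:R * (gamma + e)) <= 2 * n%:R * (e / 2).
  by apply: ler_pM => //; [exact: prob_ge0|rewrite -natr1; lra].
rewrite (_ : x - _ = gamma + e + e); last by rewrite /e; field.
move: n1; rewrite (mulrDr n%:R (gamma + e)); lra.
Qed.

Lemma lrate_above_speed x : gamma < x -> x <= top -> 0 < lrate x.
Proof.
move=> gx xt; have [n [n0 hn]] := mean_cap_le gx.
have eta0 : 0 < (x - gamma) / 2 by rewrite divr_gt0// subr_gt0.
have x0 : 0 <= x by rewrite ltW// (le_lt_trans (speed_ge0 hd hS hgamma)).
have [c c0 [C hC]] := prob_exp_decay hd n0 x0 eta0 hn.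
have c2 : 0 < c / 2 by rewrite divr_gt0.
apply: (lt_le_trans c2); apply: (lrate_ge xt).
exists (Num.truncn (C / (c / 2))).+1 => N hN.
have NR : 0 < N%:R :> R by rewrite ltr0n (leq_trans _ hN).
have CN : C <= N%:R * (c / 2).
  rewrite -ler_pdivrMr//; apply: (le_trans (ltW (truncnS_gt _))).
  by rewrite ler_nat.
have := hC N; rewrite -ler_ln ?posrE ?expR_gt0 ?(prob_gt0 _ xt)// expRK prob_rate// => h.
by rewrite -(ler_pM2l NR); lra.
Qed.

(** Convexity and the zero at gamma: x = t gamma + (1 - t) y gives lrate x <= (1 - t) lrate y, and
    lrate y is positive. *)
Lemma lrate_increasing x y : gamma <= x -> x < y -> y <= top -> lrate x < lrate y.
Proof.
rewrite le_eqVlt => /orP[/eqP<-|gx] xy yt.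
  by rewrite lrate_below_speed// lrate_above_speed.
have gy := lt_trans gx xy; have gy0 : 0 < y - gamma by rewrite subr_gt0.
pose t := (y - x) / (y - gamma).
have t0 : 0 < t by rewrite divr_gt0// subr_gt0.
have t1 : t <= 1 by rewrite ler_pdivrMr// mul1r; lra.
have t01 : 0 <= t <= 1 by rewrite (ltW t0).
have := lrate_convex t01 (ltW speed_lt_top) yt.
rewrite (_ : t * gamma + _ = x); last first.
  rewrite (_ : _ + _ = y - t * (y - gamma)); last by ring.
  by rewrite divfK ?gt_eqF//; ring.
rewrite (lrate_below_speed (lexx gamma)) mulr0 add0r => /le_lt_trans; apply.
by rewrite gtr_pMl ?lrate_above_speed// gtrBl.
Qed.

End Psi.

Theorem theorem1p7 (R : realType) (disp : measure_display)
    (Omega : measurableType disp) (P : probability Omega R) (d : nat)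
    (hd : (5 <= d)%N) (S : nat -> Omega -> 'rV[int]_d)
    (hS : simple_random_walk P S) (gamma : R)
    (hgamma : is_capacity_speed P S gamma) :
  (forall x : R, 0 < x ->
     cvgn (log_prob_rate P S x) /\ (0 <= psi P S x)%E) /\
  exists gammastar : R,
    [/\ gamma < gammastar,
        {within `[0, gammastar], continuous (psi P S)},
        convex_function `[0, gammastar] (fun x : R => fine (psi P S x)),
        {in `[gamma, gammastar] &, forall x y : R,
           x < y -> (psi P S x < psi P S y)%E} &
        [/\ forall x : R, x <= gamma -> psi P S x = 0%E,
            forall x : R, gamma < x -> x <= gammastar ->
              (0 < psi P S x)%E /\ (psi P S x < +oo)%E &
            forall x : R, gammastar < x -> psi P S x = +oo%E]].
Proof.
have tg := speed_lt_top hd hS hgamma; have g0 := speed_ge0 hd hS hgamma.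
split=> [x x0|].
  case: (leP x (line_speed R hd)) => xt.
    split; first exact: (cvgP _ (cvg_log_prob_rate hS xt)).
    by rewrite (psiE hS xt) lee_fin lrate_ge0.
  (* Above gamma* the probabilities eventually vanish, and the limit is -oo in the extended
     reals. *)
  split; first exact: (cvgP _ (cvg_log_prob_rate_above hS xt)).
  by rewrite (psi_above hS xt).
exists (line_speed R hd); split=> //.
- move=> x; apply/subspace_continuousP: x => x xA.
  have xt : x <= line_speed R hd by move: xA; rewrite /= in_itv /= => /andP[].
  rewrite /from_subspace (psiE hS xt).
  (* On the interval [psi] takes the real values [lrate], so continuity is proved for these along
     neighbourhoods within the interval. *)
  have cv : @lrate R d y @[y --> within `[0, line_speed R hd] (nbhs x)] --> lrate d x.
    apply/cvgrPdist_le => e e0; have [del del0 h] := lrate_continuous xt e0.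
    near=> y; apply: h; last by near: y; apply: cvg_within; exact: nbhsx_ballx.
    have : `[0, line_speed R hd]%classic y by near: y; exact: withinT.
    by rewrite /= in_itv /= => /andP[].
  have cvE : (@lrate R d y)%:E @[y --> within `[0, line_speed R hd] (nbhs x)] --> (lrate d x)%:E.
    by apply: cvg_EFin cv; exact: nearW.
  apply: cvg_trans cvE; apply: near_eq_cvg; near=> y.
  have : `[0, line_speed R hd]%classic y by near: y; exact: withinT.
  by rewrite /= in_itv /= => /andP[_ /(psiE hS) ->].
- move=> t x y; rewrite !inE /= !in_itv /= => /andP[_ xt] /andP[_ yt].
  rewrite !convRE (psiE hS xt) (psiE hS yt) /unstable.onem /=.
  have t01 : 0 <= t%:num <= 1 by rewrite ge0 le1.
  have mt : t%:num * x + (1 - t%:num) * y <= line_speed R hd.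
    rewrite [leRHS](_ : _ = t%:num * line_speed R hd + (1 - t%:num) * line_speed R hd).
      by rewrite lerD// ler_wpM2l// subr_ge0; case/andP: t01.
    by rewrite -mulrDl addrC subrK mul1r.
  have -> : conv t x y = t%:num * x + (1 - t%:num) * y by [].
  by rewrite (psiE hS mt); exact: lrate_convex.
- move=> x y; rewrite !in_itv /= => /andP[gx xt] /andP[_ yt] xy.
  by rewrite (psiE hS xt) (psiE hS yt) lte_fin (lrate_increasing hS hgamma).
- split=> [x xg|x gx xt|x xt].
  + by rewrite (psiE hS (ltW (le_lt_trans xg tg))) (lrate_below_speed hd hS hgamma).
  + by rewrite (psiE hS xt) lte_fin (lrate_above_speed hS hgamma) ?ltry.
  + exact: psi_above.
Unshelve. all: by end_near.
Qed.
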